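(* Let $P\in\mathbb{Z}[X]$ be separable with $\deg P\ge 2$ and with positive leading coefficient. Assume that $$\liminf_{N\to\infty}\frac{\#\{1\le n\le N:\mu^2(P(n))=1\}}{N}>0.$$ Let $f$ be a Rademacher random multiplicative function. Then as $N\to+\infty$, $$\frac{1}{\sqrt{\#\{1\le n\le N:\mu^2(P(n))=1\}}}\sum_{1\le n\le N}f(P(n))\xrightarrow{d}\mathcal{N}(0,1),$$ where $\mathcal{N}(0,1)$ is the Gaussian distribution with mean $0$ and variance $1$ and $\xrightarrow{d}$ denotes convergence in distribution.
   Context: A polynomial is separable if it has no repeated roots in $\mathbb{C}$. A Rademacher random multiplicative function $f$ is defined as follows: $(f(p))_{p\text{ prime}}$ are i.i.d. random variables uniformly distributed on $\{1,-1\}$; for a square-free integer $n\ge1$, $f(n)=\prod_{p\mid n}f(p)$; and $f(n)=0$ if $n\ge 1$ is not square-free. Here $\mu$ is the Möbius function, so for $n\ge1$, $\mu^2(n)=1$ if $n$ is square-free and $0$ otherwise. Convention: if $P(n)\le 0$, then $f(P(n))=\mu^2(P(n))=0$. *)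

(* Defs.v *)
From HB Require Import structures.
From mathcomp Require Import all_boot all_order all_algebra finmap.
From mathcomp Require Import complex.
From mathcomp Require Import all_classical all_reals all_analysis.
From mathcomp Require Import measurable_realfun.
Set Implicit Arguments.
Unset Strict Implicit.
Unset Printing Implicit Defensive.
Import Order.TTheory GRing.Theory Num.Theory.
Import numFieldTopology.Exports numFieldNormedType.Exports.

Local Open Scope classical_set_scope.
Local Open Scope ring_scope.

(* The complex numbers are the type R[i] over the reals R. *)
Definition separable (R : realType) (P : {poly int}) : Prop :=
  forall z : R[i], (mup z (map_poly intr P : {poly R[i]}) <= 1)%N.

Definition squarefree (n : nat) : bool :=
  (0 < n)%N && all (fun p => ~~ (p ^ 2 %| n)%N) (primes n).

Definition moebius (n : nat) : int :=
  if squarefree n then (-1) ^+ size (primes n) else 0.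

(* Arithmetic functions are only meaningful at positive integers; ext0 g is   *)
(* g there and 0 at the integers m <= 0.                                      *)
Definition ext0 (A : nmodType) (g : nat -> A) (m : int) : A :=
  if 0 < m then g `|m|%N else 0.

(* #{1 <= n <= N : mu^2(P(n)) = 1} *)
Definition nb_squarefree_values (P : {poly int}) (N : nat) : nat :=
  count (fun n : nat => ext0 moebius P.[n%:Z] ^+ 2 == 1) (index_iota 1 N.+1).

Section Probability.
Context (d : measure_display) (T : measurableType d) (R : realType).
Variable Pr : probability T R.

(* Mutual independence of the family (X i), i in D. *)
Definition independent_family (I : choiceType) (D : set I)
    (X : I -> {RV Pr >-> R}) : Prop :=
  forall (J : {fset I}) (B : I -> set R),
    [set` J] `<=` D -> (forall i, measurable (B i)) ->
    Pr (\bigcap_(i in [set` J]) (X i @^-1` B i)) =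
    (\prod_(i <- J) Pr (X i @^-1` B i))%E.

Definition rademacher_law (X : {RV Pr >-> R}) : Prop :=
  Pr [set w | X w = 1] = (2^-1)%:E /\ Pr [set w | X w = -1] = (2^-1)%:E.

Record rademacher_multiplicative (f : nat -> {RV Pr >-> R}) : Prop := {
  rademacher_prime_law : forall p, prime p -> rademacher_law (f p);
  rademacher_prime_indep : independent_family [set p | prime p] f;
  rademacher_squarefree : forall n w, squarefree n ->
    f n w = \prod_(p <- primes n) f p w;
  rademacher_not_squarefree : forall n w, (0 < n)%N -> ~~ squarefree n ->
    f n w = 0
}.

(* Pointwise convergence of the cumulative distribution functions at every    *)
(* continuity point of the limiting one.                                      *)
Definition cvg_in_distribution (X : nat -> {RV Pr >-> R})
    (nu : probability (measurableTypeR R) R) : Prop :=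
  forall x : R, {for x, continuous (fun y : R => nu `]-oo, y]%classic)} ->
    (fun N => cdf (X N) x) @ \oo --> nu `]-oo, x]%classic.

Section NormalizedSum.
Variables (f : nat -> {RV Pr >-> R}) (P : {poly int}) (N : nat).

Definition normalized_sum (w : T) : R :=
  (Num.sqrt (nb_squarefree_values P N)%:R)^-1 *
  \sum_(1 <= n < N.+1) ext0 (fun k => f k w) P.[n%:Z].

Lemma measurable_normalized_sum : measurable_fun [set: T] normalized_sum.
Proof.
apply: measurable_funM; first exact: measurable_cst.
apply: measurable_sum => n; rewrite /ext0.
by case: (0 < P.[n%:Z]); [exact: measurable_funP | exact: measurable_cst].
Qed.

HB.instance Definition _ :=
  isMeasurableFun.Build _ _ T R normalized_sum measurable_normalized_sum.

End NormalizedSum.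

End Probability.

(* Main.v *)
(* Write S = sum of f(P(n)) over n <= N and s^2 for the number of squarefree
   positive values.  The values f(P(n)) are Walsh functions of the independent
   signs f(p), and S / s is shown to be asymptotically Gaussian by Stein's method:
   choose for each n a prime p_n > K dividing P(n) (only O_K(1) values have none);
   flipping the sign f(p_n) changes f(P(n)) into its opposite, so that
   E[f(P(n)) g(S / s)] is half of E[f(P(n)) (g(S / s) - g(S' / s))], where S - S'
   is twice the sum D of the f(P(m)) with p_n | P(m).  A Taylor expansion of g
   leaves second and fourth moments, which are governed by the number of
   nontrivial solutions of "P(a) P(b) P(c) P(d) is a square" in [1, N]^4.

   That number is O(N^(2 - delta)).  Let a be the largest variable; since the
   values are squarefree, d is determined by a, b, c, and P(a) divides the product
   of its gcds with P(b), P(c), P(d).  If two of these gcds, g and h, are larger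
   than a small power of N, then (g h)^3 >= P(a)^2 and (b, c) is counted by the
   roots of P modulo g and h.  Otherwise P(a) / P(b) = u / v with small u and v;
   then two solutions (a, b) are far apart, because their difference gives too good
   a rational approximation to the irrational number (u / v)^(1 / deg P).

   Stein's equation is only solved for compactly supported functions of Gaussian
   mean zero, whose solutions are compactly supported too; together with the
   bound on E[(S / s)^2] this yields the lower bounds for P(S / s <= x) and
   P(S / s > x). *)
Require Import Defs.
From HB Require Import structures.
From mathcomp Require Import all_boot all_order all_algebra finmap.
From mathcomp Require Import complex.
From mathcomp Require Import all_classical all_reals all_analysis.
From mathcomp Require Import measurable_realfun.
From mathcomp Require Import zify ring lra.
Set Implicit Arguments.
Unset Strict Implicit.
Unset Printing Implicit Defensive.
Import Order.TTheory GRing.Theory Num.Theory.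
Import numFieldTopology.Exports numFieldNormedType.Exports.

Local Open Scope classical_set_scope.
Local Open Scope ring_scope.

(** * Squarefree numbers *)

(** The positive lower density makes s^2 comparable to N, so the fourth-moment counts have to be
    small against N^2. Trivial solutions, in which the four variables pair off, save no power of N:
    they contribute the squared numbers of multiples of p, whose sum over the chosen p > K is O(N^2
    / K + N). This is why only primes above K are flipped, and why K is fixed before N tends to
    infinity. A nontrivial solution is counted once for each relevant prime factor of P(a), for
    which a bare o(N^2) might not be enough; the power saving absorbs this weight.

    The Taylor remainder is grouped by the value of p_n before absolute values are taken. Bounded n
    by n it could be as large as a multiple of s, whereas the sum of the f(P(n)) with a common p_n
    has second moment equal to their number.

    The variables f(p) are signs only almost surely, and the finite cube sees only the event on
    which they are. Lower bounds for two complementary probabilities are insensitive to the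
    exceptional event. *)

Lemma squarefree_gt0 n : squarefree n -> (0 < n)%N.
Proof. by case/andP. Qed.

Lemma squarefreeP n : (0 < n)%N ->
  reflect (forall p, prime p -> ~~ (p ^ 2 %| n)%N) (squarefree n).
Proof.
move=> n0; rewrite /squarefree n0 /=; apply: (iffP allP) => [h p pp|h p].
  apply/negP => pn; move: (h p); rewrite mem_primes pp n0 pn.
  by rewrite (dvdn_trans _ pn) ?dvdn_mulr// => /(_ isT).
by rewrite mem_primes => /andP[pp _]; apply: h.
Qed.

Lemma squarefree_dvd m n : (m %| n)%N -> squarefree n -> squarefree m.
Proof.
move=> mn sn; have n0 := squarefree_gt0 sn.
have m0 := dvdn_gt0 n0 mn.
apply/(squarefreeP m0) => p pp; apply/negP => pm.
by move/(squarefreeP n0): sn => /(_ p pp)/negP; apply; apply: dvdn_trans mn.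
Qed.

Lemma squarefree_logn n p : squarefree n -> (logn p n <= 1)%N.
Proof.
move=> sn; have n0 := squarefree_gt0 sn.
case pp : (prime p); last by rewrite lognE pp.
rewrite leqNgt -pfactor_dvdn//; by move/(squarefreeP n0): sn; apply.
Qed.

Lemma squarefree_prod n : squarefree n -> n = (\prod_(p <- primes n) p)%N.
Proof.
move=> sn; have n0 := squarefree_gt0 sn.
rewrite {1}(prod_prime_decomp n0) prime_decompE big_map /=.
apply: eq_big_seq => p; rewrite -logn_gt0 => lp.
have := squarefree_logn p sn; rewrite leq_eqVlt ltnNge lp orbF => /eqP ->.
by rewrite expn1.
Qed.

Lemma squarefree_dvdP n m : squarefree n ->
  (forall p, prime p -> p %| n -> p %| m)%N -> (n %| m)%N.
Proof.
move=> sn h; have n0 := squarefree_gt0 sn.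
have [->|m0] := posnP m; first by [].
apply/dvdn_partP => // p /[!mem_primes]/and3P[pp _ pn].
rewrite p_part pfactor_dvdn//; apply: leq_trans (squarefree_logn p sn) _.
by rewrite logn_gt0 mem_primes pp m0 h.
Qed.

Lemma squarefree_primes_inj n m : squarefree n -> squarefree m ->
  (forall p, prime p -> (p %| n)%N = (p %| m)%N) -> n = m.
Proof.
move=> sn sm h; apply/eqP; rewrite eqn_dvd; apply/andP; split;
  by apply: squarefree_dvdP => // p pp; rewrite h.
Qed.

(** A divisor of a squarefree number is recovered from the set of its primes. *)
Lemma size_divisors_squarefree n : squarefree n ->
  (size (divisors n) <= 2 ^ size (primes n))%N.
Proof.
move=> sn; have n0 := squarefree_gt0 sn.
pose g (m : nat) : {set 'I_(size (primes n))} :=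
  finset.finset (fun i : 'I__ => nth 0%N (primes n) i %| m)%N.
have -> : (2 ^ size (primes n))%N = #|{set 'I_(size (primes n))}|.
  by rewrite -cardsT -powersetT card_powerset cardsT card_ord.
apply: leq_trans (max_card (mem (map g (divisors n)))).
rewrite (card_uniqP _) ?size_map// map_inj_in_uniq ?divisors_uniq// => a b.
rewrite -!dvdn_divisors// => an bn gab.
apply: squarefree_primes_inj; [exact: squarefree_dvd an _|exact: squarefree_dvd bn _|].
move=> p pp; have [pn|] := boolP (p \in primes n); last first.
  rewrite mem_primes pp n0 /= => pn.
  by transitivity false; [|symmetry]; apply: contraNF pn => /dvdn_trans; apply.
have ip : (index p (primes n) < size (primes n))%N by rewrite index_mem.
move/setP: gab => /(_ (Ordinal ip)); rewrite !inE /= nth_index//.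
Qed.

(* Only the elements below k ^ r contribute a factor k ^ r that they do not absorb. *)
Lemma prod_ge_omega_pow (k r : nat) (s : seq nat) : (0 < k)%N -> uniq s ->
  (forall p, p \in s -> 0 < p)%N ->
  ((k ^ size s) ^ r <= (k ^ r) ^ (k ^ r) * \prod_(p <- s) p)%N.
Proof.
move=> k0 us ps; set b := (k ^ r)%N.
have b0 : (0 < b)%N by rewrite expn_gt0 k0.
have -> : ((k ^ size s) ^ r = \prod_(p <- s) b)%N.
  by rewrite big_const_seq count_predT iter_muln_1 /b -!expnM mulnC.
apply: (@leq_trans (\prod_(p <- s) ((if (p < b)%N then b else 1) * p))).
  elim: s us ps => [|p s IH] us ps; first by rewrite !big_nil.
  have p0 : (0 < p)%N by apply: ps; rewrite mem_head.
  rewrite !big_cons leq_mul//; first by case: ltnP; rewrite ?leq_pmulr ?mul1n.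
  case/andP: us => _ us; apply: IH => // q qs.
  by apply: ps; rewrite inE qs orbT.
rewrite big_split /= leq_mul2r; apply/orP; right.
rewrite -big_mkcond /= big_const_seq iter_muln_1 leq_pexp2l//.
rewrite -size_filter -{2}(size_iota 0 b) uniq_leq_size ?filter_uniq//.
by move=> x; rewrite mem_filter mem_iota add0n => /andP[].
Qed.

(** This is k^omega(n) = O(n^(1/r)) without roots. As r is arbitrary, factors exponential in the
    number of primes cost less than any power of n. *)
Lemma omega_pow_le (k r n : nat) : (0 < k)%N -> squarefree n ->
  ((k ^ size (primes n)) ^ r <= (k ^ r) ^ (k ^ r) * n)%N.
Proof.
move=> k0 sn; rewrite [n in leqRHS]squarefree_prod//.
apply: prod_ge_omega_pow => //; first exact: primes_uniq.
by move=> p; rewrite mem_primes => /and3P[/prime_gt0].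
Qed.

(** * Roots of integer polynomials modulo squarefree numbers *)

Definition absval (P : {poly int}) (n : nat) : nat := `|P.[n%:Z]|%N.

Definition nroots (P : {poly int}) (G : nat) : nat :=
  count (fun r => G %| absval P r)%N (iota 0 G).

(** The second summand covers the primes dividing the leading coefficient, modulo which P may vanish
    identically; for these the trivial count p is used. *)
Definition nroots_bound (P : {poly int}) : nat := (size P + `|lead_coef P|)%N.

Lemma dvdz_horner_sub (P : {poly int}) (a b : int) : (a - b %| P.[a] - P.[b])%Z.
Proof.
elim/poly_ind: P => [|P c IH]; first by rewrite !horner0 subrr dvdz0.
rewrite !hornerMXaddC.
have -> : P.[a] * a + c - (P.[b] * b + c) = (P.[a] - P.[b]) * a + P.[b] * (a - b).
  by ring.
by apply: rpredD; [apply: dvdz_mulr|apply: dvdz_mull].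
Qed.

Lemma dvd_absval_modn (P : {poly int}) (q G n : nat) : (q %| G)%N ->
  (q %| absval P (n %% G))%N = (q %| absval P n)%N.
Proof.
move=> qG; rewrite /absval -(absz_nat q) -!dvdzE.
have h : (q%:Z %| P.[n%:Z] - P.[(n %% G)%N%:Z])%Z.
  apply: dvdz_trans (dvdz_horner_sub _ _ _).
  rewrite subzn ?leq_mod// dvdzE !absz_nat.
  by rewrite {1}(divn_eq n G) addnK dvdn_mull.
rewrite -[in RHS](subrK P.[(n %% G)%N%:Z] P.[n%:Z]).
by rewrite (rpredDl _ (dvdz_trans _ h)).
Qed.

Lemma nroots_prime (P : {poly int}) (p : nat) : lead_coef P != 0 -> prime p ->
  (nroots P p <= nroots_bound P)%N.
Proof.
move=> l0 pp; rewrite /nroots /nroots_bound.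
have [pl|pl] := boolP (p %| `|lead_coef P|)%N.
  apply: leq_trans (count_size _ _) _; rewrite size_iota.
  by apply: leq_trans (dvdn_leq _ pl) (leq_addl _ _); rewrite absz_gt0.
apply: leq_trans (leq_addr _ _).
pose Q : {poly 'F_p} := map_poly intr P.
have castE (z : int) : (z%:~R == 0 :> 'F_p) = (p %| `|z|)%N.
  have h (n : nat) : (n%:R == 0 :> 'F_p) = (p %| n)%N.
    by rewrite -(dvdn_pcharf (pchar_Fp pp)).
  by case: z => n; rewrite ?NegzE ?mulrNz ?oppr_eq0 -?pmulrn ?abszN h.
have Q0 : Q != 0.
  apply/negP => /eqP /(congr1 (fun q : {poly 'F_p} => q`_(size P).-1)).
  by rewrite coef0 coef_map /= => /eqP; rewrite castE -lead_coefE (negPf pl).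
rewrite -size_filter; set s := seq.filter _ _.
rewrite -(size_map (fun r : nat => r%:R : 'F_p)).
have sQ : (size Q <= size P)%N by exact: size_poly.
apply: leq_trans (ltnW _) sQ; apply: max_poly_roots => //.
  apply/allP => _ /mapP[r + ->]; rewrite mem_filter /root => /andP[pr _].
  by rewrite pmulrn horner_map /= castE.
rewrite map_inj_in_uniq ?filter_uniq ?iota_uniq// => a b.
rewrite !mem_filter !mem_iota !add0n => /andP[_ /andP[_ ap]] /andP[_ /andP[_ bp]].
move/(congr1 (fun x : 'F_p => x : nat)); rewrite !val_Fp_nat//.
by rewrite !modn_small.
Qed.

(** By the Chinese remainder theorem a residue modulo m n is determined by its residues modulo m and
    n. *)
Lemma nroots_mul (P : {poly int}) (m n : nat) : (0 < m)%N -> (0 < n)%N ->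
  coprime m n -> (nroots P (m * n) <= nroots P m * nroots P n)%N.
Proof.
move=> m0 n0 mn; rewrite /nroots -!size_filter -(size_allpairs pair).
set s := seq.filter _ _; rewrite -(size_map (fun r => (r %% m, r %% n)%N) s).
apply: uniq_leq_size.
  rewrite map_inj_in_uniq ?filter_uniq ?iota_uniq// => a b.
  rewrite !mem_filter !mem_iota !add0n => /andP[_ /andP[_ al]] /andP[_ /andP[_ bl]].
  move=> [am an]; rewrite -(modn_small al) -(modn_small bl).
  by apply/eqP; rewrite chinese_remainder// am an !eqxx.
move=> _ /mapP[r + ->]; rewrite mem_filter => /andP[mnr _].
apply/allpairs_f; rewrite mem_filter mem_iota ltn_mod ?m0 ?n0 leq0n !andbT;
  rewrite dvd_absval_modn//; apply: dvdn_trans mnr;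
  by [exact: dvdn_mulr|exact: dvdn_mull].
Qed.

Lemma nroots_prod (P : {poly int}) (s : seq nat) : lead_coef P != 0 ->
  uniq s -> all prime s ->
  (nroots P (\prod_(p <- s) p) <= nroots_bound P ^ size s)%N.
Proof.
move=> l0; elim: s => [|p s IH] /=.
  by rewrite big_nil /nroots /= addn0; case: (_ %| _)%N.
move=> /andP[ps us] /andP[pp als]; rewrite big_cons expnS.
have s0 : (0 < \prod_(q <- s) q)%N.
  by rewrite big_seq prodn_cond_gt0// => q /(allP als)/prime_gt0.
apply: leq_trans (nroots_mul _ (prime_gt0 pp) s0 _) _; last first.
  by rewrite leq_mul ?nroots_prime ?IH.
rewrite big_seq; elim/big_rec: _ => [|q x qs cx]; first exact: coprimen1.
have pq := allP als _ qs; rewrite coprimeMr cx andbT prime_coprime//.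
by rewrite dvdn_prime2//; apply: contraNneq ps => ->.
Qed.

Lemma nroots_squarefree (P : {poly int}) (G : nat) : lead_coef P != 0 ->
  squarefree G -> (nroots P G <= nroots_bound P ^ size (primes G))%N.
Proof.
move=> l0 sG; rewrite {1}(squarefree_prod sG) nroots_prod ?primes_uniq//.
by apply/allP => p; rewrite mem_primes => /and3P[].
Qed.

Lemma count_dvd_absval (P : {poly int}) (G a : nat) : (0 < G)%N ->
  (count (fun b => G %| absval P b) (iota 0 a) <= nroots P G * (a %/ G).+1)%N.
Proof.
move=> G0; rewrite /nroots -!size_filter mulnC -[X in (_ <= X * _)%N](size_iota 0).
rewrite -(size_allpairs pair).
set s := seq.filter _ _; rewrite -(size_map (fun r => (r %/ G, r %% G)%N) s).
apply: uniq_leq_size.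
  rewrite map_inj_uniq ?filter_uniq ?iota_uniq// => x y /= [h1 h2].
  by rewrite (divn_eq x G) (divn_eq y G) h1 h2.
move=> _ /mapP[r + ->]; rewrite mem_filter mem_iota add0n => /and3P[Gr _ ra].
apply/allpairs_f; first by rewrite mem_iota add0n ltnS leq_div2r// ltnW.
by rewrite mem_filter mem_iota ltn_mod G0 andbT dvd_absval_modn ?Gr.
Qed.

(** * Proportional values of a polynomial *)

Lemma horner_le_pow (R : realFieldType) (Q : {poly R}) (k : nat) :
  (size Q <= k.+1)%N ->
  exists2 C : R, 0 <= C & forall x, 1 <= x -> `|Q.[x]| <= C * x ^+ k.
Proof.
move=> sQ; exists (\sum_(i < size Q) `|Q`_i|); first exact: sumr_ge0.
move=> x x1; rewrite horner_coef mulr_suml.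
apply: le_trans (ler_norm_sum _ _ _) _; apply: ler_sum => i _.
rewrite normrM ler_wpM2l// ger0_norm ?exprn_ge0 ?(le_trans ler01)//.
by rewrite ler_weXn2l// -ltnS (leq_trans _ sQ).
Qed.

Lemma coef_XaddC_exp (R : idomainType) (c : R) (n : nat) :
  [/\ (('X + c%:P) ^+ n.+1)`_n.+1 = 1, (('X + c%:P) ^+ n.+1)`_n = c *+ n.+1
    & forall j, (n.+1 < j)%N -> (('X + c%:P) ^+ n.+1)`_j = 0].
Proof.
have E : ('X + c%:P) ^+ n.+1 = \prod_(z <- nseq n.+1 (- c)) ('X - z%:P) :> {poly R}.
  by rewrite big_nseq polyCN opprK iter_mulr_1.
have sE : size (('X + c%:P) ^+ n.+1) = n.+2.
  by rewrite E size_prod_XsubC size_nseq.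
split.
- have := monic_prod_XsubC (nseq n.+1 (- c)) xpredT id.
  by rewrite -E => /monicP; rewrite lead_coefE sE.
- have := @coefPn_prod_XsubC _ (nseq n.+1 (- c)).
  rewrite size_nseq -E => /(_ isT) h; rewrite [LHS]h.
  by rewrite big_nseq iter_addr_0 mulNrn opprK.
- by move=> j nj; rewrite nth_default// sE.
Qed.

(* The shift by [c] absorbs the term of degree [e.+1]. *)
Lemma shifted_power_expansion (R : realFieldType) (P : {poly R}) (e : nat) :
  size P = e.+3 ->
  exists c, exists2 C, 0 <= C & forall x, 1 <= x ->
    `|P.[x] - lead_coef P * (x + c) ^+ e.+2| <= C * x ^+ e.
Proof.
move=> sP; set A := lead_coef P.
have A0 : A != 0 by rewrite lead_coef_eq0 -size_poly_eq0 sP.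
exists (P`_e.+1 / (A *+ e.+2)); set c := _ / _.
have [C C0 hC] : exists2 C : R, 0 <= C & forall x, 1 <= x ->
    `|(P - A *: ('X + c%:P) ^+ e.+2).[x]| <= C * x ^+ e.
  apply: horner_le_pow; apply/leq_sizeP => j.
  have [h1 h2 h3] := coef_XaddC_exp c e.+1.
  rewrite coefB coefZ leq_eqVlt => /predU1P[<-|].
    rewrite h2 mulrnAr -mulrnAl mulrC divfK ?subrr//.
    by rewrite mulrn_eq0 negb_or A0.
  rewrite leq_eqVlt => /predU1P[<-|ej].
    by rewrite h1 mulr1 /A lead_coefE sP subrr.
  by rewrite h3// mulr0 subr0 nth_default// sP.
exists C => // x /hC; rewrite hornerD hornerN hornerZ horner_exp.
by rewrite hornerD hornerX hornerC.
Qed.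

Lemma subr_expn_ge (R : realFieldType) (x y : R) (n : nat) : 0 <= x -> 0 <= y ->
  `|x - y| * x ^+ n <= `|x ^+ n.+1 - y ^+ n.+1|.
Proof.
move=> x0 y0; rewrite subrXX normrM ler_wpM2l// ger0_norm; last first.
  by apply: sumr_ge0 => i _; rewrite mulr_ge0 ?exprn_ge0.
rewrite big_ord_recl /= subn0 expr0 mulr1 lerDl.
by apply: sumr_ge0 => i _; rewrite mulr_ge0 ?exprn_ge0.
Qed.

Lemma subr_expn_le (R : realFieldType) (x y z : R) (n : nat) :
  0 <= x <= z -> 0 <= y <= z ->
  `|x ^+ n.+1 - y ^+ n.+1| <= `|x - y| * (n.+1%:R * z ^+ n).
Proof.
move=> /andP[x0 xz] /andP[y0 yz]; have z0 := le_trans x0 xz.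
rewrite subrXX normrM ler_wpM2l// ger0_norm; last first.
  by apply: sumr_ge0 => i _; rewrite mulr_ge0 ?exprn_ge0.
apply: (@le_trans _ _ (\sum_(i < n.+1) z ^+ n)).
  apply: ler_sum => i _; have -> : z ^+ n = z ^+ (n - i + i) by rewrite subnK// -ltnS.
  by rewrite exprD ler_pM ?exprn_ge0// lerXn2r// ?nnegrE.
by rewrite sumr_const card_ord mulr_natl.
Qed.

(** The quadratic lower bound makes P(a)^2 at least a^4 / 64, which is what the case of two large
    gcds consumes. *)
Lemma poly_eventually_increasing (R : realFieldType) (P : {poly R}) (e : nat) :
  size P = e.+3 -> 1 <= lead_coef P ->
  exists x0, forall x, x0 <= x -> x ^+ 2 <= 8%:R * P.[x] /\ P.[x] < P.[x + 1].
Proof.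
move=> sP A1; have [c [C C0 hC]] := shifted_power_expansion sP.
set A := lead_coef P in A1 hC.
have q0 : 0 <= 8%:R * C * 4%:R ^+ e by rewrite !mulr_ge0 ?exprn_ge0.
(* The threshold yields x >= 3, x + c >= x / 2 and an error term small against z^e x. The power 4^e
   pays once for x^e = 2^e z^e and once for (x + 1)^e <= 2^e x^e. *)
exists (3%:R + 2%:R * `|c| + 8%:R * C * 4%:R ^+ e) => x hx.
have c1 : - `|c| <= c by rewrite lerNl ler_normr lexx orbT.
have cge0 : 0 <= `|c| by [].
have x3 : 3%:R <= x by lra.
have xC : 8%:R * C * 4%:R ^+ e <= x - 3%:R by lra.
pose z := x / 2%:R; pose y := x + c.
have zy : z <= y by rewrite /z /y; lra.
have z1 : 1 <= z by rewrite /z; lra.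
have z0 : 0 <= z by lra.
have y0 : 0 <= y by lra.
have ze1 : 1 <= z ^+ e by rewrite exprn_ege1.
have yz k : z ^+ k <= y ^+ k by rewrite lerXn2r ?nnegrE.
have xz : x = 2%:R * z by rewrite /z mulrC divfK.
have Ax k : y ^+ k <= A * y ^+ k by rewrite ler_peMl ?exprn_ge0.
have e24 : 2%:R ^+ e * 2%:R ^+ e = 4%:R ^+ e :> R by rewrite -exprMn -natrM.
have p2 : 1 <= 2%:R ^+ e :> R by rewrite exprn_ege1 ?ler1n.
have Cz : C * x ^+ e * (8%:R * 2%:R ^+ e) <= z ^+ e * (x - 3%:R).
  rewrite xz exprMn.
  have -> : C * (2%:R ^+ e * z ^+ e) * (8%:R * 2%:R ^+ e) =
     z ^+ e * (8%:R * C * (2%:R ^+ e * 2%:R ^+ e)) by ring.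
  by rewrite e24 ler_wpM2l ?exprn_ge0// -xz.
have := hC x _; rewrite -/y => /(_ _)/ler_normlP[|h1 h2]; first lra.
have := hC (x + 1) _ => /(_ _)/ler_normlP[|h3 h4]; first lra.
have Cx0 : 0 <= C * x ^+ e by rewrite mulr_ge0 ?exprn_ge0//; lra.
have Cx8 : C * x ^+ e * 8%:R <= z ^+ e * (x - 3%:R).
  apply: le_trans Cz; rewrite ler_wpM2l// ler_peMr//.
split.
  have h5 := le_trans (yz e.+2) (Ax e.+2).
  have : 8%:R * (z ^+ e.+2 - C * x ^+ e) <= 8%:R * P.[x] by rewrite ler_pM2l//; lra.
  apply: le_trans; rewrite mulrBr.
  have -> : z ^+ e.+2 = z ^+ e * z ^+ 2 by rewrite -exprD addn2.
  apply: (@le_trans _ _ (z ^+ e * (8%:R * z ^+ 2 - (x - 3%:R)))); last by lra.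
  apply: (@le_trans _ _ (8%:R * z ^+ 2 - (x - 3%:R))).
    by rewrite xz; nra.
  by rewrite ler_peMl//; rewrite xz; nra.
have h5 : A * y ^+ e.+2 + y ^+ e.+1 <= A * (x + 1 + c) ^+ e.+2.
  have -> : x + 1 + c = y + 1 by rewrite /y; ring.
  have : y ^+ e.+2 + y ^+ e.+1 <= (y + 1) ^+ e.+2.
    have y10 : 0 <= y + 1 by lra.
    have := subr_expn_ge e.+1 y0 y10.
    have -> : `|y - (y + 1)| = 1 by rewrite opprD addNKr normrN1.
    have : y ^+ e.+2 <= (y + 1) ^+ e.+2 by rewrite lerXn2r ?nnegrE//; lra.
    by move=> yy; rewrite mul1r distrC ger0_norm ?subr_ge0//; lra.
  move=> hy; have : A * (y ^+ e.+2 + y ^+ e.+1) <= A * (y + 1) ^+ e.+2.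
    by rewrite ler_wpM2l//; lra.
  by rewrite mulrDr; have := Ax e.+1; lra.
have h6 : C * (x + 1) ^+ e <= 2%:R ^+ e * (C * x ^+ e).
  have xx : x + 1 <= 2%:R * x by lra.
  have x10 : 0 <= x + 1 by lra.
  rewrite mulrCA ler_wpM2l// -exprMn lerXn2r ?nnegrE//.
  exact: le_trans xx.
have h7 : z * z ^+ e <= y ^+ e.+1 by rewrite -exprS.
have h8 : C * x ^+ e <= 2%:R ^+ e * (C * x ^+ e) by rewrite ler_peMl.
have : z ^+ e * (x - 3%:R) < z ^+ e * x by rewrite ltr_pM2l; lra.
rewrite {2}xz; move: Cz h6 h8; set T := 2%:R ^+ e; set W := C * x ^+ e.
set W' := C * (x + 1) ^+ e in h3 h4 *.
rewrite (mulrC z) in h7; lra.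
Qed.

(** Since P(x) = A (x + c)^(e+2) + O(x^e), the equation v P(a) = u P(b) equates (a + c)^(e+2) and (t
    (b + c))^(e+2) up to O(u a^e). Factoring the difference of powers divides this by about a^(e+1)
    and leaves O(u / a). *)
Lemma near_proportional (R : realFieldType) (u v A C c a b t : R) (P : {poly R}) (e : nat) :
  (forall x, 1 <= x -> `|P.[x] - A * (x + c) ^+ e.+2| <= C * x ^+ e) ->
  0 <= C -> 1 <= A -> 1 <= v -> v <= u -> 0 <= t -> v * t ^+ e.+2 = u ->
  2%:R * `|c| + 1 <= b -> b <= a -> v * P.[a] = u * P.[b] ->
  `|(a + c) - t * (b + c)| * a <= 2%:R ^+ e.+2 * C * u.
Proof.
move=> hC C0 A1 v1 vu t0 tuv hb ba vPuP.
have c1 : - `|c| <= c by rewrite lerNl ler_normr lexx orbT.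
have cge0 : 0 <= `|c| by [].
have a0 : 0 < a by lra.
have b0 : 0 <= b by lra.
have X0 : 0 <= a + c by lra.
have Y0 : 0 <= t * (b + c) by rewrite mulr_ge0//; lra.
have u1 : 1 <= u by lra.
have ae0 : 0 <= a ^+ e by rewrite exprn_ge0//; lra.
have ba' : b ^+ e <= a ^+ e by rewrite lerXn2r// nnegrE; lra.
have pw : v * A * `|(a + c) ^+ e.+2 - (t * (b + c)) ^+ e.+2| <=
    2%:R * u * (C * a ^+ e).
  have vA0 : 0 <= v * A by rewrite mulr_ge0; lra.
  rewrite -[v * A]ger0_norm// -normrM.
  have -> : v * A * ((a + c) ^+ e.+2 - (t * (b + c)) ^+ e.+2) =
     u * (P.[b] - A * (b + c) ^+ e.+2) - v * (P.[a] - A * (a + c) ^+ e.+2).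
    by rewrite exprMn -tuv; rewrite -tuv in vPuP; lra.
  apply: le_trans (ler_normB _ _) _.
  have u0 : 0 <= u by lra.
  have v0 : 0 <= v by lra.
  rewrite !normrM (ger0_norm u0) (ger0_norm v0).
  have h1 : u * `|P.[b] - A * (b + c) ^+ e.+2| <= u * (C * a ^+ e).
    rewrite ler_wpM2l//; apply: le_trans (hC b _) _; first lra.
    by rewrite ler_wpM2l.
  have h2 : v * `|P.[a] - A * (a + c) ^+ e.+2| <= u * (C * a ^+ e).
    by rewrite ler_pM//; apply: hC; lra.
  by lra.
have vA1 : 1 <= v * A by rewrite -[leLHS]mulr1 ler_pM.
have h3 : `|(a + c) ^+ e.+2 - (t * (b + c)) ^+ e.+2| <= 2%:R * u * (C * a ^+ e).
  by apply: le_trans pw; rewrite ler_peMl.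
have h4 := le_trans (subr_expn_ge e.+1 X0 Y0) h3.
have h5 : (a / 2%:R) ^+ e.+1 <= (a + c) ^+ e.+1.
  by rewrite lerXn2r ?nnegrE//; lra.
have h6 := le_trans (ler_wpM2l (normr_ge0 _) h5) h4.
rewrite -(ler_pM2r (_ : 0 < (a / 2%:R) ^+ e)) ?exprn_gt0//; last by lra.
rewrite [X in _ <= X](_ : _ = 2%:R * (2%:R * u * (C * a ^+ e))); last first.
  have -> : a ^+ e = 2%:R ^+ e * (a / 2%:R) ^+ e by rewrite -exprMn mulrC divfK.
  by rewrite !exprS; ring.
apply: le_trans (ler_wpM2l _ h6) => //.
by rewrite le_eqVlt; apply/orP; left; apply/eqP; rewrite exprS; field.
Qed.

(* With t ^ (e + 2) = u / v, both points lie close to a line of slope t, so the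
   difference vector (a2 - a1, b2 - b1) is a good approximation of t; but t is
   not rational. *)
Lemma proportional_values_gap (R : realType) (P : {poly R}) (e : nat) :
  size P = e.+3 -> 1 <= lead_coef P ->
  exists n0 K : nat, forall (u v a1 b1 a2 b2 : nat),
    (forall m n : nat, 0 < n -> v * m ^ e.+2 <> u * n ^ e.+2)%N ->
    (0 < v <= u)%N -> (n0 <= b1 <= a1)%N -> (b2 <= a2)%N ->
    (a1 < a2)%N -> (b1 < b2)%N ->
    v%:R * P.[a1%:R] = u%:R * P.[b1%:R] -> v%:R * P.[a2%:R] = u%:R * P.[b2%:R] ->
    (a1 <= K * u ^ 2 * (a2 - a1) ^ e.+1)%N.
Proof.
move=> sP A1; have [c [C C0 hC]] := shifted_power_expansion sP.
set A := lead_coef P in A1 hC.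
pose E := 2%:R ^+ e.+2 * C.
have E0 : 0 <= E by rewrite mulr_ge0 ?exprn_ge0.
pose C' := 2%:R * E * e.+2%:R * 2%:R ^+ e.+1 + 2%:R * E.
have p2 : 1 <= 2%:R ^+ e.+1 :> R by rewrite exprn_ege1 ?ler1n.
have C1 : 0 <= 2%:R * E by rewrite mulr_ge0.
have C2 : 0 <= 2%:R * E * e.+2%:R * 2%:R ^+ e.+1.
  by apply: mulr_ge0; [rewrite mulr_ge0|exact: le_trans ler01 p2].
exists (Num.Def.archi_bound (2%:R * `|c| + 1)), (Num.Def.archi_bound C').
move=> u v a1 b1 a2 b2 irr /andP[v0 vu] /andP[nb1 b1a1] b2a2 a12 b12 h1 h2.
have hc : 2%:R * `|c| + 1 <= b1%:R.
  apply: le_trans (ltW (archi_boundP _)) _; last by rewrite ler_nat.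
  by rewrite addr_ge0// mulr_ge0.
pose t : R := (u%:R / v%:R) `^ (e.+2%:R^-1).
have vR : 1 <= v%:R :> R by rewrite ler1n.
have vuR : v%:R <= u%:R :> R by rewrite ler_nat.
have t0 : 0 <= t by rewrite powR_ge0.
have tuv : v%:R * t ^+ e.+2 = u%:R.
  rewrite -powR_mulrn// /t -powRrM mulVf// powRr1 ?divr_ge0//.
  by rewrite mulrC divfK// gt_eqF//; lra.
have ba1 : b1%:R <= a1%:R :> R by rewrite ler_nat.
have ba2 : b2%:R <= a2%:R :> R by rewrite ler_nat.
have bb : b1%:R <= b2%:R :> R by rewrite ler_nat ltnW.
have aa : a1%:R <= a2%:R :> R by rewrite ler_nat ltnW.
have n1 := near_proportional hC C0 A1 vR vuR t0 tuv hc ba1 h1.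
have n2 := near_proportional hC C0 A1 vR vuR t0 tuv (le_trans hc bb) ba2 h2.
pose m : R := (a2 - a1)%:R; pose n : R := (b2 - b1)%:R.
have m1 : 1 <= m by rewrite ler1n subn_gt0.
have n0 : 0 <= n by [].
have mE : m = a2%:R - a1%:R by rewrite /m natrB// ltnW.
have nE : n = b2%:R - b1%:R by rewrite /n natrB// ltnW.
have cge0 : 0 <= `|c| by [].
have a1p : 0 < a1%:R :> R by lra.
have close : `|m - t * n| * a1%:R <= 2%:R * (E * u%:R).
  have -> : m - t * n = (a2%:R + c - t * (b2%:R + c)) - (a1%:R + c - t * (b1%:R + c)).
    by rewrite mE nE; ring.
  apply: le_trans (ler_wpM2r (ltW a1p) (ler_normB _ _)) _.
  rewrite mulrDl.
  have : `|a2%:R + c - t * (b2%:R + c)| * a1%:R <=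
         `|a2%:R + c - t * (b2%:R + c)| * a2%:R by rewrite ler_wpM2l.
  by rewrite /E; lra.
have uR : 1 <= u%:R :> R by lra.
have me1 : 1 <= m ^+ e.+1 by rewrite exprn_ege1.
have u2 : u%:R <= u%:R ^+ 2 :> R by rewrite expr2 ler_peMl//; lra.
suff : a1%:R <= C' * (u%:R ^+ 2 * m ^+ e.+1).
  move=> aC; rewrite -(ler_nat R); apply: le_trans aC _.
  rewrite -mulnA !natrM !natrX ler_wpM2r ?mulr_ge0 ?exprn_ge0//.
  by apply/ltW/archi_boundP/addr_ge0.
(* If a1 is below a multiple of u, the claim follows from u <= u^2 and m >= 1; otherwise |m - t n|
   <= 1, hence t n <= 2 m. The second summand of [C'] serves the former case, the first one the
   latter. *)
have [big|small] := ltP a1%:R (2%:R * (E * u%:R)).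
  apply: (le_trans (ltW big)); rewrite mulrA ler_pM//.
  - by rewrite /C' lerDr.
  - by apply: le_trans u2 _; rewrite ler_peMr// exprn_ge0//; lra.
have tn : `|m - t * n| <= 1.
  by rewrite -(ler_pM2r a1p) mul1r; apply: le_trans close _.
have tn2 : 0 <= t * n <= 2%:R * m.
  rewrite mulr_ge0//=; move: tn; rewrite ler_norml => /andP[]; lra.
have m2 : 0 <= m <= 2%:R * m by apply/andP; split; lra.
(* As t^(e+2) = u / v, this is the absolute value of the integer v m^(e+2) - u n^(e+2), which is
   nonzero by [irr]. *)
have ge1 : 1 <= v%:R * `|m ^+ e.+2 - (t * n) ^+ e.+2|.
  rewrite -[v%:R]ger0_norm// -normrM mulrBr exprMn.
  rewrite (_ : v%:R * (t ^+ _ * _) = u%:R * n ^+ e.+2); last by rewrite mulrA tuv.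
  rewrite /m /n.
  rewrite -!natrX -!natrM.
  have : (v * (a2 - a1) ^ e.+2 != u * (b2 - b1) ^ e.+2)%N.
    by apply/eqP/irr; rewrite subn_gt0.
  rewrite neq_ltn => /orP[h|h]; [rewrite distrC|];
    by rewrite -natrB 1?ltnW// ger0_norm// ler1n subn_gt0.
have := subr_expn_le e.+1 m2 tn2.
rewrite [(2%:R * m) ^+ _]exprMn => hle.
have u0 : 0 <= u%:R :> R by [].
have : 1 <= u%:R * (`|m - t * n| * (e.+2%:R * (2%:R ^+ e.+1 * m ^+ e.+1))).
  by apply: (le_trans ge1); rewrite ler_pM.
rewrite -(ler_pM2r a1p) mul1r => /le_trans; apply.
have -> : u%:R * (`|m - t * n| * (e.+2%:R * (2%:R ^+ e.+1 * m ^+ e.+1))) * a1%:R =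
   `|m - t * n| * a1%:R * (u%:R * (e.+2%:R * (2%:R ^+ e.+1 * m ^+ e.+1))) by ring.
have w0 : 0 <= u%:R * (e.+2%:R * (2%:R ^+ e.+1 * m ^+ e.+1)).
  apply: mulr_ge0 => //; apply: mulr_ge0 => //.
  by apply: mulr_ge0; [exact: le_trans p2|exact: le_trans me1].
apply: le_trans (ler_wpM2r w0 close) _.
rewrite /C' mulrDl.
have : 0 <= 2%:R * E * (u%:R ^+ 2 * m ^+ e.+1).
  apply: mulr_ge0 => //; apply: mulr_ge0; first exact: exprn_ge0.
  exact: le_trans me1.
by lra.
Qed.

(** * Quadruples of values with square product *)

Lemma sum_bool_count (N : nat) (p : pred nat) :
  (\sum_(x < N) p x)%N = count p (iota 0 N).
Proof.
rewrite -sum1_count -[iota 0 N](congr1 (iota 0) (subn0 N)) big_mkord.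
by rewrite [RHS]big_mkcond; apply: eq_bigr => i _; case: (p i).
Qed.

Lemma sum_bool_le1 (N : nat) (p : pred nat) :
  (forall x y, p x -> p y -> x = y) -> (\sum_(x < N) p x <= 1)%N.
Proof.
move=> h; rewrite sum_bool_count -size_filter leqNgt; apply/negP => s2.
have := filter_uniq p (iota_uniq 0 N); have := filter_all p (iota 0 N).
case: (seq.filter p _) s2 => [|x [|y s]] //= _ /and3P[px py _] /andP[+ _].
by rewrite inE (h _ _ px py) eqxx.
Qed.

(** From M on, distinct points of p have distinct quotients by h; below M every integer is
    counted. *)
Lemma sum_spaced_le (N M h : nat) (p : pred nat) : (0 < h)%N ->
  (forall x y, (M <= x)%N -> (x < y)%N -> p x -> p y -> (h <= y - x)%N) ->
  (\sum_(x < N) p x <= M + (N %/ h).+1)%N.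
Proof.
move=> h0 sp.
rewrite sum_bool_count.
apply: (@leq_trans (count (fun x => x < M)%N (iota 0 N)
   + count (fun x => p x && (M <= x))%N (iota 0 N))).
  rewrite -count_predUI; apply: leq_trans (leq_addr _ _).
  by apply: sub_count => x px; rewrite /= px /=; case: leqP; rewrite ?orbT.
apply: leq_add; rewrite -size_filter.
  rewrite -[X in (_ <= X)%N](size_iota 0); apply: uniq_leq_size.
    by rewrite filter_uniq ?iota_uniq.
  by move=> x; rewrite mem_filter !mem_iota !add0n => /andP[].
set s := seq.filter _ _.
rewrite -(size_map (fun x => x %/ h)%N) -[X in (_ <= X)%N](size_iota 0).
have sP x : x \in s -> [/\ p x, (M <= x)%N & (x < N)%N].
  by rewrite mem_filter mem_iota add0n => /andP[/andP[? ?] /andP[_ ?]].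
apply: uniq_leq_size.
  rewrite map_inj_in_uniq ?filter_uniq ?iota_uniq//.
  have aux x y : x \in s -> y \in s -> (x %/ h = y %/ h)%N -> (x < y)%N -> False.
    move=> /sP[px Mx _] /sP[py _ _] e xy.
    have := sp _ _ Mx xy px py.
    rewrite (divn_eq x h) (divn_eq y h) e subnDl => hh.
    have := ltn_pmod y h0; rewrite ltnNge; move/negP; apply.
    exact: leq_trans hh (leq_subr _ _).
  move=> x y xs ys e; case: (ltngtP x y) => // xy; exfalso.
    exact: aux xs ys e xy.
  by apply: aux ys xs _ xy.
move=> _ /mapP[x /sP[_ _ xN] ->].
by rewrite mem_iota add0n ltnS leq_div2r// ltnW.
Qed.

Section Quadruples.
Variables (F : nat -> nat) (n0 : nat).

Definition good (n : nat) : bool := (n0 <= n)%N && squarefree (F n).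

(** For squarefree values, the product of the four is a square exactly when each prime divides an
    even number of them; the exclusive or expresses this parity. *)
Definition square_product (a b c d : nat) : Prop := forall p, prime p ->
  (p %| F a)%N (+) (p %| F b)%N (+) (p %| F c)%N (+) (p %| F d)%N = false.

(** [uniq] removes the trivial solutions, in which the four entries pair off. *)
Definition quad (a b c d : nat) : bool :=
  [&& all good [:: a; b; c; d], uniq [:: a; b; c; d]
    & `[< square_product a b c d >]].

Hypothesis Fmono : forall m n, (n0 <= m)%N -> (m < n)%N -> (F m < F n)%N.

Lemma good_inj m n : good m -> good n -> F m = F n -> m = n.
Proof.
move=> /andP[m0 _] /andP[n0' _] e; case: (ltngtP m n) => // h.
  by have := Fmono m0 h; rewrite e ltnn.
by have := Fmono n0' h; rewrite e ltnn.
Qed.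

Lemma square_product_inj a b c d d' : good d -> good d' ->
  square_product a b c d -> square_product a b c d' -> d = d'.
Proof.
move=> gd gd' h h'; apply: good_inj => //.
apply: squarefree_primes_inj; [by case/andP: gd|by case/andP: gd'|].
move=> p pp; have := h p pp; have := h' p pp.
by do 5!case: (_ %| _)%N.
Qed.

(** An equality among b, c, d cancels two of the parities and forces a to equal the remaining
    variable. *)
Lemma square_product_uniq a b c d : all good [:: a; b; c; d] ->
  a != b -> a != c -> a != d -> square_product a b c d -> quad a b c d.
Proof.
move=> ga ab ac ad sq; apply/and3P; split=> //; last exact/asboolP.
have /and5P[ga' gb gc gd _] := ga.
have aux x y : good x -> good y ->
    (forall p, prime p -> (p %| F x)%N = (p %| F y)%N) -> x = y.
  move=> gx gy h; apply: good_inj => //; apply: squarefree_primes_inj => //.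
    by case/andP: gx.
  by case/andP: gy.
rewrite /= !inE !negb_or ab ac ad /= andbT.
rewrite -andbA; apply/and3P; split.
- apply: contra ad => /eqP bc; apply/eqP/aux => // p /sq.
  by rewrite bc; do 3!case: (_ %| _)%N.
- apply: contra ac => /eqP bd; apply/eqP/aux => // p /sq.
  by rewrite bd; do 3!case: (_ %| _)%N.
- apply: contra ab => /eqP cd; apply/eqP/aux => // p /sq.
  by rewrite cd; do 3!case: (_ %| _)%N.
Qed.

Lemma quad_perm a b c d a' b' c' d' :
  perm_eq [:: a; b; c; d] [:: a'; b'; c'; d'] -> quad a b c d = quad a' b' c' d'.
Proof.
move=> h; rewrite /quad (perm_all _ h) (perm_uniq h); congr (_ && (_ && _)).
apply: asbool_equiv_eq.
have E x y z t : square_product x y z t <-> (forall p, prime p ->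
    \big[addb/false]_(n <- [:: x; y; z; t]) (p %| F n)%N = false).
  by split=> H p /H; rewrite !big_cons big_nil addbF !addbA.
rewrite !E; split=> H p /H; first by rewrite (perm_big _ h).
by rewrite -(perm_big _ h).
Qed.

(** By parity, a prime dividing F a divides at least one of the other three values. *)
Lemma quad_gcd a b c d : quad a b c d ->
  (F a <= gcdn (F a) (F b) * gcdn (F a) (F c) * gcdn (F a) (F d))%N.
Proof.
move=> /and3P[/and5P[/andP[_ ga] /andP[_ gb] /andP[_ gc] /andP[_ gd] _] _ /asboolP sq].
have a0 := squarefree_gt0 ga.
apply: dvdn_leq; first by rewrite !muln_gt0 !gcdn_gt0 a0.
apply: squarefree_dvdP => // p pp pa; have := sq p pp.
rewrite !Euclid_dvdM// !dvdn_gcd pa /=.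
by do 3!case: (_ %| _)%N.
Qed.

(** The last condition says that F a / F b in lowest terms has numerator below D^2. *)
Definition large_gcd (D a b : nat) : bool :=
  [&& good a, good b, (b < a)%N & (F a < D ^ 2 * gcdn (F a) (F b))%N].

Definition two_gcds (D a b c : nat) : bool :=
  [&& good a, good b && (b < a)%N, good c && (c < a)%N,
    (D <= gcdn (F a) (F b))%N && (D <= gcdn (F a) (F c))%N
    & (F a ^ 2 <= (gcdn (F a) (F b) * gcdn (F a) (F c)) ^ 3)%N].

(* If no gcd exceeds F a / D ^ 2, then any two of the three gcds have product at
   least D ^ 2, so both gcds other than the smallest one are at least D. *)
Lemma quad_cases D a b c d : quad a b c d -> (b < a)%N -> (c < a)%N -> (d < a)%N ->
  [|| large_gcd D a b, large_gcd D a c, large_gcd D a d,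
    two_gcds D a b c, two_gcds D a b d | two_gcds D a c d].
Proof.
move=> q ba ca da; have := quad_gcd q.
have /and3P[/and5P[ga gb gc gd _] _ _] := q.
have a0 : (0 < F a)%N by case/andP: ga => _ /squarefree_gt0.
rewrite /large_gcd /two_gcds ga gb gc gd ba ca da /=.
have : (0 < gcdn (F a) (F b))%N by rewrite gcdn_gt0 a0.
have : (0 < gcdn (F a) (F c))%N by rewrite gcdn_gt0 a0.
have : (0 < gcdn (F a) (F d))%N by rewrite gcdn_gt0 a0.
move: (F a) (gcdn (F a) (F b)) (gcdn (F a) (F c)) (gcdn (F a) (F d)) => f x y z z0 y0 x0 le.
case: (ltnP f (D ^ 2 * x)) => // fx; case: (ltnP f (D ^ 2 * y)) => // fy.
case: (ltnP f (D ^ 2 * z)) => //= fz.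
have yz : (D ^ 2 <= y * z)%N.
  by rewrite -(leq_pmul2r x0) (leq_trans fx)// (leq_trans le)//; lia.
have xz : (D ^ 2 <= x * z)%N.
  by rewrite -(leq_pmul2r y0) (leq_trans fy)// (leq_trans le)//; lia.
have xy : (D ^ 2 <= x * y)%N.
  by rewrite -(leq_pmul2r z0) (leq_trans fz)// (leq_trans le)//; lia.
have main u v w : (w <= u)%N -> (w <= v)%N -> (D ^ 2 <= u * w)%N ->
    (D ^ 2 <= v * w)%N -> (f <= u * v * w)%N ->
    [&& D <= u, D <= v & f ^ 2 <= (u * v) ^ 3]%N.
  move=> wu wv uw vw fl; apply/and3P; split.
  - by rewrite -leq_sqr (leq_trans uw)// -mulnn leq_mul2l wu orbT.
  - by rewrite -leq_sqr (leq_trans vw)// -mulnn leq_mul2l wv orbT.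
  - have ww : (w ^ 2 <= u * v)%N by rewrite -mulnn leq_mul.
    apply: (@leq_trans ((u * v * w) ^ 2)%N); first by rewrite leq_sqr.
    rewrite [((u * v * w) ^ 2)%N]expnMn [((u * v) ^ 3)%N]expnSr.
    by rewrite leq_mul2l ww orbT.
have [h1|h1] := leqP z x; have [h2|h2] := leqP z y.
- by have := main x y z h1 h2 xz yz le; rewrite andbA => ->.
- have h3 : (y <= x)%N by exact: leq_trans (ltnW h2) h1.
  have := main x z y h3 (ltnW h2) xy _ _; rewrite (mulnC z y) yz mulnAC => /(_ isT le).
  by rewrite andbA => ->; rewrite orbT.
- have h3 : (x <= y)%N by exact: leq_trans (ltnW h1) h2.
  have := main y z x h3 (ltnW h1) _ _ _; rewrite (mulnC y x) xy (mulnC z x) xz.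
  rewrite [(y * z * x)%N](_ : _ = (x * y * z)%N); last by lia.
  by move=> /(_ isT isT le); rewrite andbA => ->; rewrite !orbT.
- have [h3|h3] := leqP x y.
    have := main y z x h3 (ltnW h1) _ _ _; rewrite (mulnC y x) xy (mulnC z x) xz.
    rewrite [(y * z * x)%N](_ : _ = (x * y * z)%N); last by lia.
    by move=> /(_ isT isT le); rewrite andbA => ->; rewrite !orbT.
  have := main x z y (ltnW h3) (ltnW h2) xy _ _; rewrite (mulnC z y) yz mulnAC => /(_ isT le).
  by rewrite andbA => ->; rewrite orbT.
Qed.

Definition nquad (N : nat) : nat :=
  (\sum_(a < N) \sum_(b < N) \sum_(c < N) \sum_(d < N) quad a b c d)%N.

(** The entries are distinct, so exactly one is the largest, and [quad_perm] moves it to the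
    front. *)
Lemma nquad_le_max N : (nquad N <= 4 *
  \sum_(a < N) \sum_(b < N) \sum_(c < N) \sum_(d < N)
    [&& quad a b c d, b < a, c < a & d < a])%N.
Proof.
pose m (a b c d : nat) : nat := [&& quad a b c d, b < a, c < a & d < a]%N.
have le a b c d : (quad a b c d <= m a b c d + m b a c d + m c a b d + m d a b c)%N.
  rewrite /m; case q : (quad a b c d) => //.
  rewrite -(@quad_perm a b c d b a c d); last by rewrite (perm_catCA [:: a] [:: b]).
  rewrite -(@quad_perm a b c d c a b d); last first.
    by rewrite (perm_catCA [:: a; b] [:: c]).
  rewrite -(@quad_perm a b c d d a b c); last first.
    by rewrite (perm_catCA [:: a; b; c] [:: d] [::]).
  rewrite q /=; have /and3P[_ u _] := q; move: u; rewrite /= !inE !negb_or => u.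
  by lia.
apply: leq_trans (leq_sum _ _) _ => [a _|].
  apply: leq_sum => b _; apply: leq_sum => c _; apply: leq_sum => d _; exact: le.
rewrite (_ : (4 * _ = \sum_(a < N) \sum_(b < N) \sum_(c < N) \sum_(d < N) m a b c d
  + \sum_(a < N) \sum_(b < N) \sum_(c < N) \sum_(d < N) m b a c d
  + \sum_(a < N) \sum_(b < N) \sum_(c < N) \sum_(d < N) m c a b d
  + \sum_(a < N) \sum_(b < N) \sum_(c < N) \sum_(d < N) m d a b c)%N); last first.
  rewrite !mulSn mul0n addn0 -!addnA; congr (_ + (_ + (_ + _)))%N.
  - by rewrite exchange_big.
  - by rewrite exchange_big; apply: eq_bigr => b _; rewrite exchange_big.
  - rewrite exchange_big; apply: eq_bigr => b _.
    by rewrite exchange_big; apply: eq_bigr => c _; rewrite exchange_big.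
rewrite -!big_split; apply: leq_sum => a _; rewrite -!big_split; apply: leq_sum => b _.
rewrite -!big_split; apply: leq_sum => c _; rewrite -!big_split; apply: leq_sum => d _.
by rewrite /=.
Qed.
End Quadruples.

(** * Reduction of the quadruple count to pairs and triples *)

Section QuadrupleCount.
Variables (F : nat -> nat) (n0 : nat).
Hypothesis Fmono : forall m n, (n0 <= m)%N -> (m < n)%N -> (F m < F n)%N.
Local Notation good := (good F n0).
Local Notation quad := (quad F n0).

(** The fourth variable is determined by the other three ([square_product_inj]), so summing over it
    costs nothing. *)
Lemma sum_quad_and N (X : nat -> nat -> nat -> bool) :
  (\sum_(a < N) \sum_(b < N) \sum_(c < N) \sum_(d < N) (quad a b c d && X a b c)
   <= \sum_(a < N) \sum_(b < N) \sum_(c < N) X a b c)%N.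
Proof.
apply: leq_sum => a _; apply: leq_sum => b _; apply: leq_sum => c _.
case: (X a b c); last by rewrite big1// => d _; rewrite andbF.
under eq_bigr do rewrite andbT.
apply: (@sum_bool_le1 N (fun d => quad a b c d)) => x y.
move=> /and3P[/and5P[_ _ _ gx _] _ /asboolP sx].
move=> /and3P[/and5P[_ _ _ gy _] _ /asboolP sy].
exact: square_product_inj Fmono _ _ _ _ _ gx gy sx sy.
Qed.

Lemma sum_quad_and3 N (X : nat -> nat -> nat -> bool) :
  (\sum_(a < N) \sum_(b < N) \sum_(c < N) \sum_(d < N) (quad a b c d && X a b d)
   <= \sum_(a < N) \sum_(b < N) \sum_(c < N) X a b c)%N.
Proof.
apply: leq_trans (sum_quad_and N X); apply: leq_sum => a _; apply: leq_sum => b _.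
rewrite exchange_big; apply: leq_sum => c _; apply: leq_sum => d _.
by rewrite (@quad_perm _ _ a b d c a b c d)//; apply/permP => s /=; lia.
Qed.

Lemma sum_quad_and2 N (X : nat -> nat -> nat -> bool) :
  (\sum_(a < N) \sum_(b < N) \sum_(c < N) \sum_(d < N) (quad a b c d && X a c d)
   <= \sum_(a < N) \sum_(b < N) \sum_(c < N) X a b c)%N.
Proof.
apply: leq_trans (sum_quad_and3 N X); apply: leq_sum => a _.
rewrite exchange_big; apply: leq_sum => b _; apply: leq_sum => c _; apply: leq_sum => d _.
by rewrite (@quad_perm _ _ a c b d a b c d)//; apply/permP => s /=; lia.
Qed.

Lemma nquad_le_cases N D : (nquad F n0 N <= 12 * (
  N * \sum_(a < N) \sum_(b < N) large_gcd F n0 D a b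
  + \sum_(a < N) \sum_(b < N) \sum_(c < N) two_gcds F n0 D a b c))%N.
Proof.
set R2 := large_gcd F n0 D; set R1 := two_gcds F n0 D.
apply: leq_trans (nquad_le_max _ _ N) _.
rewrite (_ : 12 = 4 * 3)%N// -mulnA leq_mul2l /=.
pose S (X : nat -> nat -> nat -> nat -> bool) := (\sum_(a < N) \sum_(b < N) \sum_(c < N) \sum_(d < N)
   (quad a b c d && X a b c d))%N.
apply: (@leq_trans (S (fun a b c d => R2 a b) + S (fun a b c d => R2 a c)
   + S (fun a b c d => R2 a d) + S (fun a b c d => R1 a b c)
   + S (fun a b c d => R1 a b d) + S (fun a b c d => R1 a c d))%N).
  rewrite /S -!big_split; apply: leq_sum => a _; rewrite -!big_split /=.
  apply: leq_sum => b _; rewrite -!big_split /=; apply: leq_sum => c _.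
  rewrite -!big_split /=; apply: leq_sum => d _.
  case q : (quad a b c d) => //=.
  case ba : (b < a)%N => //=; case ca : (c < a)%N => //=; case da : (d < a)%N => //=.
  have := quad_cases D q ba ca da; rewrite -/R1 -/R2.
  by do 3!case: (R2 _ _) => //=; do 3!case: (R1 _ _ _) => //=.
have h2 : (\sum_(a < N) \sum_(b < N) \sum_(c < N) R2 a b)%N =
    (N * \sum_(a < N) \sum_(b < N) R2 a b)%N.
  rewrite big_distrr; apply: eq_bigr => a _; rewrite big_distrr.
  by apply: eq_bigr => b _; rewrite sum_nat_const card_ord.
have h3 : (\sum_(a < N) \sum_(b < N) \sum_(c < N) R2 a c)%N =
    (N * \sum_(a < N) \sum_(b < N) R2 a b)%N.
  by rewrite -h2; apply: eq_bigr => a _; rewrite exchange_big.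
set T2 := (N * _)%N in h2 h3 *; set T1 := (\sum_(a < N) _)%N.
have s1 : (S (fun a b c d => R2 a b) <= T2)%N.
  by rewrite -h2; exact: (sum_quad_and N (fun a b c => R2 a b)).
have s2 : (S (fun a b c d => R2 a c) <= T2)%N.
  by rewrite -h3; exact: (sum_quad_and N (fun a b c => R2 a c)).
have s3 : (S (fun a b c d => R2 a d) <= T2)%N.
  by rewrite -h3; exact: (sum_quad_and2 N (fun a b c => R2 a c)).
have s4 : (S (fun a b c d => R1 a b c) <= T1)%N by exact: sum_quad_and.
have s5 : (S (fun a b c d => R1 a b d) <= T1)%N by exact: sum_quad_and3.
have s6 : (S (fun a b c d => R1 a c d) <= T1)%N by exact: sum_quad_and2.
by lia.
Qed.

Lemma large_gcd_quotients D a b : large_gcd F n0 D a b ->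
  exists u v : 'I_(D ^ 2), [/\ squarefree u, squarefree v, coprime u v,
    (0 < v < u)%N & (v * F a = u * F b)%N].
Proof.
move=> /and4P[ga gb ba lt]; have /andP[na sa] := ga; have /andP[nb sb] := gb.
set G := gcdn _ _ in lt.
have a0 := squarefree_gt0 sa; have b0 := squarefree_gt0 sb.
have G0 : (0 < G)%N by rewrite gcdn_gt0 a0.
have Ga : (G %| F a)%N by exact: dvdn_gcdl.
have Gb : (G %| F b)%N by exact: dvdn_gcdr.
have Fba := Fmono nb ba.
have uD : (F a %/ G < D ^ 2)%N by rewrite ltn_divLR.
have vu : (F b %/ G < F a %/ G)%N by rewrite ltn_divLR// divnK.
exists (Ordinal uD), (Ordinal (ltn_trans vu uD)) => /=; split.
- by apply: squarefree_dvd sa; exact: dvdn_div.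
- by apply: squarefree_dvd sb; exact: dvdn_div.
- by rewrite /coprime -(eqn_pmul2r G0) muln_gcdl !divnK// mul1n.
- by rewrite vu andbT divn_gt0// dvdn_leq.
- by rewrite mulnC [RHS]mulnC; exact: muln_divCA_gcd.
Qed.

(** At a prime dividing u, the left side has valuation 0 modulo e + 2 and the right side valuation
    1. *)
Lemma squarefree_ratio_irrational (u v e : nat) : squarefree u -> coprime u v ->
  (0 < v < u)%N ->
  forall m n : nat, (0 < n)%N -> (v * m ^ e.+2 <> u * n ^ e.+2)%N.
Proof.
move=> su cuv /andP[v0 vu] m n np E.
have u1 : (1 < u)%N by exact: leq_ltn_trans vu.
have pp := pdiv_prime u1; have pu := pdiv_dvd u; set p := pdiv u in pp pu.
have m0 : (0 < m)%N.
  rewrite lt0n; apply/eqP => m0; move: E; rewrite m0 exp0n// muln0 => /esym/eqP.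
  by rewrite muln_eq0 expn_eq0 -leqn0 leqNgt (ltnW u1) /= -leqn0 leqNgt np.
have u0 := ltnW u1.
have me : (0 < m ^ e.+2)%N by rewrite expn_gt0 m0.
have ne : (0 < n ^ e.+2)%N by rewrite expn_gt0 np.
have /= := congr1 (logn p) E; rewrite (lognM p v0 me) (lognM p u0 ne) !lognX.
have -> : logn p v = 0%N.
  apply/eqP; rewrite -leqn0 leqNgt logn_gt0 mem_primes pp v0 /=.
  apply/negP => pv; have := dvdn_gcd p u v; rewrite pu pv (eqP cuv) dvdn1.
  by move=> /eqP p1; rewrite p1 in pp.
have -> : logn p u = 1%N.
  apply/eqP; rewrite eqn_leq squarefree_logn// logn_gt0 mem_primes pp pu.
  by rewrite (ltnW u1).
move=> /(congr1 (modn^~ e.+2)); by rewrite add0n modnMr -modnDmr modnMr addn0 modn_small.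
Qed.

End QuadrupleCount.

Lemma le_sum_ord (N : nat) (G : nat -> nat) (i : 'I_N) :
  (G i <= \sum_(j < N) G j)%N.
Proof. by rewrite (bigD1 i)//= leq_addr. Qed.

Lemma sum_ord_le (N c : nat) (G : 'I_N -> nat) :
  (forall i, G i <= c)%N -> (\sum_(i < N) G i <= N * c)%N.
Proof.
move=> h; rewrite -[N in (N * c)%N]card_ord -sum_nat_const.
by apply: leq_sum.
Qed.

Section GcdCounts.
Variables (F : nat -> nat) (n0 : nat).
Hypothesis Fmono : forall m n, (n0 <= m)%N -> (m < n)%N -> (F m < F n)%N.
Local Notation good := (good F n0).

Definition proportional (u v a b : nat) : bool :=
  [&& good a, good b, (b < a)%N,
    [&& squarefree u, squarefree v, coprime u v & 0 < v < u]%N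
    & (v * F a == u * F b)%N].

(** The reduced fraction u / v = F a / F b is fixed first, which leaves at most D^4 choices. Then b
    is determined by a, and the admissible a beyond M are spaced by h. *)
Lemma sum_large_gcd (N D M h : nat) : (0 < h)%N ->
  (forall u v a1 b1 a2 b2 : nat, (u < D ^ 2)%N ->
    proportional u v a1 b1 -> proportional u v a2 b2 ->
    (M <= a1)%N -> (a1 < a2)%N -> (h <= a2 - a1)%N) ->
  (\sum_(a < N) \sum_(b < N) large_gcd F n0 D a b <=
     D ^ 2 * D ^ 2 * (M + (N %/ h).+1))%N.
Proof.
move=> h0 gap.
apply: (@leq_trans (\sum_(u < D ^ 2) \sum_(v < D ^ 2) \sum_(a < N) \sum_(b < N)
   proportional u v a b)%N); last first.
  rewrite -mulnA; apply: sum_ord_le => u; apply: sum_ord_le => v.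
  apply: (@leq_trans (\sum_(a < N) `[< exists b, proportional u v a b >])%N).
    apply: leq_sum => a _; case: asboolP => [[b0 _]|nex].
      apply: (@sum_bool_le1 N (fun b => proportional u v a b)) => x y.
      move=> /and5P[_ gx _ /and4P[su _ _ _] /eqP ex] /and5P[_ gy _ _ /eqP ey].
      apply: (good_inj Fmono) => //; apply/eqP.
      by rewrite -(eqn_pmul2l (squarefree_gt0 su)) -ex ey.
    rewrite leqn0 sum_nat_eq0; apply/forallP => b; apply/implyP => _.
    by rewrite eqb0; apply/negP => pb; apply: nex; exists b.
  apply: (@sum_spaced_le N M h (fun a => `[< exists b, proportional u v a b >])) => //.
  move=> x y Mx xy /asboolP[b pb] /asboolP[b' pb'].
  exact: gap pb pb' Mx xy.
under [leqRHS]eq_bigr do rewrite exchange_big.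
rewrite [leqRHS]exchange_big; apply: leq_sum => a _ /=.
under [leqRHS]eq_bigr do rewrite exchange_big.
rewrite [leqRHS]exchange_big; apply: leq_sum => b _ /=.
case ab : (large_gcd _ _ _ _ _) => //.
have [u [v [su sv cuv vu e]]] := large_gcd_quotients Fmono ab.
have /and4P[ga gb ba _] := ab.
have p : proportional u v a b.
  by rewrite /proportional ga gb ba su sv cuv vu e eqxx.
apply: leq_trans (le_sum_ord (fun u => \sum_(v < D ^ 2) proportional u v a b)%N u).
by apply: leq_trans (le_sum_ord (fun v => proportional u v a b) v); rewrite p.
Qed.

End GcdCounts.

Section TwoGcdCounts.
Variables (P : {poly int}) (n0 : nat).
Hypothesis lead0 : lead_coef P != 0.
Local Notation F := (absval P).
Local Notation good := (good F n0).
Local Notation kappa := (nroots_bound P).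

Lemma nroots_bound_gt0 : (0 < kappa)%N.
Proof. by rewrite addn_gt0 orbC absz_gt0 lead0. Qed.

Lemma count_dvd_divisor (n g a : nat) : squarefree n -> (g %| n)%N ->
  (count (fun b => g %| F b) (iota 0 a)
    <= kappa ^ size (primes n) * (a %/ g).+1)%N.
Proof.
move=> sn gn; have n_gt0 := squarefree_gt0 sn.
have g0 : (0 < g)%N := dvdn_gt0 n_gt0 gn.
apply: leq_trans (count_dvd_absval _ _ g0) _; rewrite leq_mul2r; apply/orP; right.
apply: leq_trans (nroots_squarefree lead0 (squarefree_dvd gn sn)) _.
rewrite leq_pexp2l ?nroots_bound_gt0//; apply: uniq_leq_size (primes_uniq _) _ => p.
by rewrite !mem_primes n_gt0 g0 /= => /andP[-> /dvdn_trans]; apply.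
Qed.

(** The gcds range over divisors g, h of F a, and b, c over roots of P modulo g, h. Each of the two
    pairs (g, b) and (h, c) costs a factor 2 for the divisor and kappa for the roots, per prime of F
    a. *)
Lemma sum_two_gcds (N D W a : nat) : squarefree (F a) ->
  (forall g h : nat, (D <= g)%N -> (D <= h)%N -> (F a ^ 2 <= (g * h) ^ 3)%N ->
    ((a %/ g).+1 * (a %/ h).+1 <= W)%N) ->
  (\sum_(b < N) \sum_(c < N) two_gcds F n0 D a b c <=
    ((2 * kappa) ^ 2) ^ size (primes (F a)) * W)%N.
Proof.
move=> sa hW; have Fa0 := squarefree_gt0 sa.
pose w := size (primes (F a)); pose dv := divisors (F a).
pose cond g h := [&& D <= g, D <= h & F a ^ 2 <= (g * h) ^ 3]%N.
pose X (g b : nat) : nat := (b < a)%N && (g %| F b)%N.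
apply: (@leq_trans (\sum_(g <- dv) \sum_(h <- dv)
    cond g h * ((\sum_(b < N) X g b) * (\sum_(c < N) X h c)))%N).
  rewrite (_ : (\sum_(g <- dv) _ = \sum_(b < N) \sum_(c < N) \sum_(g <- dv)
     \sum_(h <- dv) cond g h * (X g b * X h c))%N); last first.
    under [RHS]eq_bigr do rewrite exchange_big.
    rewrite [RHS]exchange_big; apply: eq_bigr => g _ /=.
    under [RHS]eq_bigr do rewrite exchange_big.
    rewrite [RHS]exchange_big; apply: eq_bigr => h _ /=.
    rewrite big_distrl big_distrr; apply: eq_bigr => b _ /=.
    by rewrite !big_distrr.
  apply: leq_sum => b _; apply: leq_sum => c _.
  case tg : (two_gcds _ _ _ _ _ _) => //.
  move: tg => /and5P[ga /andP[gb ba] /andP[gc ca] /andP[D1 D2] h3].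
  have in1 x : gcdn (F a) (F x) \in dv by rewrite -dvdn_divisors// dvdn_gcdl.
  rewrite (bigD1_seq _ (in1 b)) ?divisors_uniq//= (bigD1_seq _ (in1 c)) ?divisors_uniq//=.
  by rewrite /cond D1 D2 h3 /X ba ca !dvdn_gcdr.
have XN g : g \in dv -> (\sum_(b < N) X g b <= kappa ^ w * (a %/ g).+1)%N.
  rewrite -dvdn_divisors// => gF; apply: leq_trans (count_dvd_divisor _ sa gF).
  rewrite (@sum_bool_count N (fun b => (b < a)%N && (g %| F b)%N)) -!size_filter.
  apply: uniq_leq_size; first by rewrite filter_uniq ?iota_uniq.
  by move=> x; rewrite !mem_filter !mem_iota !add0n => /andP[/andP[-> ->]].
apply: (@leq_trans (\sum_(g <- dv) \sum_(h <- dv) (kappa ^ w) ^ 2 * W)%N).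
  rewrite big_seq [leqRHS]big_seq; apply: leq_sum => g gd.
  rewrite big_seq [leqRHS]big_seq; apply: leq_sum => h hd.
  case: (boolP (cond g h)) => // /and3P[c1 c2 c3]; rewrite mul1n.
  apply: leq_trans (leq_mul (XN _ gd) (XN _ hd)) _.
  by rewrite mulnACA mulnn leq_mul2l hW ?orbT.
rewrite !big_const_seq !count_predT !iter_addn_0.
have sd : (size dv <= 2 ^ w)%N := size_divisors_squarefree sa.
have -> : (((2 * kappa) ^ 2) ^ w * W = (kappa ^ w) ^ 2 * W * 2 ^ w * 2 ^ w)%N.
  by rewrite expnAC expnMn -!mulnn; ring.
by rewrite leq_mul ?leq_mul.
Qed.

End TwoGcdCounts.

(** * Growth of the values and the power saving *)

Lemma absval_growth (R : realType) (P : {poly int}) (e : nat) :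
  size P = e.+3 -> 0 < lead_coef P ->
  exists n0 C K : nat, [/\ (8 <= n0)%N,
    forall n, (n0 <= n)%N -> 0 < P.[n%:Z] /\ (n ^ 2 <= 8 * absval P n)%N,
    forall m n, (n0 <= m)%N -> (m < n)%N -> (absval P m < absval P n)%N,
    forall n, (n0 <= n)%N -> (absval P n <= C * n ^ e.+2)%N
  & forall u v a1 b1 a2 b2 : nat,
    (forall m n : nat, 0 < n -> v * m ^ e.+2 <> u * n ^ e.+2)%N ->
    (0 < v <= u)%N -> (n0 <= b1 <= a1)%N -> (n0 <= b2 <= a2)%N ->
    (a1 < a2)%N ->
    (v * absval P a1 = u * absval P b1)%N -> (v * absval P a2 = u * absval P b2)%N ->
    (a1 <= K * u ^ 2 * (a2 - a1) ^ e.+1)%N].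
Proof.
move=> sP lP; pose PR : {poly R} := map_poly intr P.
have iinj : injective (intr : int -> R) := @intr_inj R.
have sPR : size PR = e.+3 by rewrite size_map_inj_poly.
have lPR : 1 <= lead_coef PR.
  by rewrite lead_coef_map_inj// -[1]/(1%:~R) ler_int -gtz0_ge1.
have PRE (n : nat) : PR.[n%:R] = P.[n%:Z]%:~R by rewrite -horner_map /= pmulrn.
have [x0 hx0] := poly_eventually_increasing sPR lPR.
have [n1 [K hK]] := proportional_values_gap sPR lPR.
have [C C0 hC] : exists2 C : R, 0 <= C & forall x, 1 <= x ->
  `|PR.[x]| <= C * x ^+ e.+2 by apply: horner_le_pow; rewrite sPR.
pose n0 := maxn 8 (maxn n1 (Num.Def.archi_bound `|x0|)).
have x0n n : (n0 <= n)%N -> x0 <= n%:R.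
  move=> h; apply: le_trans (ler_norm _) _.
  apply: le_trans (ltW (archi_boundP _)) _ => //; rewrite ler_nat.
  by apply: leq_trans h; rewrite !leq_max leqnn !orbT.
have n8 n : (n0 <= n)%N -> (8 <= n)%N by apply: leq_trans; rewrite leq_max leqnn.
have n1n n : (n0 <= n)%N -> (n1 <= n)%N.
  by apply: leq_trans; rewrite !leq_max leqnn orbT.
have pos n : (n0 <= n)%N -> 0 < P.[n%:Z].
  move=> h; have [h1 _] := hx0 _ (x0n n h); rewrite -(ltr_int R) -PRE.
  have : 0 < n%:R ^+ 2 :> R by rewrite exprn_gt0// ltr0n (leq_trans _ (n8 _ h)).
  by lra.
have FE n : (n0 <= n)%N -> (absval P n)%:R = PR.[n%:R] :> R.
  by move=> h; rewrite PRE /absval pmulrn gez0_abs// ltW// pos.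
have Fmono m n : (n0 <= m)%N -> (m < n)%N -> (absval P m < absval P n)%N.
  move=> hm; elim: n => // n IH; rewrite ltnS leq_eqVlt => /predU1P[<-|mn].
    rewrite -(ltr_nat R) !FE ?(leqW hm)//; have [_] := hx0 _ (x0n m hm).
    by rewrite -natr1.
  have hn : (n0 <= n)%N by rewrite ltnW// (leq_ltn_trans hm).
  apply: ltn_trans (IH mn) _.
  rewrite -(ltr_nat R) !FE ?(leqW hn)//; have [_] := hx0 _ (x0n n hn).
  by rewrite -natr1.
exists n0, (Num.Def.archi_bound C), K; split => //.
- by rewrite leq_max leqnn.
- move=> n hn; split; first exact: pos.
  rewrite -(ler_nat R) natrX natrM FE//.
  by have [] := hx0 _ (x0n n hn).
- move=> n hn; rewrite -(ler_nat R) natrM natrX FE//.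
  apply: le_trans (ler_norm _) _; apply: le_trans (hC _ _) _.
    by rewrite ler1n (leq_trans _ (n8 _ hn)).
  by rewrite ler_wpM2r ?exprn_ge0// ltW// archi_boundP.
- move=> u v a1 b1 a2 b2 irr vu /andP[nb1 ba1] /andP[nb2 ba2] a12 e1 e2.
  have na1 := leq_trans nb1 ba1; have na2 := leq_trans nb2 ba2.
  have u0 : (0 < u)%N by case/andP: vu => v0; apply: leq_trans.
  have b12 : (b1 < b2)%N.
    rewrite ltnNge; apply/negP => b21.
    have : (u * absval P b2 <= u * absval P b1)%N.
      rewrite leq_pmul2l//; move: b21; rewrite leq_eqVlt => /predU1P[->//|b21].
      exact/ltnW/Fmono.
    rewrite -e1 -e2 leq_pmul2l; last by case/andP: vu.
    by rewrite leqNgt Fmono.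
  apply: hK irr vu _ ba2 a12 b12 _ _; first by rewrite n1n.
    by rewrite -!FE// -!natrM e1.
  by rewrite -!FE// -!natrM e2.
Qed.

(** From (g h)^3 >= f^2 >= a^4 / 64 follows a^2 / (g h) <= 4 a^(2/3) <= 4 L^(2 s); t is a multiple
    of 3 so that this bound is a power of L. With a / g and a / h at most L^(t - 3), expanding the
    product gives 4 + 1 + 1 + 1 = 7. *)
Lemma two_gcds_weight (L t s a f g h : nat) : t = (3 * s)%N -> (3 <= s)%N ->
  (0 < L)%N -> (0 < a)%N -> (a < L ^ t)%N -> (a ^ 2 <= 8 * f)%N ->
  (L ^ 3 <= g)%N -> (L ^ 3 <= h)%N -> (f ^ 2 <= (g * h) ^ 3)%N ->
  ((a %/ g).+1 * (a %/ h).+1 <= 7 * L ^ (t - 3))%N.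
Proof.
move=> ts s3 L0 a0 aL af gL hL fgh.
have quo k : (L ^ 3 <= k)%N -> (a %/ k <= L ^ (t - 3))%N.
  move=> Lk; have L30 : (0 < L ^ 3)%N by rewrite expn_gt0 L0.
  have k0 : (0 < k)%N := leq_trans L30 Lk.
  rewrite -(leq_pmul2r L30) -expnD subnK; last by lia.
  apply: leq_trans (ltnW aL); apply: leq_trans (leq_trunc_div a k).
  by rewrite leq_mul2l Lk orbT.
have qg := quo _ gL; have qh := quo _ hL.
have prod : ((a %/ g) * (a %/ h) <= 4 * L ^ (t - 3))%N.
  apply: (@leq_trans (4 * L ^ (2 * s))); last first.
    by rewrite leq_mul2l leq_pexp2l//; lia.
  set x := (_ * _)%N.
  have xa : (x * (g * h) <= a ^ 2)%N.
    by rewrite /x mulnACA -mulnn leq_mul ?leq_trunc_div.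
  rewrite -(@leq_exp2r _ _ 3)// -(@leq_pmul2r (a ^ 4)) ?expn_gt0 ?a0//.
  apply: (@leq_trans (x ^ 3 * (64 * f ^ 2)))%N.
    rewrite leq_mul2l; apply/orP; right.
    have -> : (64 * f ^ 2 = (8 * f) ^ 2)%N by rewrite expnMn.
    by rewrite (_ : 4 = 2 * 2)%N// expnM leq_sqr.
  apply: (@leq_trans (64 * (x * (g * h)) ^ 3)%N).
    by rewrite [((x * _) ^ 3)%N]expnMn mulnCA leq_mul2l leq_mul2l fgh !orbT.
  apply: (@leq_trans (64 * (a ^ 2) ^ 3)%N); first by rewrite leq_mul2l leq_exp2r ?xa.
  have -> : ((4 * L ^ (2 * s)) ^ 3 = 64 * (L ^ t) ^ 2)%N.
    by rewrite expnMn -!expnM; congr (_ * L ^ _)%N; lia.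
  have -> : ((a ^ 2) ^ 3 = a ^ 2 * a ^ 4)%N by rewrite -expnM -expnD.
  by rewrite -mulnA leq_mul2l leq_mul ?leq_sqr ?(ltnW aL).
have : (1 <= L ^ (t - 3))%N by rewrite expn_gt0 L0.
by lia.
Qed.

(* With N = L ^ t and D = L ^ 3, the exponent t = 15 e + 42 makes both cases of
   [quad_cases] gain a factor L ^ 2 over the trivial bound N ^ 2. *)
Lemma nquad_bound (P : {poly int}) (e n0 C K : nat) :
  0 < lead_coef P -> (8 <= n0)%N ->
  (forall n, (n0 <= n)%N -> (n ^ 2 <= 8 * absval P n)%N) ->
  (forall m n, (n0 <= m)%N -> (m < n)%N -> (absval P m < absval P n)%N) ->
  (forall n, (n0 <= n)%N -> (absval P n <= C * n ^ e.+2)%N) ->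
  (forall u v a1 b1 a2 b2 : nat,
    (forall m n : nat, 0 < n -> v * m ^ e.+2 <> u * n ^ e.+2)%N ->
    (0 < v <= u)%N -> (n0 <= b1 <= a1)%N -> (n0 <= b2 <= a2)%N ->
    (a1 < a2)%N ->
    (v * absval P a1 = u * absval P b1)%N -> (v * absval P a2 = u * absval P b2)%N ->
    (a1 <= K * u ^ 2 * (a2 - a1) ^ e.+1)%N) ->
  exists t B : nat, (1 < t)%N /\ forall L, (K < L)%N ->
    (nquad (absval P) n0 (L ^ t) <= B * L ^ (2 * t - 2))%N /\
    (forall a, (a < L ^ t)%N -> good (absval P) n0 a ->
       2 ^ size (primes (absval P a)) <= B * L)%N.
Proof.
move=> lP n08 Fsq Fmono Fub gap.
have lP0 : lead_coef P != 0 by rewrite gt_eqF.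
pose s := (5 * e + 14)%N; pose t := (3 * s)%N.
(* For good a < L^t one has F a <= C L^r, so [omega_pow_le] with this r bounds k^omega by a constant
   times a single factor L. *)
pose k := ((2 * nroots_bound P) ^ 2)%N; pose r := (t * e.+2)%N.
pose B0 := ((k ^ r) ^ (k ^ r) * C)%N.
have kap0 := nroots_bound_gt0 lP0.
have k0 : (0 < k)%N by rewrite expn_gt0 muln_gt0 kap0.
have k2 : (2 <= k)%N by rewrite /k -mulnn; nia.
have C0 : (0 < C)%N.
  have := Fub n0 (leqnn _); have := Fsq n0 (leqnn _).
  by case: (C) => // h1 h2; move: h1 n08; rewrite -mulnn; nia.
have B00 : (0 < B0)%N by rewrite muln_gt0 C0 expn_gt0 expn_gt0 k0.
(* With u < L^6, K < L and a1 >= L^(t - 14), a difference a2 - a1 below L^14 would give L^(t - 14) <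
   L L^12 L^(14 (e + 1)); this t excludes it. *)
have t14 : (14 + 12 + 14 * e.+1 < t)%N by rewrite /t /s; lia.
exists t, (12 * (3 + 7 * B0))%N; split; first by lia.
move=> L KL; have L0 : (0 < L)%N by lia.
have omega a : (a < L ^ t)%N -> good (absval P) n0 a ->
    (k ^ size (primes (absval P a)) <= B0 * L)%N.
  move=> aL /andP[na sa].
  have r0 : (0 < r)%N by rewrite muln_gt0 /=; lia.
  rewrite -(@leq_exp2r _ _ r)//; apply: leq_trans (omega_pow_le r k0 sa) _.
  rewrite expnMn; apply: (@leq_trans (B0 * L ^ r)); last first.
    by rewrite leq_mul2r -[X in (X <= _)%N]expn1 leq_pexp2l ?orbT.
  rewrite /B0 -mulnA leq_mul2l; apply/orP; right.
  apply: leq_trans (Fub a na) _; rewrite leq_mul2l; apply/orP; right.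
  by rewrite /r expnM leq_exp2r// ltnW.
split; last first.
  move=> a aL ga; apply: leq_trans (leq_trans (omega a aL ga) _).
    by case: (size _) => // w; rewrite leq_exp2r.
  by rewrite leq_mul2r; lia.
have sum2 : (\sum_(a < L ^ t) \sum_(b < L ^ t) large_gcd (absval P) n0 (L ^ 3) a b
    <= 3 * L ^ (t - 2))%N.
  apply: leq_trans (@sum_large_gcd _ _ Fmono _ _ (L ^ (t - 14)) (L ^ 14) _ _) _.
  - by rewrite expn_gt0 L0.
  - move=> u v a1 b1 a2 b2 uD.
    move=> /and5P[ga1 gb1 ba1 /and4P[su _ cuv vu] /eqP e1].
    move=> /and5P[ga2 gb2 ba2 _ /eqP e2] Ma a12.
    have irr := @squarefree_ratio_irrational u v e su cuv vu.
    have vu' : (0 < v <= u)%N by case/andP: vu => -> /ltnW.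
    have nb1 : (n0 <= b1 <= a1)%N by case/andP: gb1 => ->; rewrite ltnW.
    have nb2 : (n0 <= b2 <= a2)%N by case/andP: gb2 => ->; rewrite ltnW.
    have := gap u v a1 b1 a2 b2 irr vu' nb1 nb2 a12 e1 e2.
    move=> h; rewrite leqNgt; apply/negP => small.
    have : (L ^ (t - 14) <= K * L ^ 12 * (L ^ 14) ^ e.+1)%N.
      apply: leq_trans Ma (leq_trans h _); rewrite leq_mul//.
        rewrite leq_mul2l; apply/orP; right.
        by rewrite (_ : 12 = 3 * 2 * 2)%N// !expnM leq_sqr ltnW.
      by rewrite leq_exp2r// ltnW.
    apply/negP; rewrite -ltnNge.
    apply: (@leq_trans (L * L ^ 12 * (L ^ 14) ^ e.+1))%N.
      by rewrite ltn_pmul2r ?expn_gt0 ?L0// ltn_pmul2r ?expn_gt0 ?L0.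
    by rewrite -expnS -expnM -expnD leq_pexp2l//; lia.
  - rewrite -expnB//; last by lia.
    have -> : ((L ^ 3) ^ 2 * (L ^ 3) ^ 2 = L ^ 12)%N by rewrite -!expnM -expnD.
    have -> : (L ^ (t - 2) = L ^ 12 * L ^ (t - 14))%N by rewrite -expnD; congr (L ^ _)%N; lia.
    rewrite mulnCA leq_mul2l; apply/orP; right.
    have : (0 < L ^ (t - 14))%N by rewrite expn_gt0 L0.
    by lia.
have sum1 : (\sum_(a < L ^ t) \sum_(b < L ^ t) \sum_(c < L ^ t)
    two_gcds (absval P) n0 (L ^ 3) a b c <= L ^ t * (B0 * L * (7 * L ^ (t - 3))))%N.
  apply: sum_ord_le => a.
  case: (boolP (good (absval P) n0 a)) => [ga|nga]; last first.
    rewrite big1// => b _; rewrite big1// => c _.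
    by rewrite /two_gcds (negPf nga).
  have /andP[na sa] := ga.
  apply: leq_trans (@sum_two_gcds P n0 lP0 (L ^ t) (L ^ 3) (7 * L ^ (t - 3)) a sa _) _.
    move=> g h gL hL fgh; apply: (@two_gcds_weight L t s a (absval P a)) => //.
    - by rewrite /s; lia.
    - by lia.
    - exact: Fsq.
  by rewrite leq_mul// omega.
apply: leq_trans (nquad_le_cases Fmono (L ^ t) (L ^ 3)) _.
rewrite -mulnA leq_mul2l /= mulnDl leq_add//.
  apply: (leq_trans (leq_mul (leqnn _) sum2)).
  by rewrite mulnCA leq_mul2l -expnD leq_pexp2l//; lia.
apply: leq_trans sum1 _.
have -> : (L ^ t * (B0 * L * (7 * L ^ (t - 3))) = 7 * B0 * (L ^ t * (L * L ^ (t - 3))))%N.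
  by ring.
by rewrite leq_mul2l -expnS -expnD leq_pexp2l ?orbT//; lia.
Qed.

Lemma leq_nquad (F : nat -> nat) (n0 M N : nat) : (M <= N)%N ->
  (nquad F n0 M <= nquad F n0 N)%N.
Proof.
move=> MN; rewrite /nquad.
have sub (G : nat -> nat) : (\sum_(a < M) G a <= \sum_(a < N) G a)%N.
  by rewrite (big_ord_widen N G MN) big_mkcond; apply: leq_sum => i _; case: ifP.
have sub2 (G H : nat -> nat) : (forall a, (G a <= H a)%N) ->
    (\sum_(a < M) G a <= \sum_(a < N) H a)%N.
  by move=> GH; apply: leq_trans (sub H); apply: leq_sum.
pose q3 K a b c := (\sum_(d < K) quad F n0 a b c d)%N.
pose q2 K a b := (\sum_(c < K) q3 K a b c)%N.
pose q1 K a := (\sum_(b < K) q2 K a b)%N.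
apply: (sub2 (q1 M) (q1 N)) => a; apply: (sub2 (q2 M a) (q2 N a)) => b.
apply: (sub2 (q3 M a b) (q3 N a b)) => c.
exact: (sub (fun d => quad F n0 a b c d)).
Qed.

(** This passes from the powers L^t to all N: for the least L with N <= L^t one has (L - 1)^t <= N
    and L <= 2 (L - 1), a loss bounded in terms of t. As w = O(L), the gain L^2 leaves one factor L
    after multiplication by w + 1. *)
Lemma nquad_littleo (F : nat -> nat) (n0 K t B : nat) : (1 < t)%N ->
  (forall L, (K < L)%N -> (nquad F n0 (L ^ t) <= B * L ^ (2 * t - 2))%N /\
    (forall a, (a < L ^ t)%N -> good F n0 a -> 2 ^ size (primes (F a)) <= B * L)%N) ->
  forall m, exists N0, forall N, (N0 <= N)%N -> exists w,
    (forall a, (a < N)%N -> good F n0 a -> size (primes (F a)) <= w)%N /\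
    (m * w.+1 * nquad F n0 N <= N ^ 2)%N.
Proof.
move=> t1 hB m; pose L0 := (K + 2 ^ (2 * t) * (2 * m * B.+1 * B.+1) + 2)%N.
exists (L0 ^ t)%N => N N0N.
have ex : exists L, (N <= L ^ t)%N.
  by exists N; rewrite -[X in (X <= _)%N]expn1; case: (N) => // n; rewrite leq_pexp2l//; lia.
case: (ex_minnP ex) => L NL Lmin.
have L1 : (L0 <= L)%N by rewrite -(@leq_exp2r _ _ t) ?(leq_trans N0N)//; lia.
have [l lE] : exists l, L = l.+1 by case: (L) L1 => [|l]; [rewrite /L0; lia|exists l].
have lN : (l ^ t <= N)%N.
  by rewrite leqNgt; apply/negP => /ltnW /Lmin; rewrite lE ltnn.
have KL : (K < L)%N by apply: leq_trans L1; rewrite /L0; lia.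
have [h1 h2] := hB L KL.
exists (B * L)%N; split.
  move=> a aN ga; apply: leq_trans (h2 a (leq_trans aN NL) ga).
  exact: ltnW (ltn_expl _ _).
have l0 : (0 < l)%N.
  by move: L1; rewrite lE /L0; case: (l) => // ; lia.
apply: (@leq_trans (l ^ (2 * t))); last by rewrite mulnC expnM leq_sqr.
apply: (@leq_trans (m * (B.+1 * L) * (B.+1 * L ^ (2 * t - 2)))).
  rewrite leq_mul//; first by rewrite leq_mul2l mulSn addnC -addn1 leq_add2l lE orbT.
  apply: leq_trans (leq_nquad _ _ NL) (leq_trans h1 _).
  by rewrite leq_mul2r leqnSn orbT.
have -> : (m * (B.+1 * L) * (B.+1 * L ^ (2 * t - 2)) =
  m * B.+1 * B.+1 * L ^ (2 * t - 1))%N.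
  rewrite (_ : 2 * t - 1 = (2 * t - 2).+1)%N; last by lia.
  by rewrite expnS; ring.
apply: (@leq_trans (m * B.+1 * B.+1 * (2 ^ (2 * t) * l ^ (2 * t - 1))))%N.
  rewrite leq_mul2l; apply/orP; right.
  apply: (@leq_trans ((2 * l) ^ (2 * t - 1))%N).
    by rewrite leq_exp2r; lia.
  by rewrite expnMn leq_mul2r leq_pexp2l ?orbT//; lia.
have -> : (l ^ (2 * t) = l * l ^ (2 * t - 1))%N by rewrite -expnS; congr (l ^ _)%N; lia.
rewrite mulnA leq_mul2r; apply/orP; right.
have E : (2 ^ (2 * t) * (2 * m * B.+1 * B.+1) = 2 * (m * B.+1 * B.+1 * 2 ^ (2 * t)))%N.
  by ring.
by move: L1; rewrite lE /L0 E; lia.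
Qed.

(** A squarefree value whose primes are all at most K divides K!, so n <= K! as soon as n >= n0. *)
Lemma count_smooth_values (P : {poly int}) (n0 K N : nat) :
  (forall n, (n0 <= n)%N -> (n <= absval P n)%N) ->
  (\sum_(n < N) (squarefree (absval P n) && all (fun p => p <= K) (primes (absval P n)))
     <= n0 + K`!.+1)%N.
Proof.
move=> hn; pose p n := squarefree (absval P n) &&
  all (fun p => (p <= K)%N) (primes (absval P n)).
rewrite (@sum_bool_count N p) -size_filter -(size_iota 0 (n0 + K`!.+1)).
apply: uniq_leq_size; first by rewrite filter_uniq ?iota_uniq.
move=> n; rewrite mem_filter !mem_iota !add0n /= => /andP[/andP[sn /allP al] _].
have [nn0|] := ltnP n n0; first by rewrite (leq_trans nn0)// leq_addr.
move=> /hn nF; rewrite addnS ltnS (leq_trans nF)// (leq_trans _ (leq_addl _ _))//.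
apply: dvdn_leq (fact_gt0 _) _; apply: squarefree_dvdP => // q qp qn.
rewrite dvdn_fact// prime_gt0//=; apply: al.
by rewrite mem_primes qp qn (squarefree_gt0 sn).
Qed.

(** * Walsh functions on a finite cube *)

Section Mean.
Variables (R : realFieldType) (Omega : finType).
Implicit Types X Y : Omega -> R.

Definition mean X : R := (\sum_w X w) / #|Omega|%:R.

Lemma eq_mean X Y : X =1 Y -> mean X = mean Y.
Proof. by move=> e; rewrite /mean (eq_bigr Y). Qed.

Lemma meanD X Y : mean (fun w => X w + Y w) = mean X + mean Y.
Proof. by rewrite /mean big_split mulrDl. Qed.

Lemma meanZ a X : mean (fun w => a * X w) = a * mean X.
Proof. by rewrite /mean -mulr_sumr mulrA. Qed.

Lemma meanN X : mean (fun w => - X w) = - mean X.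
Proof. by rewrite /mean sumrN mulNr. Qed.

Lemma meanB X Y : mean (fun w => X w - Y w) = mean X - mean Y.
Proof. by rewrite meanD meanN. Qed.

Lemma mean_sum (I : finType) (Q : pred I) (X : I -> Omega -> R) :
  mean (fun w => \sum_(i | Q i) X i w) = \sum_(i | Q i) mean (X i).
Proof. by rewrite /mean exchange_big mulr_suml. Qed.

Lemma ler_mean X Y : (forall w, X w <= Y w) -> mean X <= mean Y.
Proof. by move=> h; rewrite ler_wpM2r// ler_sum. Qed.

Lemma mean_norm X : `|mean X| <= mean (fun w => `|X w|).
Proof.
have c0 : 0 <= #|Omega|%:R^-1 :> R by rewrite invr_ge0.
by rewrite normrM (ger0_norm c0) ler_wpM2r// ler_norm_sum.
Qed.

Hypothesis Omega_gt0 : (0 < #|Omega|)%N.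

Lemma mean_cst a : mean (fun=> a) = a.
Proof.
by rewrite /mean sumr_const -[a *+ _]mulr_natr mulfK// pnatr_eq0 -lt0n.
Qed.

Lemma mean_norm_le X a : (forall w, `|X w| <= a) -> `|mean X| <= a.
Proof.
by move=> h; rewrite (le_trans (mean_norm X))// -[leRHS]mean_cst ler_mean.
Qed.

End Mean.

Section Walsh.
Variables (R : realFieldType) (I : finType).
Local Notation Omega := {ffun I -> bool}.

Definition walsh (S : {set I}) (w : Omega) : R := \prod_(i in S) (-1) ^+ w i.

Definition flip (p : I) (w : Omega) : Omega :=
  [ffun i => if i == p then ~~ w i else w i].

Lemma flipK p : involutive (flip p).
Proof.
by move=> w; apply/ffunP => i; rewrite !ffunE; case: eqP => // _; rewrite negbK.
Qed.

Lemma card_Omega_gt0 : (0 < #|{: Omega}|)%N.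
Proof. by apply/card_gt0P; exists [ffun=> true]. Qed.

Lemma mean_flip p (X : Omega -> R) : mean (X \o flip p) = mean X.
Proof.
rewrite /mean [in RHS](reindex_inj (inv_inj (flipK p))).
by congr (_ / _); apply: eq_bigr.
Qed.

Lemma mean_odd p (X : Omega -> R) : (forall w, X (flip p w) = - X w) -> mean X = 0.
Proof.
move=> h; have : mean X = - mean X.
  by rewrite -meanN -(mean_flip p X); apply: eq_mean => w /=.
by move=> e; apply/eqP; rewrite -[_ == 0](mulrn_eq0 _ 2) mulr2n {1}e addNr.
Qed.

Lemma walsh_flip p (S : {set I}) w :
  walsh S (flip p w) = (if p \in S then -1 else 1) * walsh S w.
Proof.
case: ifPn => pS; last first.
  rewrite mul1r; apply: eq_bigr => i iS; rewrite ffunE.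
  by case: eqP => // ip; move: pS; rewrite -ip iS.
rewrite /walsh (bigD1 p)//= [in RHS](bigD1 p)//= ffunE eqxx mulrA; congr (_ * _).
  by case: (w p); rewrite ?expr0 ?expr1; ring.
by apply: eq_bigr => i /andP[_ ip]; rewrite ffunE (negPf ip).
Qed.

Lemma normr_walsh S w : `|walsh S w| = 1.
Proof. by rewrite normr_prod big1// => i _; rewrite normr_sign. Qed.

Definition even_cover (S1 S2 S3 S4 : {set I}) : bool :=
  [forall p, ~~ ((p \in S1) (+) (p \in S2) (+) (p \in S3) (+) (p \in S4))].

(** Flipping a coordinate that is covered an odd number of times changes the sign of the product, so
    its mean vanishes. *)
Lemma mean_walsh4 S1 S2 S3 S4 :
  mean (fun w => walsh S1 w * walsh S2 w * (walsh S3 w * walsh S4 w))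
    <= (even_cover S1 S2 S3 S4)%:R.
Proof.
case: (boolP (even_cover _ _ _ _)) => [_|].
  apply: le_trans (ler_norm _) _; apply: mean_norm_le; first exact: card_Omega_gt0.
  by move=> w; rewrite !normrM !normr_walsh !mulr1.
rewrite negb_forall => /existsP[p]; rewrite negbK => pp.
rewrite (@mean_odd p)// => w; rewrite !walsh_flip.
by move: pp; case: (p \in S1); case: (p \in S2); case: (p \in S3);
  case: (p \in S4) => //= _; ring.
Qed.

Lemma mean_walsh2 S1 S2 : S1 != S2 -> mean (fun w => walsh S1 w * walsh S2 w) = 0.
Proof.
move=> S12; have [p pp] : exists p, (p \in S1) (+) (p \in S2).
  apply/existsP; apply: contraNT S12; rewrite negb_exists => /forallP h.
  apply/eqP/setP => p; have := h p.
  by do 2!case: (p \in _).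
rewrite (@mean_odd p)// => w; rewrite !walsh_flip.
by move: pp; case: (p \in S1); case: (p \in S2) => //= _; ring.
Qed.

Variable (J : finType) (S : J -> {set I}).
Local Notation chi n := (walsh (S n)).

Lemma mean_quadratic (u v : J -> J -> bool) :
  mean (fun w => (\sum_n \sum_m (u n m)%:R * (chi n w * chi m w)) *
                 (\sum_n \sum_m (v n m)%:R * (chi n w * chi m w)))
  <= (\sum_a \sum_b \sum_c \sum_d
        (u a b && v c d && even_cover (S a) (S b) (S c) (S d)))%N%:R.
Proof.
rewrite (@eq_mean _ _ _ (fun w => \sum_a \sum_b \sum_c \sum_d
   (u a b && v c d)%:R * (chi a w * chi b w * (chi c w * chi d w)))); last first.
  move=> w; rewrite mulr_suml; apply: eq_bigr => a _; rewrite mulr_suml; apply: eq_bigr => b _.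
  rewrite mulr_sumr; apply: eq_bigr => c _; rewrite mulr_sumr; apply: eq_bigr => d _.
  by case: (u a b); case: (v c d); rewrite /= ?mul0r ?mulr0 ?mul1r.
rewrite mean_sum natr_sum; apply: ler_sum => a _.
rewrite mean_sum natr_sum; apply: ler_sum => b _.
rewrite mean_sum natr_sum; apply: ler_sum => c _.
rewrite mean_sum natr_sum; apply: ler_sum => d _.
rewrite meanZ; case: (u a b && v c d); rewrite /= ?mul0r// mul1r.
exact: mean_walsh4.
Qed.

End Walsh.

(** * Stein's method for sums of Walsh functions *)

Lemma sqr_sum_cond (R : comPzRingType) (J : finType) (q : pred J) (x : J -> R) :
  (\sum_(n | q n) x n) ^+ 2 = \sum_n \sum_m (q n && q m)%:R * (x n * x m).
Proof.
rewrite expr2 big_distrlr big_mkcond; apply: eq_bigr => n _ /=.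
case: (q n) => /=; last by rewrite big1// => m _; rewrite mul0r.
rewrite big_mkcond; apply: eq_bigr => m _.
by case: (q m); rewrite ?mul1r ?mul0r.
Qed.

Section SteinBound.
Variables (R : realFieldType) (I J : finType) (S : J -> {set I}).
Variables (A B : pred J) (pi : J -> I) (s : R).
Local Notation Omega := {ffun I -> bool}.
Local Notation chi n := (@walsh R I (S n)).
Hypothesis AB : forall n, A n -> B n.
Hypothesis Api : forall n, A n -> pi n \in S n.
Hypothesis Sinj : forall m n, A m -> A n -> S m = S n -> m = n.
Hypothesis s_gt0 : 0 < s.
Hypothesis sB : s ^+ 2 = #|B|%:R.

Definition walsh_sum (w : Omega) : R := (\sum_(n | B n) chi n w) / s.

Definition divisible_sum (p : I) (w : Omega) : R :=
  \sum_(m | B m && (p \in S m)) chi m w.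

Definition fiber_sum (p : I) (w : Omega) : R := \sum_(n | A n && (pi n == p)) chi n w.

(** The diagonal m = n is left out because it contributes exactly [#|A|], the main term in
    [sum_divisible_sum]. *)
Definition linked (n m : J) : bool := [&& A n, B m, m != n & pi n \in S m].

Definition linked_sum (w : Omega) : R :=
  \sum_n \sum_m (linked n m)%:R * (chi n w * chi m w).

Definition linked_quads : nat :=
  (\sum_a \sum_b \sum_c \sum_d
     (linked a b && linked c d && even_cover (S a) (S b) (S c) (S d)))%N.

Definition divisible_quads (p : I) : nat :=
  (\sum_a \sum_b \sum_c \sum_d
     ([&& B a && (p \in S a), B b && (p \in S b), B c && (p \in S c)
       & B d && (p \in S d)] && even_cover (S a) (S b) (S c) (S d)))%N.

Lemma walsh_sum_flip p w :
  walsh_sum (flip p w) = walsh_sum w - 2%:R * divisible_sum p w / s.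
Proof.
rewrite /walsh_sum -mulrBl; congr (_ / s).
rewrite /divisible_sum (bigID (fun m => p \in S m)) [in RHS](bigID (fun m => p \in S m)) /=.
rewrite (eq_bigr (fun m => - chi m w)); last first.
  by move=> m /andP[_ pm]; rewrite walsh_flip pm mulN1r.
rewrite [X in _ + X = _](eq_bigr (fun m => chi m w)); last first.
  by move=> m /andP[_ pm]; rewrite walsh_flip (negPf pm) mul1r.
by rewrite sumrN; ring.
Qed.

(** By [Sinj], distinct n give orthogonal Walsh functions. This is the cancellation within a fiber
    on which the estimate of the Taylor remainder rests. *)
Lemma mean_fiber_sum_sqr p :
  mean (fun w => fiber_sum p w ^+ 2) = #|[pred n | A n && (pi n == p)]|%:R.
Proof.
rewrite (@eq_mean _ _ _ (fun w => \sum_(n | A n && (pi n == p))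
   \sum_(m | A m && (pi m == p)) chi n w * chi m w)); last first.
  by move=> w; rewrite expr2 big_distrlr.
rewrite mean_sum -sum1_card natr_sum; apply: eq_bigr => n /andP[An pn].
rewrite mean_sum (bigD1 n) ?An//= big1 => [|m /andP[/andP[Am _] mn]]; last first.
  by apply: mean_walsh2; apply: contra mn => /eqP e; apply/eqP/Sinj.
rewrite addr0 (@eq_mean _ _ _ (fun=> 1)) ?mean_cst ?card_Omega_gt0// => w.
by rewrite -expr2 -real_normK ?num_real// normr_walsh expr1n.
Qed.

Lemma mean_divisible_sum4 p :
  mean (fun w => divisible_sum p w ^+ 4) <= (divisible_quads p)%:R.
Proof.
pose u n m := (B n && (p \in S n)) && (B m && (p \in S m)).
have := @mean_quadratic R I J S u u.
rewrite (_ : (\sum_a _)%N = divisible_quads p); last first.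
  do 4!(apply: eq_bigr => ? _); by rewrite /u -!andbA.
apply: le_trans; apply/ler_mean => w; rewrite le_eqVlt; apply/orP; left; apply/eqP.
by rewrite (_ : 4 = 2 + 2)%N// exprD sqr_sum_cond.
Qed.

Lemma sum_divisible_sum w :
  \sum_(n | A n) chi n w * divisible_sum (pi n) w = #|A|%:R + linked_sum w.
Proof.
rewrite -sum1_card natr_sum /linked_sum.
rewrite [X in _ = _ + X](_ : _ = \sum_(n | A n) \sum_m (linked n m)%:R * (chi n w * chi m w)); last first.
  rewrite [RHS]big_mkcond; apply: eq_bigr => n _; case: ifP => // An.
  by rewrite big1// => m _; rewrite /linked An mul0r.
rewrite -big_split; apply: eq_bigr => n An /=.
rewrite /divisible_sum (bigD1 n) /=; last by rewrite AB ?Api.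
rewrite mulrDr; congr (_ + _).
  by rewrite -expr2 -real_normK ?num_real// normr_walsh expr1n.
rewrite mulr_sumr big_mkcond; apply: eq_bigr => m _; rewrite /linked An /= -andbA [(m != n) && _]andbC.
by case: (_ && _); rewrite ?mul1r ?mul0r.
Qed.

Variables (g g1 : R -> R) (G0 G1 G2 : R).
Hypothesis g_le : forall x, `|g x| <= G0.
Hypothesis g1_le : forall x, `|g1 x| <= G1.
Hypothesis g_taylor : forall x h, `|g x - g (x - h) - h * g1 x| <= G2 * h ^+ 2.

Local Notation W := walsh_sum.
Let r p w := g (W w) - g (W (flip p w)) - 2%:R * divisible_sum p w / s * g1 (W w).

Let mean_walsh_g n : A n ->
  mean (fun w => chi n w * g (W w)) =
  mean (fun w => chi n w * divisible_sum (pi n) w * g1 (W w)) / s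
  + mean (fun w => chi n w * r (pi n) w) / 2%:R.
Proof.
move=> An; set p := pi n.
have e : mean (fun w => chi n w * g (W w)) = - mean (fun w => chi n w * g (W (flip p w))).
  rewrite -meanN -(mean_flip p); apply: eq_mean => w /=.
  by rewrite walsh_flip Api// mulN1r mulNr.
have : mean (fun w => chi n w * g (W w)) - mean (fun w => chi n w * g (W (flip p w))) =
   2%:R / s * mean (fun w => chi n w * divisible_sum p w * g1 (W w))
   + mean (fun w => chi n w * r p w).
  by rewrite -meanB -meanZ -meanD; apply: eq_mean => w; rewrite /r; ring.
by lra.
Qed.

(* [delta] and [lambda] are the weights of the inequality 2 x y <= w x ^ 2 + y ^ 2 / w,
   used for the off-diagonal sum and for the Taylor remainder. *)
Lemma stein_bound (delta lambda : R) : 0 < delta -> 0 < lambda ->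
  `|mean (fun w => g1 (W w) - W w * g (W w))| <=
    (G0 / s + G1 / s ^+ 2) * #|[pred n | B n && ~~ A n]|%:R
    + G1 * (delta + linked_quads%:R / (delta * s ^+ 4))
    + 2%:R * G2 / s ^+ 3 * (lambda * #|A|%:R
        + (\sum_(p | [exists n, A n && (pi n == p)]) divisible_quads p)%N%:R / lambda).
Proof.
move=> d0 l0; set b := #|[pred n | B n && ~~ A n]|.
have G10 : 0 <= G1 := le_trans (normr_ge0 _) (g1_le 0).
have G20 : 0 <= G2.
  by have := le_trans (normr_ge0 _) (g_taylor 0 1); rewrite expr1n mulr1.
have s2 : s ^+ 2 = #|A|%:R + b%:R.
  rewrite sB -natrD /b; congr (_%:R); rewrite -!sum1_card (bigID A) /=; congr (_ + _)%N.
  by apply: eq_bigl => n; rewrite !unfold_in; have := @AB n; case: (A n); case: (B n) => // ->.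
pose M p := mean (fun w => fiber_sum p w * r p w).
(* The three terms are the linear Taylor term over A (diagonal and linked pairs), the Taylor
   remainder over A, and the n in B outside A, where no coordinate is flipped. *)
have split : mean (fun w => W w * g (W w)) =
   mean (fun w => g1 (W w) * (#|A|%:R + linked_sum w)) / s ^+ 2
   + (\sum_p M p) / (2%:R * s)
   + (\sum_(n | B n && ~~ A n) mean (fun w => chi n w * g (W w))) / s.
  rewrite (@eq_mean _ _ _ (fun w => s^-1 * \sum_(n | B n) chi n w * g (W w))); last first.
    by move=> w; rewrite -mulr_suml mulrA [s^-1 * _]mulrC.
  rewrite meanZ mean_sum (bigID A) /= mulrDr; congr (_ + _); last by rewrite mulrC.
  rewrite (eq_bigl A); last by move=> n; rewrite andbC; case: (boolP (A n)) => // /AB.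
  rewrite (_ : \sum_(n | A n) _ =
      (\sum_(n | A n) mean (fun w => chi n w * divisible_sum (pi n) w * g1 (W w))) / s
      + (\sum_(n | A n) mean (fun w => chi n w * r (pi n) w)) / 2%:R); last first.
    by rewrite (eq_bigr _ mean_walsh_g) big_split !mulr_suml.
  (* All n with the same flipped coordinate p share the remainder [r p], so they can be kept
     together as one [fiber_sum]. *)
  rewrite (_ : \sum_(n | A n) mean (fun w => chi n w * r (pi n) w) = \sum_p M p); last first.
    rewrite (partition_big pi xpredT)//=; apply: eq_bigr => p _.
    rewrite -mean_sum; apply: eq_mean => w; rewrite /fiber_sum mulr_suml.
    by apply: eq_bigr => n /andP[_ /eqP ->].
  rewrite -mean_sum (@eq_mean _ _ (fun w => \sum_(n | A n) _)
    (fun w => g1 (W w) * (#|A|%:R + linked_sum w))); last first.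
    move=> w; rewrite -sum_divisible_sum mulr_sumr; apply: eq_bigr => n _.
    by rewrite mulrC.
  by field; rewrite gt_eqF.
have bad : `|(\sum_(n | B n && ~~ A n) mean (fun w => chi n w * g (W w))) / s| <= G0 / s * b%:R.
  have si0 : 0 <= s^-1 by rewrite invr_ge0 ltW.
  rewrite normrM (ger0_norm si0) [leRHS]mulrAC ler_wpM2r//.
  apply: le_trans (ler_norm_sum _ _ _) _.
  rewrite (le_trans (ler_sum _ (_ : forall n, _ -> _ <= G0)))//.
    by move=> n _; apply: mean_norm_le => [|w]; rewrite ?card_Omega_gt0// normrM normr_walsh mul1r.
  by rewrite sumr_const mulr_natr.
have remainder : `|(\sum_p M p) / (2%:R * s)| <= 2%:R * G2 / s ^+ 3 * (lambda * #|A|%:R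
        + (\sum_(p | [exists n, A n && (pi n == p)]) divisible_quads p)%N%:R / lambda).
  have Mp p : `|M p| <= 4%:R * G2 / s ^+ 2 * (lambda * #|[pred n | A n && (pi n == p)]|%:R
      + (if [exists n, A n && (pi n == p)] then (divisible_quads p)%:R / lambda else 0)).
    case: ifPn => [_|]; last first.
      rewrite negb_exists => /forallP nA.
      have F0 w : fiber_sum p w = 0 by apply: big_pred0 => n; apply/negbTE.
      rewrite /M (@eq_mean _ _ _ (fun=> 0)) => [|w]; last by rewrite F0 mul0r.
      rewrite mean_cst ?card_Omega_gt0// normr0 addr0 !mulr_ge0 ?invr_ge0 ?exprn_ge0//.
        exact: ltW.
      exact: ltW.
    apply: le_trans (mean_norm _) _.
    apply: (@le_trans _ _ (mean (fun w => 4%:R * G2 / s ^+ 2 *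
      (lambda * fiber_sum p w ^+ 2 + divisible_sum p w ^+ 4 / lambda)))).
      apply: ler_mean => w; rewrite normrM.
      have := g_taylor (W w) (2%:R * divisible_sum p w / s).
      rewrite -walsh_sum_flip -/(r p w) => hr.
      apply: le_trans (ler_wpM2l (normr_ge0 _) hr) _.
      rewrite (_ : G2 * _ = 4%:R * G2 / s ^+ 2 * divisible_sum p w ^+ 2); last first.
        by field; rewrite gt_eqF.
      rewrite mulrCA ler_wpM2l//; first by rewrite !mulr_ge0 ?invr_ge0 ?exprn_ge0// ltW.
      set x := fiber_sum p w; set y := divisible_sum p w.
      rewrite -(ler_pM2r l0) mulrDl divfK ?gt_eqF//.
      rewrite -[x ^+ 2]real_normK ?num_real// (_ : y ^+ 4 = (y ^+ 2) ^+ 2); last by rewrite -exprM.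
      have := sqr_ge0 (lambda * `|x| - y ^+ 2 / 2%:R); have := sqr_ge0 (y ^+ 2).
      by nra.
    rewrite meanZ ler_wpM2l//; first by rewrite !mulr_ge0 ?invr_ge0 ?exprn_ge0// ltW.
    rewrite meanD meanZ mean_fiber_sum_sqr lerD2l.
    rewrite (@eq_mean _ _ _ (fun w => lambda^-1 * divisible_sum p w ^+ 4)); last first.
      by move=> w; rewrite mulrC.
    by rewrite meanZ mulrC ler_wpM2r ?mean_divisible_sum4// invr_ge0 ltW.
  have k0 : 0 <= (2%:R * s)^-1 by rewrite invr_ge0 mulr_ge0// ltW.
  rewrite normrM (ger0_norm k0).
  apply: (@le_trans _ _ ((\sum_p `|M p|) / (2%:R * s))).
    by rewrite ler_wpM2r// ler_norm_sum.
  apply: le_trans (ler_wpM2r k0 (ler_sum _ (fun p _ => Mp p))) _.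
  rewrite -mulr_sumr big_split /= -mulr_sumr -natr_sum.
  rewrite (_ : (\sum_p #|_|)%N = #|A|); last first.
    rewrite -sum1_card (partition_big pi xpredT)//=; apply: eq_bigr => p _.
    by rewrite sum1_card.
  rewrite -big_mkcond natr_sum mulr_suml le_eqVlt; apply/orP; left; apply/eqP.
  by field; rewrite gt_eqF//.
have main : `|mean (fun w => g1 (W w)) -
    mean (fun w => g1 (W w) * (#|A|%:R + linked_sum w)) / s ^+ 2| <=
    G1 / s ^+ 2 * b%:R + G1 * (delta + linked_quads%:R / (delta * s ^+ 4)).
  rewrite (_ : mean _ - _ = mean (fun w => g1 (W w) * (b%:R - linked_sum w) / s ^+ 2)); last first.
    transitivity (mean (fun w => g1 (W w)) - (s ^+ 2)^-1 *
        mean (fun w => g1 (W w) * (#|A|%:R + linked_sum w))); first by rewrite [in RHS]mulrC.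
    rewrite -meanZ -meanB; apply: eq_mean => w.
    have -> : b%:R = s ^+ 2 - #|A|%:R by rewrite s2; ring.
    by field; rewrite gt_eqF.
  have s20 : 0 < s ^+ 2 by rewrite exprn_gt0.
  apply: le_trans (mean_norm _) _.
  apply: (@le_trans _ _ (mean (fun w => G1 / s ^+ 2 *
     (b%:R + delta * s ^+ 2 + (delta * s ^+ 2)^-1 * linked_sum w ^+ 2)))).
    apply: ler_mean => w; rewrite mulrAC normrM.
    have G1s : `|g1 (W w) / s ^+ 2| <= G1 / s ^+ 2.
      have i2 : 0 <= (s ^+ 2)^-1 by rewrite invr_ge0 ltW.
      by rewrite normrM (ger0_norm i2) ler_wpM2r.
    apply: ler_pM => //; apply: le_trans (ler_normB _ _) _; rewrite normr_nat -addrA lerD2l.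
    set z := linked_sum w; have e0 : 0 < delta * s ^+ 2 by rewrite mulr_gt0.
    move: (delta * s ^+ 2) e0 => e e0.
    rewrite -(ler_pM2r e0) mulrDl mulrAC mulVf ?gt_eqF// mul1r -[z ^+ 2]real_normK ?num_real//.
    by have := sqr_ge0 (`|z| - e / 2%:R); have := sqr_ge0 e; nra.
  rewrite meanZ meanD mean_cst ?card_Omega_gt0// meanZ.
  rewrite (_ : G1 / s ^+ 2 * b%:R + _ = G1 / s ^+ 2 * (b%:R + delta * s ^+ 2
     + (delta * s ^+ 2)^-1 * linked_quads%:R)); last by field; rewrite !gt_eqF.
  apply: ler_wpM2l; first by rewrite divr_ge0// ltW.
  rewrite lerD2l; apply: ler_wpM2l; first by rewrite invr_ge0 mulr_ge0// ltW.
  exact: (mean_quadratic _ S linked linked).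
rewrite meanB split.
apply: (@le_trans _ _ (G1 / s ^+ 2 * b%:R + G1 * (delta + linked_quads%:R / (delta * s ^+ 4))
  + 2%:R * G2 / s ^+ 3 * (lambda * #|A|%:R
        + (\sum_(p | [exists n, A n && (pi n == p)]) divisible_quads p)%N%:R / lambda)
  + G0 / s * b%:R)); last by lra.
rewrite !opprD !addrA.
by apply: le_trans (ler_normB _ _) (lerD (le_trans (ler_normB _ _) (lerD main remainder)) bad).
Qed.
End SteinBound.

(** * The Stein equation for compactly supported functions *)

(** The intermediate point is located by its distance to x, so that increments of either sign are
    covered. *)
Lemma mean_value (R : realType) (f df : R -> R) :
  (forall x : R, is_derive x (1 : R) f (df x)) ->
  forall x y, exists2 c, `|c - x| <= `|y - x| & f y - f x = df c * (y - x).
Proof.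
move=> fd.
have cf : continuous f.
  move=> z; apply/differentiable_continuous/derivable1_diffP.
  by have [] := fd z.
have main x y : x <= y -> exists2 c, x <= c <= y & f y - f x = df c * (y - x).
  move=> xy; have h z : z \in `]x, y[%R -> is_derive z (1 : R) f (df z) by move=> _; exact: fd.
  have [c + ->] := MVT_segment xy h (continuous_subspaceT cf).
  by rewrite in_itv /= => cxy; exists c.
move=> x y; have [xy|/ltW yx] := leP x y.
  have [c /andP[c1 c2] e] := main x y xy; exists c => //.
  by rewrite !ger0_norm ?subr_ge0// lerD2r.
have [c /andP[c1 c2] e] := main y x yx; exists c.
  by rewrite (distrC c) (distrC y) !ger0_norm ?subr_ge0// lerD2l lerN2.
by rewrite -opprB e -mulrN opprB.
Qed.

Lemma lipschitz_of_derive (R : realType) (f df : R -> R) (C : R) :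
  (forall x : R, is_derive x (1 : R) f (df x)) -> (forall x, `|df x| <= C) ->
  forall x y, `|f x - f y| <= C * `|x - y|.
Proof.
move=> fd dC x y; have [c _ ->] := mean_value fd y x.
by rewrite normrM ler_wpM2r.
Qed.

Lemma taylor_of_lipschitz_derive (R : realType) (f df : R -> R) (C : R) : 0 <= C ->
  (forall x : R, is_derive x (1 : R) f (df x)) ->
  (forall x y, `|df x - df y| <= C * `|x - y|) ->
  forall x h, `|f x - f (x - h) - h * df x| <= C * h ^+ 2.
Proof.
move=> C0 fd dC x h; have [c cx e] := mean_value fd x (x - h).
have -> : f x - f (x - h) = h * df c by rewrite -opprB e; ring.
rewrite -[h ^+ 2]real_normK ?num_real// -mulrBr normrM expr2 mulrCA ler_wpM2l//.
apply: le_trans (dC _ _) _; rewrite ler_wpM2l// (le_trans cx)//.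
by rewrite (_ : x - h - x = - h) ?normrN//; ring.
Qed.

Lemma lipschitz_continuous (R : realType) (f : R -> R) (C : R) :
  (forall x y, `|f x - f y| <= C * `|x - y|) -> continuous f.
Proof.
move=> fC x; apply/cvgrPdist_le => e e0.
have C0 : 0 < `|C| + 1 by rewrite ltr_wpDl.
near=> y; apply: le_trans (fC x y) _.
apply: (@le_trans _ _ ((`|C| + 1) * `|x - y|)).
  by rewrite ler_wpM2r// (le_trans (ler_norm C))// lerDl.
rewrite -ler_pdivlMl// mulrC; near: y.
by apply: (cvgr_dist_le (fun y : R => y) x) => //; rewrite divr_gt0.
Unshelve. all: by end_near. Qed.

Section SteinEquation.
Variable R : realType.
Local Notation mu := (@lebesgue_measure R).
Local Notation phi := (normal_pdf (0 : R) 1).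

Definition gauss_mean (psi : R -> R) : R := (\int[mu]_x (psi x * phi x))%R.

Lemma normal_pdf_std x : phi x = normal_peak 1 * expR (- x ^+ 2 / 2%:R).
Proof. by rewrite normal_pdfE ?oner_neq0// /normal_fun subr0 expr1n mulr2n. Qed.

Lemma integrable_mul_normal_pdf (psi : R -> R) (M : R) : continuous psi ->
  (forall x, `|psi x| <= M) ->
  mu.-integrable [set: R] (EFin \o (fun x => psi x * phi x)).
Proof.
move=> cpsi bpsi.
apply: (@integrableMr _ _ R mu setT measurableT psi (EFin \o phi)).
- exact: continuous_measurable_fun.
- exists M; split; first exact: num_real.
  by move=> N MN x _; apply: le_trans (bpsi x) (ltW MN).
- exact: integrable_normal_pdf.
Qed.

(* The solution is g x = F x / phi x with F the integral of psi * phi up to x; it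
   vanishes outside [-L, L] because the total integral does. *)
Lemma stein_solution (psi : R -> R) (L M Lip : R) : 0 < L ->
  (forall x y, `|psi x - psi y| <= Lip * `|x - y|) ->
  (forall x, `|psi x| <= M) ->
  (forall x, L <= `|x| -> psi x = 0) ->
  gauss_mean psi = 0 ->
  exists g g1 : R -> R, exists G0 G1 G2 : R,
    [/\ forall x, `|g x| <= G0, forall x, `|g1 x| <= G1,
        forall x h, `|g x - g (x - h) - h * g1 x| <= G2 * h ^+ 2
      & forall x, g1 x - x * g x = psi x].
Proof.
move=> L0 Lpsi Mpsi psi0 mean0.
have cpsi := lipschitz_continuous Lpsi.
pose f x := psi x * phi x.
have intf := integrable_mul_normal_pdf cpsi Mpsi.
pose F x := (\int[mu]_(t in `]-oo, x]) f t)%R.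
have Fd x : is_derive x (1 : R) (F : R -> R) (f x).
  have [] := @continuous_FTC1 R f -oo%O x (x + 1) _ _ _ _.
  - by rewrite ltrDl.
  - by apply: integrableS intf.
  - by rewrite ltNyr.
  - apply: continuousM; first exact: cpsi.
    by apply: continuous_normal_pdf; rewrite oner_neq0.
  - by move=> dF eF; split; [exact: dF|rewrite -derive1E; exact: eF].
have F0 x : L <= `|x| -> F x = 0.
  have zero (D : set R) : measurable D -> (forall t, D t -> L <= `|t|) ->
      (\int[mu]_(t in D) f t = 0)%R.
    move=> mD LD; rewrite (@eq_Rintegral _ _ _ _ _ (cst 0)) ?Rintegral_cst ?mul0r// => t /set_mem tD.
    by rewrite /f psi0 ?mul0r//; exact: LD.
  rewrite ler_normr => /orP[Lx|Lx]; last first.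
    apply: zero => // t /=; rewrite in_itv /= => tx.
    by rewrite ler_normr; apply/orP; right; lra.
  (* To the right of L, F x is the full Gaussian mean, which is 0, minus an integral of zeros. *)
  have z : (\int[mu]_(t in `]x, +oo[) f t)%R = 0.
    apply: zero => // t /=; rewrite in_itv /= andbT => xt.
    by rewrite ler_normr; apply/orP; left; lra.
  rewrite -mean0 -[F x]addr0 -z /F /gauss_mean -Rintegral_setU//.
  - by rewrite itv_setU_setT.
  - by rewrite itv_setU_setT.
  - exact: disjoint_rays.
have pk : 0 < normal_peak (1 : R) by rewrite normal_peak_gt0// oner_neq0.
have M0 : 0 <= M := le_trans (normr_ge0 _) (Mpsi 0).
have fM x : `|f x| <= M * normal_peak 1.
  rewrite normrM ler_pM// ger0_norm ?normal_pdf_ge0//.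
  by apply: normal_pdf_ub; rewrite oner_neq0.
have FM x : `|F x| <= M * normal_peak 1 * (2%:R * L).
  have p0 : 0 <= M * normal_peak 1 by rewrite mulr_ge0// ltW.
  have [xL|Lx] := leP L `|x|.
    by rewrite F0// normr0 mulr_ge0// mulr_ge0// ltW.
  (* F vanishes at L and x is within 2 L of it, so the Lipschitz bound for F suffices. *)
  have FL : F L = 0 by apply: F0; exact: ler_norm.
  rewrite -[F x]subr0 -FL; apply: le_trans (lipschitz_of_derive Fd fM _ _) _.
  rewrite ler_wpM2l//; apply: le_trans (ler_normB _ _) _.
  by rewrite (gtr0_norm L0); lra.
(* This is 1 / phi. Its derivative x q makes F q a solution of g' - x g = psi. *)
pose q x : R := expR (x ^+ 2 / 2%:R) / normal_peak 1.
have qd x : is_derive x (1 : R) (q : R -> R) (x * q x).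
  rewrite /q; apply: is_derive_eq.
  by rewrite /GRing.scale /=; field; rewrite gt_eqF.
have q0 x : 0 <= q x by rewrite /q divr_ge0 ?expR_ge0// ltW.
have phiq x : phi x * q x = 1.
  rewrite normal_pdf_std /q mulrA -[_ * _ * expR _]mulrA -expRD mulNr addNr expR0 mulr1.
  by rewrite mulfV// gt_eqF.
pose g x := F x * q x; pose g1 x := psi x + x * g x.
have gd x : is_derive x (1 : R) (g : R -> R) (g1 x).
  have h1 := Fd x; have h2 := qd x.
  apply: (is_derive_eq (is_deriveM h1 h2)).
  rewrite /g1 /g /GRing.scale /= -[psi x]mulr1 -(phiq x) /f; ring.
have g0 x : L <= `|x| -> g x = 0 by move=> Lx; rewrite /g F0 ?mul0r.
pose G0 := M * normal_peak 1 * (2%:R * L) * q L.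
have gG x : `|g x| <= G0.
  have pk0 := ltW pk; have L0' := ltW L0.
  have [xL|Lx] := leP L `|x|.
    by rewrite g0// normr0 /G0; do 3!(apply: mulr_ge0 => //); apply: mulr_ge0.
  rewrite normrM ler_pM// (ger0_norm (q0 x)) /q ler_wpM2r ?invr_ge0//.
  rewrite ler_expR ler_wpM2r// -[x ^+ 2]real_normK ?num_real//.
  by rewrite lerXn2r ?nnegrE// ltW.
have G00 : 0 <= G0 := le_trans (normr_ge0 _) (gG 0).
pose G1 := M + L * G0.
have xgG (u : R -> R) C : (forall x, L <= `|x| -> u x = 0) -> (forall x, `|u x| <= C) ->
    forall x, `|x * u x| <= L * C.
  move=> u0 uC x; have [xL|Lx] := leP L `|x|.
    by rewrite u0// mulr0 normr0 mulr_ge0 ?(ltW L0)// (le_trans _ (uC 0)).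
  by rewrite normrM ler_pM// ltW.
have g1G x : `|g1 x| <= G1.
  by rewrite (le_trans (ler_normD _ _))// lerD// xgG.
have g10 x : L <= `|x| -> g1 x = 0 by move=> Lx; rewrite /g1 psi0// g0// mulr0 addr0.
have xgd x : is_derive x (1 : R) (fun y => y * g y) (g x + x * g1 x).
  have h1 := gd x; apply: (is_derive_eq (is_deriveM (is_derive_id x 1) h1)).
  by rewrite /GRing.scale /=; ring.
have xgL : forall x y, `|x * g x - y * g y| <= (G0 + L * G1) * `|x - y|.
  apply: lipschitz_of_derive xgd _ => x.
  by rewrite (le_trans (ler_normD _ _))// lerD// xgG.
have Lip0 : 0 <= Lip.
  have := le_trans (normr_ge0 _) (Lpsi 1 0).
  by rewrite subr0 normr1 mulr1.
have G10 : 0 <= G1 := le_trans (normr_ge0 _) (g1G 0).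
exists g, g1, G0, G1, (Lip + (G0 + L * G1)); split=> //.
- apply: taylor_of_lipschitz_derive => //.
    by apply: addr_ge0 => //; apply: addr_ge0 => //; apply: mulr_ge0 => //; exact: ltW.
  move=> x y; rewrite /g1 [_ * `|_|]mulrDl.
  rewrite (_ : _ - _ = (psi x - psi y) + (x * g x - y * g y)); last by ring.
  by rewrite (le_trans (ler_normD _ _))// lerD.
- by move=> x; rewrite /g1 addrK.
Qed.
End SteinEquation.

(** * Trapezoidal test functions and Gaussian half-lines *)

Section Trapezoid.
Variable R : realType.
Local Notation mu := (@lebesgue_measure R).
Local Notation phi := (normal_pdf (0 : R) 1).
Local Notation gam := (normal_prob (0 : R) 1).

Definition clamp (y : R) : R := Num.max 0 (Num.min 1 y).

Lemma clamp_ge0 y : 0 <= clamp y. Proof. by rewrite le_max lexx. Qed.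

Lemma clamp_le1 y : clamp y <= 1.
Proof. by rewrite ge_max ler01 ge_min lexx. Qed.

Lemma clamp_eq1 y : 1 <= y -> clamp y = 1.
Proof. by move=> y1; rewrite /clamp min_l// max_r. Qed.

Lemma clamp_eq0 y : y <= 0 -> clamp y = 0.
Proof. by move=> y0; rewrite /clamp min_r ?(le_trans y0)// max_l. Qed.

Lemma clamp_lipschitz x y : `|clamp x - clamp y| <= `|x - y|.
Proof.
wlog xy : x y / x <= y.
  by move=> h; have [/h//|/ltW/h hh] := leP x y; rewrite distrC [leRHS]distrC.
rewrite distrC [leRHS]distrC [leRHS]ger0_norm ?subr_ge0//.
have key z : [\/ clamp z = 0 /\ z <= 0, clamp z = z /\ 0 <= z <= 1 | clamp z = 1 /\ 1 <= z].
  have [z0|z0] := leP z 0; first by constructor 1; rewrite clamp_eq0.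
  have [z1|z1] := leP 1 z; first by constructor 3; rewrite clamp_eq1.
  by constructor 2; rewrite /clamp !(min_r, max_r) ?(ltW z0) ?(ltW z1).
by case: (key x) => -[-> ?]; case: (key y) => -[-> ?]; rewrite ger0_norm; lra.
Qed.

(** For a <= b and e > 0 the graph is a plateau over [a, b] with linear descents to 0 of length e.
    In terms of the distance to the midpoint, the Lipschitz bound is a triangle inequality. *)
Definition trapezoid (a b e x : R) : R :=
  clamp (1 + ((b - a) / 2%:R - `|x - (a + b) / 2%:R|) / e).

Section Fixed.
Variables (a b e : R).
Hypothesis e0 : 0 < e.
Local Notation h := (trapezoid a b e).

Lemma trapezoid_bounds x : 0 <= h x <= 1.
Proof. by rewrite clamp_ge0 clamp_le1. Qed.

Lemma normr_trapezoid x : `|h x| <= 1.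
Proof. by have /andP[h0 h1] := trapezoid_bounds x; rewrite ger0_norm. Qed.

Lemma trapezoid_eq1 x : a <= x <= b -> h x = 1.
Proof.
move=> /andP[ax xb]; apply: clamp_eq1; rewrite lerDl; apply: divr_ge0; last exact: ltW.
by rewrite subr_ge0 ler_norml; apply/andP; split; lra.
Qed.

Lemma trapezoid_eq0 x : (x <= a - e) || (b + e <= x) -> h x = 0.
Proof.
move=> xo; apply: clamp_eq0.
rewrite -lerBrDl sub0r ler_pdivrMr// mulN1r lerBlDl.
rewrite -lerBlDr opprK ler_normr; apply/orP.
by case/orP: xo => ?; [right|left]; lra.
Qed.

Lemma trapezoid_lipschitz x y : `|h x - h y| <= e^-1 * `|x - y|.
Proof.
apply: le_trans (clamp_lipschitz _ _) _.
set c := (a + b) / 2%:R.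
rewrite (_ : _ - _ = (`|y - c| - `|x - c|) / e); last by ring.
have ei : 0 <= e^-1 by rewrite invr_ge0 ltW.
rewrite normrM (ger0_norm ei) mulrC ler_wpM2l//.
rewrite distrC; apply: le_trans (ler_dist_dist _ _) _.
by rewrite (_ : x - c - (y - c) = x - y)//; ring.
Qed.

Lemma gauss_mean_trapezoid_le1 : gauss_mean h <= 1.
Proof.
have ch : continuous h := lipschitz_continuous trapezoid_lipschitz.
have ih := integrable_mul_normal_pdf ch normr_trapezoid.
have i1 := integrable_normal_pdf (0 : R) 1.
rewrite (_ : 1 = (\int[mu]_x phi x)%R); last first.
  by rewrite /Rintegral integral_normal_pdf.
apply: le_Rintegral => //= x _.
by have /andP[_ h1] := trapezoid_bounds x; rewrite ler_piMl ?normal_pdf_ge0.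
Qed.

Lemma gauss_mean_trapezoid_ge : fine (gam `[a, b]%classic) <= gauss_mean h.
Proof.
have ch : continuous h := lipschitz_continuous trapezoid_lipschitz.
have ih := integrable_mul_normal_pdf ch normr_trapezoid.
have i1 := integrable_normal_pdf (0 : R) 1.
have -> : fine (gam `[a, b]%classic) = (\int[mu]_(x in `[a, b]) phi x)%R by [].
rewrite Rintegral_mkcond; apply: le_Rintegral => //=.
  have i2 : mu.-integrable `[a, b]%classic (EFin \o phi) by apply: integrableS i1.
  rewrite -restrict_EFin.
  by apply/(@integrable_mkcond _ _ _ mu `[a, b]%classic (EFin \o phi)).
move=> x _; rewrite patchE; case: ifPn => [|_].
  by rewrite inE /= in_itv /= => /trapezoid_eq1 ->; rewrite mul1r.
by rewrite mulr_ge0 ?normal_pdf_ge0//; have /andP[] := trapezoid_bounds x.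
Qed.
End Fixed.

(** Continuity from below of the Gaussian measure, along compact intervals exhausting U. *)
Lemma normal_prob_itv_lim (U : set R) (l r : nat -> R) :
  (forall m n, (m <= n)%N -> l n <= l m) -> (forall m n, (m <= n)%N -> r m <= r n) ->
  measurable U -> (\bigcup_n `[l n, r n]%classic = U) ->
  forall eta : R, 0 < eta -> exists n0, forall n, (n0 <= n)%N ->
    fine (gam U) - eta <= fine (gam `[l n, r n]%classic).
Proof.
move=> lm rm mU UE eta eta0.
have cv : gam (`[l n, r n]%classic) @[n --> \oo] --> gam U.
  rewrite -UE; apply: (@nondecreasing_cvg_mu _ _ _ (normal_prob (0 : R) 1)) => //.
    by rewrite UE.
  move=> m n mn; apply/subsetPset => x /=; rewrite !in_itv /= => /andP[h1 h2].
  by rewrite (le_trans (lm _ _ mn) h1) (le_trans h2 (rm _ _ mn)).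
have gU : gam U = (fine (gam U))%:E by rewrite fineK// fin_num_measure.
rewrite gU in cv; move/fine_cvg : cv => /cvgrPdist_le/(_ _ eta0)[n0 _ hn].
exists n0 => n nn; have := hn n nn.
by rewrite /= ler_norml => /andP[_]; lra.
Qed.

Lemma nat_above (x : R) : exists n : nat, x <= n%:R.
Proof.
exists (Num.Def.archi_bound `|x|); apply: le_trans (ler_norm x) _.
exact/ltW/archi_boundP.
Qed.

Lemma harmonic_below (x : R) : 0 < x -> exists n : nat, n.+1%:R^-1 <= x.
Proof.
move=> x0; have [n hn] := nat_above x^-1; exists n.
by rewrite -[x]invrK lef_pV2 ?posrE ?invr_gt0// (le_trans hn)// ler_nat.
Qed.

Lemma harmonic_le (m n : nat) : (m <= n)%N -> n.+1%:R^-1 <= m.+1%:R^-1 :> R.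
Proof. by move=> mn; rewrite lef_pV2 ?posrE// ler_nat ltnS. Qed.

Lemma trapezoid_below (x eta : R) : 0 < eta -> exists a b e : R,
  [/\ 0 < e, b + e <= x & fine (gam `]-oo, x]%classic) - eta <= gauss_mean (trapezoid a b e)].
Proof.
move=> eta0.
pose l (n : nat) : R := - n%:R; pose r (n : nat) : R := x - n.+1%:R^-1.
have lm m n : (m <= n)%N -> l n <= l m by rewrite lerN2 ler_nat.
have rm m n : (m <= n)%N -> r m <= r n.
  by move=> mn; rewrite lerD2l lerN2 harmonic_le.
(* The constraint b + e <= x keeps the plateaus left of x, so they exhaust only the open ray. The
   point x has measure zero and is restored at the end. *)
have mU : measurable (`]-oo, x[%classic : set R) by [].
have UE : \bigcup_n `[l n, r n]%classic = `]-oo, x[%classic.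
  apply/seteqP; split=> y.
    move=> [n _] /=; rewrite !in_itv /= => /andP[_ yr].
    by apply: le_lt_trans yr _; rewrite ltrBlDr ltrDl invr_gt0.
  rewrite /= in_itv /= => yx.
  have [n1 h1] := nat_above (- y).
  have xy0 : 0 < x - y by rewrite subr_gt0.
  have [n2 h2] := harmonic_below xy0.
  have m1 := lm _ _ (leq_maxl n1 n2); have m2 := rm _ _ (leq_maxr n1 n2).
  exists (maxn n1 n2) => //=; rewrite in_itv /=; apply/andP; split.
    by apply: le_trans m1 _; rewrite /l lerNl.
  by apply: le_trans m2; rewrite /r lerBrDl -lerBrDr.
have [n0 /(_ n0 (leqnn _)) hn] := normal_prob_itv_lim lm rm mU UE eta0.
have i0 : 0 < n0.+1%:R^-1 :> R by rewrite invr_gt0.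
exists (l n0), (r n0), (n0.+1%:R^-1); split => //; first by rewrite /r subrK.
apply: le_trans (gauss_mean_trapezoid_ge _ _ i0); apply: le_trans hn.
rewrite lerD2r le_eqVlt; apply/orP; left; apply/eqP; congr fine.
rewrite /normal_prob -integral_itv_bndo_bndc//.
apply/measurable_EFinP/measurable_funTS.
exact: measurable_normal_pdf.
Qed.

Lemma trapezoid_above (x eta : R) : 0 < eta -> exists a b e : R,
  [/\ 0 < e, x <= a - e & fine (gam `]x, +oo[%classic) - eta <= gauss_mean (trapezoid a b e)].
Proof.
move=> eta0.
pose l (n : nat) : R := x + n.+1%:R^-1; pose r (n : nat) : R := n%:R.
have lm m n : (m <= n)%N -> l n <= l m by move=> mn; rewrite lerD2l harmonic_le.
have rm m n : (m <= n)%N -> r m <= r n by rewrite ler_nat.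
have mU : measurable (`]x, +oo[%classic : set R) by [].
have UE : \bigcup_n `[l n, r n]%classic = `]x, +oo[%classic.
  apply/seteqP; split=> y.
    move=> [n _] /=; rewrite !in_itv /= andbT => /andP[yl _].
    by apply: lt_le_trans yl; rewrite ltrDl invr_gt0.
  rewrite /= in_itv /= andbT => yx.
  have [n1 h1] := nat_above y.
  have xy0 : 0 < y - x by rewrite subr_gt0.
  have [n2 h2] := harmonic_below xy0.
  have m1 := rm _ _ (leq_maxl n1 n2); have m2 := lm _ _ (leq_maxr n1 n2).
  exists (maxn n1 n2) => //=; rewrite in_itv /=; apply/andP; split.
    by apply: le_trans m2 _; rewrite /l -lerBrDl.
  by apply: le_trans m1; rewrite /r.
have [n0 /(_ n0 (leqnn _)) hn] := normal_prob_itv_lim lm rm mU UE eta0.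
have i0 : 0 < n0.+1%:R^-1 :> R by rewrite invr_gt0.
exists (l n0), (r n0), (n0.+1%:R^-1); split => //; first by rewrite /l addrK.
exact: le_trans hn (gauss_mean_trapezoid_ge _ _ i0).
Qed.

Lemma trapezoid_large (L0 : R) : exists L : R,
  [/\ L0 <= L, 0 < L & 0 < gauss_mean (trapezoid (- L) L 1)].
Proof.
pose l (n : nat) : R := - n%:R; pose r (n : nat) : R := n%:R.
have lm m n : (m <= n)%N -> l n <= l m by rewrite lerN2 ler_nat.
have rm m n : (m <= n)%N -> r m <= r n by rewrite ler_nat.
have UE : \bigcup_n `[l n, r n]%classic = [set: R].
  apply/seteqP; split=> y // _; have [n hn] := nat_above `|y|.
  by exists n => //=; rewrite in_itv /= -ler_norml.
have eta0 : 0 < 2%:R^-1 :> R by rewrite invr_gt0.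
have [n0 hn] := normal_prob_itv_lim lm rm measurableT UE eta0.
have [n1 hn1] := nat_above L0; pose n := maxn n0 n1.+1.
exists n%:R; split.
- by rewrite (le_trans hn1)// ler_nat leq_max leqnSn orbT.
- by rewrite ltr0n leq_max orbT.
have := hn n (leq_maxl _ _); rewrite probability_setT /=.
have := @gauss_mean_trapezoid_ge (- n%:R) n%:R 1 ltr01.
have := eta0; rewrite /l /r; lra.
Qed.

End Trapezoid.

(* Stein's method applies to psi = h - k chi, where chi is a large trapezoid and k
   makes the Gaussian mean of psi vanish; E chi(W) >= 1 - C / L ^ 2 by Chebyshev. *)
Lemma weak_lower_bound (R : realType) (O : nat -> finType) (W : forall N, O N -> R) (C : R) :
  (forall N, (0 < #|O N|)%N) ->
  (forall (g g1 : R -> R) (G0 G1 G2 : R), (forall x, `|g x| <= G0) ->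
    (forall x, `|g1 x| <= G1) ->
    (forall x h, `|g x - g (x - h) - h * g1 x| <= G2 * h ^+ 2) ->
    forall eps, 0 < eps -> exists N0, forall N, (N0 <= N)%N ->
      `|mean (fun w => g1 (W N w) - W N w * g (W N w))| <= eps) ->
  (forall N, mean (fun w => W N w ^+ 2) <= C) ->
  forall a b e, 0 < e -> forall eps, 0 < eps -> exists N0, forall N, (N0 <= N)%N ->
    gauss_mean (trapezoid a b e) - eps <= mean (fun w => trapezoid a b e (W N w)).
Proof.
move=> O0 stein tight a b e e0 eps eps0.
(* With L >= 1 and L >= 2 |C| / eps the Chebyshev loss C / L^2 is at most eps / 2; the other half of
   eps goes to Stein's bound. *)
have [L [hL L0 mL0]] := trapezoid_large (Num.max 1 (2%:R * `|C| / eps)).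
set h := trapezoid a b e; set chi := trapezoid (- L) L 1 in mL0.
set m := gauss_mean h; set mL := gauss_mean chi in mL0.
have ch : continuous h := lipschitz_continuous (trapezoid_lipschitz a b e0).
have cchi : continuous chi := lipschitz_continuous (trapezoid_lipschitz (- L) L ltr01).
have ih := integrable_mul_normal_pdf ch (normr_trapezoid a b e).
have ichi := integrable_mul_normal_pdf cchi (normr_trapezoid (- L) L 1).
have m0 : 0 <= m.
  apply: Rintegral_ge0 => x _; rewrite mulr_ge0 ?normal_pdf_ge0//.
  by have /andP[] := trapezoid_bounds a b e x.
have m1 : m <= 1 := gauss_mean_trapezoid_le1 a b e0.
have mL1 : mL <= 1 := gauss_mean_trapezoid_le1 (- L) L ltr01.
(* As mL <= 1, k >= m, and k E chi(W) is bounded below by m E chi(W) whatever the value of mL. *)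
pose k := m / mL; have k0 : 0 <= k by rewrite divr_ge0// ltW.
have mk : m <= k by rewrite ler_pdivlMr// ler_piMr.
pose psi x := h x - k * chi x.
pose L' := Num.max (Num.max `|a - e| `|b + e|) (L + 1).
have L'0 : 0 < L' by rewrite lt_max; apply/orP; right; lra.
have psiL x y : `|psi x - psi y| <= (e^-1 + k) * `|x - y|.
  rewrite /psi (_ : _ - _ = (h x - h y) - k * (chi x - chi y)); last by ring.
  apply: le_trans (ler_normB _ _) _; rewrite mulrDl lerD ?trapezoid_lipschitz//.
  rewrite normrM ger0_norm// ler_wpM2l//.
  by have := trapezoid_lipschitz (- L) L ltr01 x y; rewrite invr1 mul1r.
have psiM x : `|psi x| <= 1 + k.
  apply: le_trans (ler_normB _ _) _; rewrite lerD ?normr_trapezoid//.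
  by rewrite normrM ger0_norm// ler_piMr// normr_trapezoid.
have psi0 x : L' <= `|x| -> psi x = 0.
  rewrite !ge_max -andbA => /and3P[h1 h2 h3].
  have h4 := ler_norm (b + e); have h5 := ler_norm (- (a - e)); rewrite normrN in h5.
  rewrite /psi /h /chi !trapezoid_eq0 ?mulr0 ?subr0//.
    by move: h1 h2 h3; case: (ger0P x) => _ *; apply/orP; [right|left]; lra.
  by move: h1 h2 h3; case: (ger0P x) => _ *; apply/orP; [right|left]; lra.
have psi_mean : gauss_mean psi = 0.
  have ikchi : (@lebesgue_measure R).-integrable [set: R]
      (EFin \o (fun x => k * (chi x * normal_pdf 0 1 x))).
    have -> : (fun x => k * (chi x * normal_pdf 0 1 x)) =
        (fun x => (k * chi x) * normal_pdf 0 1 x) by apply/funext => x; rewrite mulrA.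
    apply: (@integrable_mul_normal_pdf _ _ k) => [|x].
      apply: (@lipschitz_continuous _ _ k) => x y.
      rewrite -mulrBr normrM ger0_norm// ler_wpM2l//.
      by have := trapezoid_lipschitz (- L) L ltr01 x y; rewrite invr1 mul1r.
    by rewrite normrM ger0_norm// ler_piMr// normr_trapezoid.
  transitivity (m - k * mL); last by rewrite /k divfK ?subrr// gt_eqF.
  rewrite /m /mL /gauss_mean -RintegralZl// -RintegralB//.
  by apply: eq_Rintegral => x _; rewrite /psi; ring.
have [g [g1 [G0 [G1 [G2 [hG0 hG1 hG2 hg]]]]]] := stein_solution L'0 psiL psiM psi0 psi_mean.
have e2 : 0 < eps / 2%:R by lra.
have [N0 hN0] := stein _ _ _ _ _ hG0 hG1 hG2 _ e2.
exists N0 => N /hN0 /ler_normlP[hN _].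
have chi_ge : 1 - C / L ^+ 2 <= mean (fun w => chi (W N w)).
  apply: (@le_trans _ _ (mean (fun w => 1 - (L ^+ 2)^-1 * W N w ^+ 2))).
    rewrite meanB meanZ mean_cst// lerB// mulrC; apply: ler_wpM2r (tight N).
    by rewrite invr_ge0 sqr_ge0.
  apply: ler_mean => w; set x := W N w.
  have [xL|Lx] := leP `|x| L.
    rewrite /chi trapezoid_eq1 ?ltr01 -?ler_norml// lerBlDr lerDl.
    by rewrite mulr_ge0 ?invr_ge0 ?sqr_ge0.
  have /andP[+ _] := trapezoid_bounds (- L) L 1 x; apply: le_trans.
  rewrite subr_le0 mulrC ler_pdivlMr ?exprn_gt0// mul1r -[x ^+ 2]real_normK ?num_real//.
  by rewrite lerXn2r ?nnegrE// ltW.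
have meanh : mean (fun w => h (W N w)) =
    mean (fun w => g1 (W N w) - W N w * g (W N w)) + k * mean (fun w => chi (W N w)).
  by rewrite -meanZ -meanD; apply: eq_mean => w; rewrite hg /psi subrK.
have CL : C / L ^+ 2 <= eps / 2%:R.
  move: hL; rewrite ge_max => /andP[L1 hL].
  rewrite ler_pdivrMr ?exprn_gt0//.
  have LL : L <= L ^+ 2 by rewrite expr2 ler_peMl// ltW.
  apply: (@le_trans _ _ `|C|); first exact: ler_norm.
  move: hL; rewrite ler_pdivrMr// => hL.
  have : L * eps <= L ^+ 2 * eps by rewrite ler_wpM2r// ltW.
  by lra.
have chi0 : 0 <= mean (fun w => chi (W N w)).
  rewrite -[leLHS](mean_cst (O0 N) 0); apply: ler_mean => w.
  by have /andP[] := trapezoid_bounds (- L) L 1 (W N w).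
rewrite meanh.
have : m * (1 - C / L ^+ 2) <= k * mean (fun w => chi (W N w)).
  apply: (@le_trans _ _ (m * mean (fun w => chi (W N w)))); first by rewrite ler_wpM2l.
  by rewrite ler_wpM2r.
have : m * (C / L ^+ 2) <= eps / 2%:R.
  apply: (@le_trans _ _ (m * (eps / 2%:R))); first by rewrite ler_wpM2l.
  by rewrite ler_piMl// ltW.
by lra.
Qed.

(** * The Walsh model of a polynomial *)

Section PolynomialWalsh.
Variables (P : {poly int}) (N : nat).
Local Notation F := (absval P).

Definition admissible (n : nat) : bool :=
  [&& (0 < n)%N, 0 < P.[n%:Z] & squarefree (F n)].

(* The summand 3 ensures that 2 is available as [default_prime]. *)
Definition prime_bound : nat := (\max_(n < N.+1) F n + 3)%N.

Definition small_prime : finType := {p : 'I_prime_bound | prime p}.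

Definition prime_support (n : 'I_N.+1) : {set small_prime} :=
  finset.finset (fun p : small_prime => val (val p) %| F n)%N.

Local Notation S := prime_support.

Lemma in_prime_support p n : (p \in S n) = (val (val p) %| F n)%N.
Proof. by rewrite inE. Qed.

Lemma absval_lt_prime_bound (n : 'I_N.+1) : (F n < prime_bound)%N.
Proof.
apply: (@leq_ltn_trans (\max_(m < N.+1) F m)); last by rewrite /prime_bound; lia.
exact: (leq_bigmax (F := fun m : 'I_N.+1 => F m)).
Qed.

Lemma prime_dvd_support (q : nat) (n : 'I_N.+1) : prime q -> (0 < F n)%N ->
  (q %| F n)%N -> exists p : small_prime, val (val p) = q.
Proof.
move=> pq n0 qn.
have qb : (q < prime_bound)%N.
  exact: leq_ltn_trans (dvdn_leq n0 qn) (absval_lt_prime_bound n).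
by exists (exist _ (Ordinal qb) pq).
Qed.

Lemma even_square_product (a b c d : 'I_N.+1) :
  (0 < F a)%N -> (0 < F b)%N -> (0 < F c)%N -> (0 < F d)%N ->
  even_cover (S a) (S b) (S c) (S d) -> square_product F a b c d.
Proof.
move=> a0 b0 c0 d0 /forallP ev q pq.
have [qb|qb] := ltnP q prime_bound.
  have := ev (exist _ (Ordinal qb) pq); rewrite !in_prime_support /=.
  by move/negbTE.
have nd (n : 'I_N.+1) : (0 < F n)%N -> (q %| F n)%N = false.
  move=> n0; apply/negP => /(dvdn_leq n0); rewrite leqNgt => /negP; apply.
  exact: leq_trans (absval_lt_prime_bound n) qb.
by rewrite !nd.
Qed.

Lemma card_prime_support (n : 'I_N.+1) : (0 < F n)%N ->
  (#|S n| <= size (primes (F n)))%N.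
Proof.
move=> n0; rewrite cardE -(size_map (fun p : small_prime => val (val p))).
apply: uniq_leq_size.
  by rewrite map_inj_uniq ?enum_uniq// => x y /val_inj/val_inj.
move=> _ /mapP[p + ->]; rewrite mem_enum in_prime_support => pn.
by rewrite mem_primes n0 pn !andbT; exact: (valP p).
Qed.

Lemma prime_support_absval (m n : 'I_N.+1) :
  squarefree (F m) -> squarefree (F n) -> S m = S n -> F m = F n.
Proof.
move=> sm sn e; apply: squarefree_primes_inj => // q pq.
have main (x y : 'I_N.+1) : (0 < F x)%N -> S x = S y ->
    (q %| F x)%N -> (q %| F y)%N.
  move=> x0 exy qx; have [p pE] := prime_dvd_support pq x0 qx.
  by move: qx; rewrite -pE -!in_prime_support exy.
by apply/idP/idP; apply: main => //; exact: squarefree_gt0.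
Qed.

Variables (n0 K : nat).
Hypothesis Fmono : forall m n, (n0 <= m)%N -> (m < n)%N -> (F m < F n)%N.
Hypothesis FK : forall n, (n < n0)%N -> (F n <= K)%N.
Local Notation good := (good F n0).
Local Notation quad := (quad F n0).

Definition admissible_index (n : 'I_N.+1) : bool := admissible n.

Definition has_large_prime (n : 'I_N.+1) : bool :=
  admissible n && [exists p : small_prime, (K < val (val p))%N && (p \in S n)].

Lemma has_large_prime_admissible n : has_large_prime n -> admissible_index n. Proof. by case/andP. Qed.

Definition default_prime : small_prime :=
  exist _ (@Ordinal prime_bound 2 (leq_addl _ _)) isT.

Definition big_prime (n : 'I_N.+1) : small_prime :=
  odflt default_prime [pick p : small_prime | (K < val (val p))%N && (p \in S n)].

Lemma big_primeP n : has_large_prime n -> (K < val (val (big_prime n)))%N /\ big_prime n \in S n.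
Proof.
move=> /andP[_ /existsP[q hq]]; rewrite /big_prime; case: pickP => [p /andP[]//|].
by move=> /(_ q); rewrite hq.
Qed.

(** K bounds all values below n0, so an admissible n whose value has a prime factor above K lies in
    the range where F is increasing. *)
Lemma good_of_prime p (n : 'I_N.+1) : admissible_index n -> (K < val (val p))%N -> p \in S n -> good n.
Proof.
move=> /and3P[_ _ sn] Kp; rewrite in_prime_support => pn; rewrite /good sn andbT.
rewrite leqNgt; apply/negP => /FK nK.
have := dvdn_leq (squarefree_gt0 sn) pn; rewrite leqNgt => /negP; apply.
exact: leq_ltn_trans nK Kp.
Qed.

Lemma good_gt0 n : good n -> (0 < F n)%N.
Proof. by move=> /andP[_ /squarefree_gt0]. Qed.

Lemma prime_support_inj m n : has_large_prime m -> has_large_prime n -> S m = S n -> m = n.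
Proof.
move=> Am An e; have [Km pm] := big_primeP Am; have [Kn pn] := big_primeP An.
have gm := good_of_prime (has_large_prime_admissible Am) Km pm; have gn := good_of_prime (has_large_prime_admissible An) Kn pn.
apply/val_inj/(good_inj Fmono) => //.
by apply: prime_support_absval e; [case/andP: gm|case/andP: gn].
Qed.

Lemma pair_eq_of_even (a b c d : 'I_N.+1) : all good [:: val a; val b; val c; val d] ->
  even_cover (S a) (S b) (S c) (S d) ->
  [|| (a == b) && (c == d), (a == c) && (b == d), (a == d) && (b == c)
    | quad a b c d].
Proof.
move=> g ev; have /and5P[ga gb gc gd _] := g.
have sq : square_product F a b c d by apply: even_square_product ev; exact: good_gt0.
have inj (x y : 'I_N.+1) : good x -> good y ->
    (forall p, prime p -> (p %| F x)%N = (p %| F y)%N) -> x = y.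
  move=> gx gy h; apply/val_inj/(good_inj Fmono) => //.
  by apply: squarefree_primes_inj h; [case/andP: gx|case/andP: gy].
have [ab|ab] := eqVneq a b.
  suff -> : c = d by rewrite eqxx.
  by apply: inj => // p /sq; rewrite ab; do 3!case: (_ %| _)%N.
have [ac|ac] := eqVneq a c.
  suff -> : b = d by rewrite eqxx.
  by apply: inj => // p /sq; rewrite ac; do 3!case: (_ %| _)%N.
have [ad|ad] := eqVneq a d.
  suff -> : b = c by rewrite eqxx.
  by apply: inj => // p /sq; rewrite ad; do 3!case: (_ %| _)%N.
by rewrite (square_product_uniq Fmono g).
Qed.

Lemma sum_eq_and (T : finType) (x : T) (G : T -> nat) :
  (\sum_y (x == y) * G y = G x)%N.
Proof.
rewrite (bigD1 x)//= eqxx mul1n big1 ?addn0// => y; rewrite eq_sym.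
by move=> /negPf ->.
Qed.

Lemma sum_eq_and2 (T : finType) (x y : T) (l : nat) :
  (\sum_c \sum_d (x == c) * ((y == d) * l) = l)%N.
Proof.
rewrite -[RHS](sum_eq_and x (fun=> l)); apply: eq_bigr => c _.
by rewrite -big_distrr /= (sum_eq_and y (fun=> l)).
Qed.

Local Notation linked := (linked S has_large_prime admissible_index big_prime).

(** Linked pairs are off-diagonal, so only the pairings a = c, b = d and a = d, b = c remain; each
    contributes the number of linked pairs. *)
Lemma linked_quads_le : (linked_quads S has_large_prime admissible_index big_prime <=
  2 * (\sum_n \sum_m linked n m) + nquad F n0 N.+1)%N.
Proof.
have lg n m : linked n m -> good n && good m.
  move=> /and4P[An Bm _ pm]; have [Kp pn] := big_primeP An.
  by rewrite (good_of_prime (has_large_prime_admissible An) Kp pn) (good_of_prime Bm Kp pm).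
apply: (@leq_trans (\sum_a \sum_b \sum_c \sum_d
   ((a == c) * ((b == d) * linked a b) + (b == c) * ((a == d) * linked a b) + quad a b c d))%N).
  apply: leq_sum => a _; apply: leq_sum => b _; apply: leq_sum => c _; apply: leq_sum => d _.
  case: (boolP (_ && _)) => // /andP[/andP[lab lcd] ev].
  have /andP[ga gb] := lg _ _ lab; have /andP[gc gd] := lg _ _ lcd.
  have nab : (a == b) = false by have /and4P[_ _ /negPf] := lab; rewrite eq_sym.
  have := @pair_eq_of_even a b c d; rewrite /= ga gb gc gd nab lab /= => /(_ isT ev).
  by rewrite [(a == d) && _]andbC; do 4!case: (_ == _); case: (quad _ _ _ _).
rewrite (_ : (\sum_a _ = \sum_a \sum_b linked a b + \sum_a \sum_b linked a b
    + nquad F n0 N.+1)%N); first by rewrite addnn mul2n.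
rewrite /nquad -!big_split; apply: eq_bigr => a _; rewrite -!big_split.
apply: eq_bigr => b _ /=.
transitivity (\sum_c \sum_d (a == c) * ((b == d) * linked a b)
  + \sum_c \sum_d (b == c) * ((a == d) * linked a b)
  + \sum_(c < N.+1) \sum_(d < N.+1) quad a b c d)%N; last by rewrite !sum_eq_and2.
by rewrite -!big_split; apply: eq_bigr => c _; rewrite -!big_split.
Qed.

Definition multiples (p : small_prime) : nat := (\sum_n (admissible_index n && (p \in S n)))%N.

(** Here all three pairings occur, each contributing [multiples p ^ 2]. *)
Lemma divisible_quads_le p : (K < val (val p))%N ->
  (divisible_quads S admissible_index p <= 3 * multiples p ^ 2 +
    \sum_(a < N.+1) \sum_(b < N.+1) \sum_(c < N.+1) \sum_(d < N.+1)
      (quad a b c d && (p \in S a)))%N.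
Proof.
move=> Kp; pose u n := admissible_index n && (p \in S n).
have ug n : u n -> good n by move=> /andP[Bn pn]; exact: good_of_prime Bn Kp pn.
apply: (@leq_trans (\sum_a \sum_b \sum_c \sum_d
   ((u a * u c) * ((a == b) * (c == d)) + (u a * u b) * ((a == c) * (b == d))
    + (u a * u b) * ((a == d) * (b == c)) + (quad a b c d && (p \in S a))))%N).
  apply: leq_sum => a _; apply: leq_sum => b _; apply: leq_sum => c _; apply: leq_sum => d _.
  case: (boolP (_ && _)) => // /andP[/and4P[ua ub uc ud] ev].
  have := @pair_eq_of_even a b c d; rewrite /= !ug// => /(_ isT ev).
  rewrite -!/(u _) in ua ub uc ud *; rewrite ua ub uc; have /andP[_ ->] := ua.
  by do 6!case: (_ == _); case: (quad _ _ _ _).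
have E (G : 'I_N.+1 -> 'I_N.+1 -> nat) : (forall a b, G a b = u a * u b)%N ->
    (\sum_a \sum_b G a b = multiples p ^ 2)%N.
  move=> hG; rewrite -mulnn /multiples big_distrlr /=; apply: eq_bigr => a _.
  by apply: eq_bigr => b _; rewrite hG.
rewrite (_ : (\sum_a _ = multiples p ^ 2 + multiples p ^ 2 + multiples p ^ 2 +
   \sum_(a < N.+1) \sum_(b < N.+1) \sum_(c < N.+1) \sum_(d < N.+1)
      (quad a b c d && (p \in S a)))%N); first by rewrite leq_add2r; lia.
rewrite -{1}(E (fun a c => (\sum_b \sum_d (u a * u c) * ((a == b) * (c == d)))%N)); last first.
  move=> a c; rewrite -[RHS](sum_eq_and2 a c (u a * u c)%N).
  by apply: eq_bigr => b _; apply: eq_bigr => d _; ring.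
rewrite -{1}(E (fun a b => (\sum_c \sum_d (u a * u b) * ((a == c) * (b == d)))%N)); last first.
  move=> a c; rewrite -[RHS](sum_eq_and2 a c (u a * u c)%N).
  by apply: eq_bigr => b _; apply: eq_bigr => d _; ring.
rewrite -(E (fun a b => (\sum_c \sum_d (u a * u b) * ((a == d) * (b == c)))%N)); last first.
  move=> a c; rewrite -[RHS](sum_eq_and2 c a (u a * u c)%N).
  by apply: eq_bigr => b _; apply: eq_bigr => d _; ring.
rewrite -!big_split; apply: eq_bigr => a _ /=.
rewrite [X in (_ = X + _ + _ + _)%N]exchange_big -!big_split; apply: eq_bigr => b _ /=.
rewrite -!big_split; apply: eq_bigr => c _ /=.
by rewrite -!big_split.
Qed.

(** A nontrivial quadruple is counted once for each relevant p dividing P(a), hence at most w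
    times. *)
Lemma sum_divisible_quads_le w :
  (forall a, (a < N.+1)%N -> good a -> size (primes (F a)) <= w)%N ->
  (\sum_(p | [exists n, has_large_prime n && (big_prime n == p)]) divisible_quads S admissible_index p <=
   3 * (\sum_(p | [exists n, has_large_prime n && (big_prime n == p)]) multiples p ^ 2)
     + w * nquad F n0 N.+1)%N.
Proof.
move=> hw; set Q := fun p : small_prime => [exists n, has_large_prime n && (big_prime n == p)].
have QK p : Q p -> (K < val (val p))%N.
  by move=> /existsP[n /andP[An /eqP <-]]; have [] := big_primeP An.
apply: leq_trans (leq_sum _ (fun p Qp => divisible_quads_le (QK p Qp))) _.
rewrite big_split -big_distrr leq_add2l /=.
apply: (@leq_trans (\sum_p \sum_(a < N.+1) \sum_(b < N.+1) \sum_(c < N.+1)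
   \sum_(d < N.+1) (quad a b c d && (p \in S a)))%N).
  by rewrite big_mkcond; apply: leq_sum => p _; case: ifP.
rewrite exchange_big /nquad big_distrr; apply: leq_sum => a _ /=.
rewrite exchange_big big_distrr; apply: leq_sum => b _ /=.
rewrite exchange_big big_distrr; apply: leq_sum => c _ /=.
rewrite exchange_big big_distrr; apply: leq_sum => d _ /=.
case q : (quad a b c d) => /=; last by rewrite big1.
have /and3P[/andP[ga _] _ _] := q.
rewrite muln1 (leq_trans _ (hw a (ltn_ord a) ga))//.
apply: leq_trans (card_prime_support (good_gt0 ga)).
by rewrite -sum1_card [leqRHS]big_mkcond; apply: leq_sum => p _; case: (p \in S a).
Qed.

Lemma multiples_le p : lead_coef P != 0 ->
  (multiples p <= nroots_bound P * (N.+1 %/ val (val p)).+1)%N.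
Proof.
move=> l0; have pp : prime (val (val p)) := valP p.
apply: (@leq_trans (count (fun n => val (val p) %| F n)%N (iota 0 N.+1))).
  rewrite -(@sum_bool_count N.+1 (fun n => val (val p) %| F n)%N).
  by apply: leq_sum => n _; rewrite in_prime_support; case: (admissible_index n).
apply: leq_trans (count_dvd_absval _ _ (prime_gt0 pp)) _.
by rewrite leq_mul2r nroots_prime ?orbT.
Qed.

Lemma sum_linked_le : (\sum_n \sum_m linked n m <= \sum_(n | has_large_prime n) multiples (big_prime n))%N.
Proof.
rewrite [leqRHS]big_mkcond; apply: leq_sum => n _; case: ifP => An.
  by apply: leq_sum => m _; rewrite /linked An /=; case: (admissible_index m); case: (_ \in _); case: (_ != _).
by rewrite big1// => m _; rewrite /linked An.
Qed.

(** The bound in [multiples_le] has a constant term, which must not be summed over all primes below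
    [prime_bound], a number growing with the values of P. Only the chosen primes matter, at most one
    per n. *)
Lemma card_image_big_prime : (#|[pred p | [exists n, has_large_prime n && (big_prime n == p)]]| <= N.+1)%N.
Proof.
apply: (@leq_trans #|[seq big_prime n | n in has_large_prime]|); last first.
  by apply: leq_trans (leq_image_card _ _) (leq_trans (max_card _) _); rewrite card_ord.
apply/subset_leq_card/fintype.subsetP => p; rewrite inE => /existsP[n /andP[An /eqP <-]].
by apply: (map_f big_prime); rewrite mem_enum.
Qed.

End PolynomialWalsh.

(** * Size of the error terms *)

Lemma sum_inv_sqr_le (R : realFieldType) (K M : nat) : (0 < K)%N ->
  \sum_(i < M | (K < i)%N) (i%:R ^+ 2)^-1 <= K%:R^-1 :> R.
Proof.
move=> K0; have KR : 0 < K%:R :> R by rewrite ltr0n.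
(* The sum telescopes through 1 / i^2 <= 1 / (i - 1) - 1 / i; the maximum covers the M for which it
   is still empty. *)
suff : \sum_(i < M | (K < i)%N) (i%:R ^+ 2)^-1 <= K%:R^-1 - (maxn K M.-1)%:R^-1 :> R.
  by move=> h; apply: le_trans h _; rewrite gerBl invr_ge0.
elim: M => [|M IH]; first by rewrite big_ord0 maxn0 subrr.
have -> : \sum_(i < M.+1 | (K < i)%N) (i%:R ^+ 2)^-1 =
    \sum_(i < M | (K < i)%N) (i%:R ^+ 2)^-1
    + (if (K < M)%N then (M%:R ^+ 2)^-1 else 0) :> R.
  by rewrite big_mkcond big_ord_recr /= -big_mkcond.
rewrite -[M.+1.-1]/M; case: (ltnP K M) => KM; last first.
  have KM1 : (M.-1 <= K)%N by lia.
  by rewrite addr0 subrr; move: IH; rewrite (maxn_idPl KM1) subrr.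
move: IH; have -> : maxn K M.-1 = M.-1 by apply/maxn_idPr; lia.
case: M KM => // M; rewrite ltnS /= => KM IH.
have MR : 0 < M%:R :> R by rewrite ltr0n; lia.
have M1R : 0 < M.+1%:R :> R by rewrite ltr0n.
apply: le_trans (lerD IH (lexx _)) _.
have : (M.+1%:R ^+ 2)^-1 <= M%:R^-1 - M.+1%:R^-1 :> R.
  rewrite -natr1 in M1R *.
  rewrite (_ : M%:R^-1 - (M%:R + 1)^-1 = (M%:R * (M%:R + 1))^-1 :> R); last first.
    by field; rewrite !gt_eqF.
  by rewrite lef_pV2 ?posrE ?mulr_gt0 ?exprn_gt0// expr2; nra.
by move: (_ ^-1) (_ ^-1) (_ ^-1) => x y z; lra.
Qed.

(** With z = (N + 1) / p, the square (z + 1)^2 is at most 2 (z^2 + 1). The terms 1 / p^2 with p > K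
    sum to at most 1 / K, and [card_image_big_prime] counts the constant ones. *)
Lemma sum_multiples_sqr_le (R : realFieldType) (P : {poly int}) (N K : nat) : (0 < K)%N ->
  lead_coef P != 0 ->
  (\sum_(p | [exists n : 'I_N.+1, has_large_prime P K n && (big_prime P K n == p)]) @multiples P N p ^ 2)%N%:R <=
  2%:R * (nroots_bound P)%:R ^+ 2 * (N.+1%:R ^+ 2 / K%:R + N.+1%:R) :> R.
Proof.
move=> K0 l0; pose Q p := [exists n : 'I_N.+1, has_large_prime P K n && (big_prime P K n == p)]; set k := nroots_bound P.
have QK p : Q p -> (K < val (val p))%N.
  by move=> /existsP[n /andP[An /eqP <-]]; have [] := big_primeP An.
have term (p : small_prime P N) : (multiples p ^ 2)%:R <=
    2%:R * k%:R ^+ 2 * (N.+1%:R ^+ 2 * ((val (val p))%:R ^+ 2)^-1 + 1) :> R.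
  have := multiples_le p l0; set q := val (val p) => hm.
  have q0 : 0 < q%:R :> R by rewrite ltr0n prime_gt0//; exact: (valP p).
  have : (multiples p)%:R <= k%:R * (N.+1%:R / q%:R + 1) :> R.
    apply: (@le_trans _ _ (k%:R * (N.+1 %/ q).+1%:R)); first by rewrite -natrM ler_nat.
    rewrite ler_wpM2l// -natr1 lerD2r ler_pdivlMr// -natrM ler_nat.
    exact: leq_trunc_div.
  have m0 : 0 <= (multiples p)%:R :> R by [].
  have k0 : 0 <= k%:R :> R by [].
  move=> h; rewrite natrX; apply: (@le_trans _ _ ((k%:R * (N.+1%:R / q%:R + 1)) ^+ 2)).
    by rewrite lerXn2r ?nnegrE// mulr_ge0// addr_ge0// divr_ge0.
  have -> : N.+1%:R ^+ 2 * (q%:R ^+ 2)^-1 = (N.+1%:R / q%:R) ^+ 2 :> R.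
    by rewrite exprMn exprVn.
  rewrite exprMn [2%:R * _]mulrC -[leRHS]mulrA ler_wpM2l ?sqr_ge0//.
  by have := sqr_ge0 (N.+1%:R / q%:R - 1 : R); set z := N.+1%:R / q%:R; nra.
rewrite -/(Q _) natr_sum; apply: le_trans (ler_sum _ (fun p _ => term p)) _.
rewrite -mulr_sumr ler_wpM2l ?mulr_ge0 ?sqr_ge0// big_split /=; apply: lerD.
  rewrite -mulr_sumr ler_wpM2l ?sqr_ge0//.
  apply: le_trans (sum_inv_sqr_le R (prime_bound P N) K0).
  apply: (@le_trans _ _ (\sum_(p : small_prime P N | (K < val (val p))%N) ((val (val p))%:R ^+ 2)^-1)).
    rewrite [leRHS]big_mkcond [leLHS]big_mkcond; apply: ler_sum => p _.
    rewrite -/(Q p); case Qp : (Q p); first by rewrite (QK p Qp).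
    by case: ifP => // _; rewrite invr_ge0 sqr_ge0.
  pose D : {set small_prime P N} := finset.finset (fun p => K < val (val p))%N.
  rewrite (eq_bigl (fun p => p \in D)) => [|p]; last by rewrite inE.
  rewrite -(big_imset (h := fun p : small_prime P N => val p)
    (fun i : 'I_(prime_bound P N) => (i%:R ^+ 2)^-1 : R)) => [|p q _ _ /val_inj//].
  rewrite [leLHS]big_mkcond [leRHS]big_mkcond; apply: ler_sum => i _.
  case: imsetP => [[p + ->]|_]; first by rewrite inE => ->.
  by case: ifP => // _; rewrite invr_ge0 sqr_ge0.
rewrite sumr_const ler_nat; apply: leq_trans (card_image_big_prime P N K).
by apply: subset_leq_card; apply/fintype.subsetP.
Qed.

Lemma ext0_moebius_sqr (P : {poly int}) (n : nat) :
  (ext0 moebius P.[n%:Z] ^+ 2 == 1) = (0 < P.[n%:Z]) && squarefree (absval P n).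
Proof.
rewrite /ext0 /moebius /absval; case: (0 < _) => //=.
by case: (squarefree _) => //; rewrite sqrr_sign eqxx.
Qed.

Lemma nb_squarefree_valuesE (P : {poly int}) (N : nat) :
  nb_squarefree_values P N = #|@admissible_index P N|.
Proof.
rewrite -sum1_card big_mkcond.
rewrite (eq_bigr (fun n : 'I_N.+1 => admissible P n : nat)); last first.
  by move=> n _; rewrite unfold_in /admissible_index; case: (admissible P n).
rewrite sum_bool_count /= /nb_squarefree_values /index_iota subn1 /=.
rewrite -[iota 1 N]/(iota 1 N) add0n; apply: eq_in_count => n.
by rewrite mem_iota => /andP[n1 _]; rewrite ext0_moebius_sqr /admissible n1.
Qed.

(** Distinct supports are orthogonal. Below n0 values may coincide, so up to n0 + 1 indices can
    share a support; a bound independent of N is enough for Chebyshev's inequality. *)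
Lemma mean_walsh_sum_sqr (R : realFieldType) (P : {poly int}) (N n0 : nat) (s : R) :
  (forall m n, (n0 <= m)%N -> (m < n)%N -> (absval P m < absval P n)%N) ->
  s ^+ 2 = #|@admissible_index P N|%:R ->
  mean (fun w => walsh_sum (@prime_support P N) (@admissible_index P N) s w ^+ 2) <= n0.+1%:R.
Proof.
move=> Fmono sB; set S := @prime_support P N.
have s2 : 0 <= (s ^+ 2)^-1 by rewrite invr_ge0 sqr_ge0.
rewrite (@eq_mean _ _ _ (fun w => (s ^+ 2)^-1 * \sum_(n | @admissible_index P N n) \sum_(m | @admissible_index P N m)
   walsh R (S n) w * walsh R (S m) w)); last first.
  by move=> w; rewrite /walsh_sum exprMn exprVn mulrC [X in _ * X = _]expr2 big_distrlr.
rewrite meanZ mean_sum.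
apply: (@le_trans _ _ ((s ^+ 2)^-1 * (\sum_(n | @admissible_index P N n) n0.+1%:R))); last first.
  rewrite sumr_const -[_ *+ #|_|]mulr_natr mulrCA -sB.
  have [->|s0] := eqVneq (s ^+ 2) 0; first by rewrite !mulr0.
  by rewrite mulVf// mulr1.
rewrite ler_wpM2l//; apply: ler_sum => n Bn; rewrite mean_sum.
apply: (@le_trans _ _ (\sum_(m | @admissible_index P N m) (S n == S m)%:R)).
  apply: ler_sum => m _; case: eqVneq => [e|ne]; last by rewrite mean_walsh2.
  apply: le_trans (ler_norm _) _; apply: mean_norm_le; first exact: card_Omega_gt0.
  by move=> w; rewrite normrM !normr_walsh mulr1.
rewrite -natr_sum ler_nat -[n0.+1]addn1.
apply: (@leq_trans (\sum_(m < N.+1) (m < n0)%N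
   + \sum_(m < N.+1) [&& (n0 <= m)%N, squarefree (absval P m) & absval P m == absval P n])%N).
  rewrite big_mkcond -big_split; apply: leq_sum => m _ /=; case: ifP => // Bm.
  have /and3P[_ _ sn] := Bn; have /and3P[_ _ sm] := Bm.
  case: eqP => // e; case: ltnP => // _; rewrite sm /= add0n.
  by rewrite (prime_support_absval sm sn) ?eqxx.
apply: leq_add.
  rewrite (@sum_bool_count N.+1 (fun m => m < n0)%N) -size_filter -[n0 in leqRHS](size_iota 0).
  apply: uniq_leq_size; first by rewrite filter_uniq ?iota_uniq.
  by move=> x; rewrite mem_filter !mem_iota => /andP[].
apply: (@sum_bool_le1 N.+1 (fun m => [&& (n0 <= m)%N, squarefree (absval P m)
   & absval P m == absval P n])) => x y.
move=> /and3P[x0 sx /eqP ex] /and3P[y0 sy /eqP ey].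
by apply: (good_inj Fmono); rewrite ?/good ?x0 ?y0// ex.
Qed.

(** [stein_bound] is applied with lambda = delta s: then lambda a / s^3 <= delta and dq / (lambda
    s^3) = dq / (delta s^4), so the Taylor remainder has the same shape as the off-diagonal
    error. *)
Lemma stein_error_arith (R : realFieldType) (G0 G1 G2 delta s a b lq dq T : R) :
  0 <= G0 -> 0 <= G1 -> 0 <= G2 -> 0 < delta -> 1 <= s -> a <= s ^+ 2 -> 0 <= b ->
  lq <= T -> dq <= T ->
  (G0 / s + G1 / s ^+ 2) * b + G1 * (delta + lq / (delta * s ^+ 4))
    + 2%:R * G2 / s ^+ 3 * ((delta * s) * a + dq / (delta * s)) <=
  (G0 + G1) * b / s + (G1 + 2%:R * G2) * (delta + T / (delta * s ^+ 4)).
Proof.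
move=> G00 G10 G20 d0 s1 as2 b0 lT dT.
have s0 : 0 < s by lra.
have i0 : 0 < s^-1 by rewrite invr_gt0.
have i1 : s^-1 <= 1 by rewrite invf_le1.
have d4 : 0 <= (delta * s ^+ 4)^-1 by rewrite invr_ge0 mulr_ge0 ?exprn_ge0// ltW.
have h1 : (G0 / s + G1 / s ^+ 2) * b <= (G0 + G1) * b / s.
  rewrite -mulrA [b / s]mulrC mulrA ler_wpM2r// mulrDl lerD2l ler_wpM2l//.
  by rewrite -exprVn expr2 ler_piMr// ltW.
have h2 : lq / (delta * s ^+ 4) <= T / (delta * s ^+ 4) by rewrite ler_wpM2r.
have h3 : dq / (delta * s ^+ 4) <= T / (delta * s ^+ 4) by rewrite ler_wpM2r.
have h4 : 2%:R * G2 / s ^+ 3 * ((delta * s) * a + dq / (delta * s)) =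
   2%:R * G2 * (delta * (a / s ^+ 2) + dq / (delta * s ^+ 4)).
  by field; rewrite !gt_eqF.
have h5 : delta * (a / s ^+ 2) <= delta.
  by rewrite ler_piMr ?(ltW d0)// ler_pdivrMr ?exprn_gt0// mul1r.
have h6 : G1 * (delta + lq / (delta * s ^+ 4)) <= G1 * (delta + T / (delta * s ^+ 4)).
  by rewrite ler_wpM2l// lerD2l.
have h7 : 2%:R * G2 * (delta * (a / s ^+ 2) + dq / (delta * s ^+ 4)) <=
    2%:R * G2 * (delta + T / (delta * s ^+ 4)).
  by rewrite ler_wpM2l ?mulr_ge0// lerD.
by rewrite h4 mulrDl; lra.
Qed.

Lemma nat_upper_bound (R : realType) (x : R) : exists n : nat, forall m, (n <= m)%N -> x <= m%:R.
Proof.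
exists (Num.Def.archi_bound `|x|) => m nm; apply: le_trans (ler_norm x) _.
by apply: le_trans (ltW (archi_boundP (normr_ge0 x))) _; rewrite ler_nat.
Qed.

Lemma linked_quads_real (R : realFieldType) (P : {poly int}) (N n0 K : nat) : (0 < K)%N ->
  lead_coef P != 0 ->
  (forall m n, (n0 <= m)%N -> (m < n)%N -> (absval P m < absval P n)%N) ->
  (forall n, (n < n0)%N -> (absval P n <= K)%N) ->
  (linked_quads (@prime_support P N) (@has_large_prime P N K) (@admissible_index P N) (big_prime P K))%:R <=
  2%:R * (nroots_bound P)%:R * (N.+1%:R ^+ 2 / K%:R + N.+1%:R)
    + (nquad (absval P) n0 N.+1)%:R :> R.
Proof.
move=> K0 l0 Fmono FK; set k := nroots_bound P.
have KR : 0 < K%:R :> R by rewrite ltr0n.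
apply: (@le_trans _ _ (2 * (\sum_(n | @has_large_prime P N K n) multiples (big_prime P K n))
    + nquad (absval P) n0 N.+1)%N%:R).
  rewrite ler_nat; have h := @linked_quads_le P N n0 K Fmono FK.
  by apply: (leq_trans h); rewrite leq_add2r leq_mul2l sum_linked_le.
rewrite natrD natrM lerD2r -mulrA ler_wpM2l// natr_sum.
have -> : k%:R * (N.+1%:R ^+ 2 / K%:R + N.+1%:R) =
    N.+1%:R * (k%:R * (N.+1%:R / K%:R + 1)) :> R by field; rewrite gt_eqF.
apply: (@le_trans _ _ (\sum_(n | @has_large_prime P N K n) k%:R * (N.+1%:R / K%:R + 1))).
  apply: ler_sum => n An; have [Kp _] := big_primeP An.
  set p := big_prime P K n in Kp *.
  apply: (@le_trans _ _ (k * (N.+1 %/ val (val p)).+1)%N%:R).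
    by rewrite ler_nat multiples_le.
  rewrite natrM ler_wpM2l// -natr1 lerD2r ler_pdivlMr// -natrM ler_nat.
  apply: leq_trans (leq_trunc_div _ (val (val p))).
  by rewrite leq_mul2l ltnW ?orbT.
rewrite sumr_const -[_ *+ #|_|]mulr_natr mulrC; apply: ler_wpM2r.
  by rewrite mulr_ge0// addr_ge0// divr_ge0.
by rewrite ler_nat -[leqRHS]card_ord max_card.
Qed.

Definition normalized_walsh_sum (R : realType) (P : {poly int}) (N : nat) :
    {ffun small_prime P N -> bool} -> R :=
  walsh_sum (@prime_support P N) (@admissible_index P N) (Num.sqrt #|@admissible_index P N|%:R).

Lemma stein_asymptotic (R : realType) (P : {poly int}) (n0 N1 : nat) (c : R) :
  lead_coef P != 0 ->
  (forall m n, (n0 <= m)%N -> (m < n)%N -> (absval P m < absval P n)%N) ->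
  (forall n, (n0 <= n)%N -> (n <= absval P n)%N) ->
  (forall m, exists N0, forall N, (N0 <= N)%N -> exists w,
    (forall a, (a < N)%N -> good (absval P) n0 a -> size (primes (absval P a)) <= w)%N /\
    (m * w.+1 * nquad (absval P) n0 N <= N ^ 2)%N) ->
  0 < c -> (forall N, (N1 <= N)%N -> c * N.+1%:R <= #|@admissible_index P N|%:R) ->
  forall (g g1 : R -> R) (G0 G1 G2 : R), (forall x, `|g x| <= G0) ->
    (forall x, `|g1 x| <= G1) ->
    (forall x h, `|g x - g (x - h) - h * g1 x| <= G2 * h ^+ 2) ->
  forall eps, 0 < eps -> exists N0, forall N, (N0 <= N)%N ->
    `|mean (fun w => g1 (@normalized_walsh_sum R P N w)
        - @normalized_walsh_sum R P N w * g (@normalized_walsh_sum R P N w))| <= eps.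
Proof.
move=> l0 Fmono Fn hq c0 dens g g1 G0 G1 G2 gG0 gG1 gG2 eps eps0.
have G00 : 0 <= G0 := le_trans (normr_ge0 _) (gG0 0).
have G10 : 0 <= G1 := le_trans (normr_ge0 _) (gG1 0).
have G20 : 0 <= G2.
  by have := le_trans (normr_ge0 _) (gG2 0 1); rewrite expr1n mulr1.
pose G := G1 + 2%:R * G2; have Gge0 : 0 <= G by rewrite /G; lra.
pose k : R := (nroots_bound P)%:R.
have k1 : 1 <= k by rewrite ler1n nroots_bound_gt0.
(* First delta depends on eps, then K and m on delta, and finally N on all of them. The three thirds
   of eps go to the n without large prime, to delta, and to the fourth-moment counts. *)
pose delta := eps / (3%:R * (G + 1)).
have d0 : 0 < delta by rewrite divr_gt0// mulr_gt0//; lra.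
have Gd : G * delta <= eps / 3%:R.
  rewrite /delta mulrA ler_pdivrMr ?mulr_gt0//; last lra.
  by rewrite mulrA divfK// mulrDr mulr1 mulrC lerDl ltW.
pose H := G / (delta * c ^+ 2).
have H0 : 0 <= H by rewrite divr_ge0// mulr_ge0 ?exprn_ge0// ltW.
have [K0 hK0] := nat_upper_bound (9%:R * (6%:R * k ^+ 2 * H) / eps).
have [m hm] := nat_upper_bound (9%:R * H / eps).
pose K := (K0 + \max_(n < n0) absval P n + 1)%N.
have K1 : (0 < K)%N by rewrite /K addn1.
have KR : 0 < K%:R :> R by rewrite ltr0n.
have FK n : (n < n0)%N -> (absval P n <= K)%N.
  move=> nn; apply: (@leq_trans (\max_(n < n0) absval P n)); last by rewrite /K addnAC leq_addl.
  exact: (leq_bigmax (F := fun n : 'I_n0 => absval P n) (Ordinal nn)).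
have [Nq hNq] := hq m.+1.
pose bK : R := (n0 + K`!.+1)%N%:R.
pose Y := 3%:R * ((G0 + G1) * bK) / eps.
have Y0 : 0 <= Y by rewrite divr_ge0 ?mulr_ge0 ?addr_ge0// ltW.
have [N2 hN2] := nat_upper_bound ((Y ^+ 2 + 1) / c).
exists (maxn (maxn N1 Nq) (maxn N2 K0))%N => N.
rewrite !geq_max => /andP[/andP[NN1 NNq] /andP[NN2 NK0]].
rewrite /normalized_walsh_sum; set nb := #|@admissible_index P N|; pose s : R := Num.sqrt nb%:R; pose x : R := N.+1%:R.
have x0 : 0 < x by rewrite ltr0n.
have s2 : s ^+ 2 = nb%:R by rewrite sqr_sqrtr.
have cx : c * x <= s ^+ 2 by rewrite s2 dens.
have sY : Y ^+ 2 + 1 <= s ^+ 2.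
  apply: le_trans cx; rewrite mulrC -ler_pdivrMr//; apply: hN2.
  exact: leq_trans NN2 (leqnSn N).
have s00 : 0 <= s by rewrite sqrtr_ge0.
have s1 : 1 <= s.
  rewrite -(@ler_pXn2r _ 2) ?nnegrE// expr1n.
  by have := sqr_ge0 Y; lra.
have Ys : Y <= s.
  by rewrite -(@ler_pXn2r _ 2) ?nnegrE//; lra.
have s0 : 0 < s by lra.
have ds0 : 0 < delta * s by rewrite mulr_gt0.
have Api n : @has_large_prime P N K n -> big_prime P K n \in @prime_support P N n.
  by move=> /big_primeP[].
have Sinj := @prime_support_inj P N n0 K Fmono FK.
apply: le_trans (stein_bound (@has_large_prime_admissible P N K) Api Sinj s0 s2 gG0 gG1 gG2 d0 ds0) _.
have [w [hw nqw]] := hNq N.+1 (leq_trans NNq (leqnSn N)).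
set nq := nquad (absval P) n0 N.+1 in nqw.
have nqR : (w.+1 * nq)%:R <= x ^+ 2 / m.+1%:R :> R.
  by rewrite ler_pdivlMr// -natrM -natrX ler_nat mulnC mulnA.
(* The factor 6 k^2 majorises both 2 k from the linked pairs and three times 2 k^2 from the squared
   numbers of multiples. *)
pose T := 6%:R * k ^+ 2 * (x ^+ 2 / K%:R + x) + x ^+ 2 / m.+1%:R.
have kk : 0 <= (x ^+ 2 / K%:R + x) by rewrite addr_ge0 ?(ltW x0)// divr_ge0// sqr_ge0.
have lT : (linked_quads (@prime_support P N) (@has_large_prime P N K) (@admissible_index P N) (big_prime P K))%:R <= T.
  apply: le_trans (linked_quads_real R N K1 l0 Fmono FK) _; apply: lerD.
    by rewrite ler_wpM2r// -/k; nra.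
  by apply: le_trans nqR; rewrite ler_nat leq_pmull.
have dT : (\sum_(p | [exists n : 'I_N.+1, @has_large_prime P N K n && (big_prime P K n == p)])
    divisible_quads (@prime_support P N) (@admissible_index P N) p)%N%:R <= T.
  have := sum_divisible_quads_le Fmono FK hw; rewrite -(ler_nat R) => h.
  apply: (le_trans h); rewrite natrD natrM; apply: lerD.
    have := sum_multiples_sqr_le R N K1 l0; rewrite -/k -/x => h2.
    by apply: le_trans (ler_wpM2l (ler0n _ 3) h2) _; rewrite !mulrA -natrM.
  by apply: le_trans nqR; rewrite ler_nat leq_mul.
have bb : #|[pred n | @admissible_index P N n && ~~ @has_large_prime P N K n]|%:R <= bK.
  rewrite ler_nat; apply: leq_trans (count_smooth_values K N.+1 Fn).
  rewrite -sum1_card big_mkcond; apply: leq_sum => n _; rewrite unfold_in /=.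
  case: ifP => // /andP[Bn /negP nA]; have /and3P[_ _ sn] := Bn.
  rewrite sn lt0b; apply/allP => q; rewrite mem_primes => /and3P[pq Fn0 qF].
  rewrite leqNgt; apply/negP => Kq; apply: nA; rewrite /has_large_prime -/(admissible_index P n) Bn.
  have [p pE] := prime_dvd_support pq Fn0 qF.
  by apply/existsP; exists p; rewrite in_prime_support pE Kq.
have as2 : #|@has_large_prime P N K|%:R <= s ^+ 2.
  by rewrite s2 ler_nat; apply: subset_leq_card; apply/fintype.subsetP => n; exact: has_large_prime_admissible.
apply: le_trans (stein_error_arith G00 G10 G20 d0 s1 as2 _ lT dT) _ => //.
have e1 : (G0 + G1) * #|[pred n | @admissible_index P N n && ~~ @has_large_prime P N K n]|%:R / s <= eps / 3%:R.
  rewrite ler_pdivrMr//; apply: (@le_trans _ _ ((G0 + G1) * bK)).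
    by rewrite ler_wpM2l// addr_ge0.
  apply: (@le_trans _ _ (eps / 3%:R * Y)); last by rewrite ler_wpM2l// divr_ge0// ltW.
  by rewrite le_eqVlt; apply/orP; left; apply/eqP; rewrite /Y; field; rewrite gt_eqF.
have e2 : G * (T / (delta * s ^+ 4)) <= eps / 3%:R.
  have T0 : 0 <= T by rewrite addr_ge0 ?mulr_ge0 ?sqr_ge0// ?divr_ge0 ?sqr_ge0//; lra.
  have s4 : c ^+ 2 * x ^+ 2 <= s ^+ 4.
    rewrite (_ : s ^+ 4 = (s ^+ 2) ^+ 2); last by rewrite -exprM.
    by rewrite -exprMn lerXn2r ?nnegrE ?sqr_ge0// mulr_ge0// ltW.
  apply: (@le_trans _ _ (H * (T / x ^+ 2))).
    rewrite (_ : H * _ = G * (T / (delta * (c ^+ 2 * x ^+ 2)))); last first.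
      by rewrite /H; field; rewrite !gt_eqF.
    have q1 : 0 < delta * (c ^+ 2 * x ^+ 2).
      by apply: mulr_gt0 => //; apply: mulr_gt0; exact: exprn_gt0.
    have q2 : 0 < delta * s ^+ 4 by apply: mulr_gt0 => //; exact: exprn_gt0.
    do 2!(apply: ler_wpM2l => //).
    by rewrite lef_pV2 ?posrE// ler_pM2l.
  have -> : T / x ^+ 2 = 6%:R * k ^+ 2 / K%:R + 6%:R * k ^+ 2 / x + m.+1%:R^-1.
    by rewrite /T; field; rewrite !gt_eqF//.
  have aux u v : 0 < v -> 9%:R * u / eps <= v -> u / v <= eps / 9%:R.
    by move=> v0; rewrite !ler_pdivrMr//; lra.
  have K9 : 6%:R * k ^+ 2 * H / K%:R <= eps / 9%:R.
    by apply: aux => //; apply: hK0; rewrite /K -addnA leq_addr.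
  have x9 : 6%:R * k ^+ 2 * H / x <= eps / 9%:R.
    by apply: aux => //; apply: hK0; exact: leq_trans NK0 (leqnSn N).
  have m9 : H / m.+1%:R <= eps / 9%:R by apply: aux => //; exact: hm.
  apply: (@le_trans _ _ (eps / 9%:R + eps / 9%:R + eps / 9%:R)); last first.
    by rewrite le_eqVlt; apply/orP; left; apply/eqP; field.
  apply: le_trans (lerD (lerD K9 x9) m9).
  by rewrite le_eqVlt; apply/orP; left; apply/eqP; ring.
rewrite -/G [G * _]mulrDr; apply: le_trans (lerD e1 (lerD Gd e2)) _.
by rewrite le_eqVlt; apply/orP; left; apply/eqP; field.
Qed.

(** * Transfer to the random multiplicative function *)

Section Transfer.
Context (R : realType) (d : measure_display) (T : measurableType d) (Pr : probability T R).

Lemma measure_finite_union (I : finType) (F : I -> set T) (Q : pred I) :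
  (forall i, measurable (F i)) -> (forall i j, i != j -> F i `&` F j = set0) ->
  Pr (\bigcup_(i in [set i | Q i]) F i) = (\sum_(i | Q i) Pr (F i))%E.
Proof.
move=> mF dF.
have main (s : seq I) : uniq s ->
    Pr (\big[setU/set0]_(i <- s) F i) = (\sum_(i <- s) Pr (F i))%E.
  elim: s => [|i s IH] /=; first by rewrite !big_nil measure0.
  move=> /andP[nis us]; rewrite !big_cons measureU//.
  - by congr (_ + _)%E; exact: IH.
  - exact: bigsetU_measurable.
  - apply/seteqP; split=> // t [Fi]; rewrite -bigcup_seq => -[j js Fj].
    have ij : i != j by apply: contra nis => /eqP ->.
    by rewrite -(dF i j ij).
rewrite -big_filter -main ?filter_uniq ?index_enum_uniq//; congr (Pr _).
rewrite -bigcup_seq; apply/seteqP; split=> t [i /= Qi Fi]; exists i => //=.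
  by rewrite mem_filter Qi mem_index_enum.
by move: Qi; rewrite mem_filter => /andP[].
Qed.

Variables (f : nat -> {RV Pr >-> R}) (P : {poly int}) (N : nat).
Hypothesis fR : rademacher_multiplicative f.
Local Notation I := (small_prime P N).
Local Notation Omega := {ffun I -> bool}.
Local Notation F := (absval P).

(** [independent_family] takes sets indexed by all naturals; indices other than small primes are
    left unconstrained. *)
Definition sign_set (w : Omega) (q : nat) : set R :=
  if [pick p : I | val (val p) == q] is Some p then [set (-1) ^+ w p] else setT.

Definition small_primes : {fset nat} := [fset x in map (fun p : I => val (val p)) (enum I)]%fset.

Definition atom (w : Omega) : set T :=
  \bigcap_(q in [set` small_primes]) (f q @^-1` sign_set w q).

Lemma sign_setE w p : sign_set w (val (val p)) = [set (-1) ^+ w p].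
Proof.
rewrite /sign_set; case: pickP => [q /eqP e|/(_ p)]; last by rewrite eqxx.
by have -> : q = p by exact/val_inj/val_inj.
Qed.

Lemma small_primesP q : reflect (exists p : I, val (val p) = q) (q \in small_primes).
Proof.
rewrite !inE; apply: (iffP mapP) => [[p _ ->]|[p <-]]; first by exists p.
by exists p => //; rewrite mem_enum.
Qed.

Lemma atomP w t : atom w t -> forall p : I, f (val (val p)) t = (-1) ^+ w p.
Proof.
move=> at_ p; have /= := at_ (val (val p)); rewrite sign_setE; apply.
by apply/small_primesP; exists p.
Qed.

Lemma measurable_sign_set w q : measurable (sign_set w q).
Proof. by rewrite /sign_set; case: pickP. Qed.

Lemma measurable_atom w : measurable (atom w).
Proof.
apply: fin_bigcap_measurable; first exact: finite_fset.
move=> q _; rewrite -[X in measurable X]setTI; apply: measurable_funP => //.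
exact: measurable_sign_set.
Qed.

Lemma atom_disjoint w w' : w != w' -> atom w `&` atom w' = set0.
Proof.
move=> ww; apply/seteqP; split=> // t [a1 a2].
move/eqP: ww; apply; apply/ffunP => p; apply/(@signr_inj R).
by rewrite -(atomP a1) -(atomP a2).
Qed.

Lemma Pr_atom w : Pr (atom w) = (#|{: Omega}|%:R^-1)%:E.
Proof.
have [law ind _ _] := fR.
rewrite /atom ind; last 2 first.
- by move=> q /small_primesP[p <-] /=; exact: (valP p).
- exact: measurable_sign_set.
rewrite big_seq (eq_bigr (fun=> (2%:R^-1)%:E)); last first.
  move=> q /small_primesP[p <-]; rewrite sign_setE.
  have [l1 l2] := law _ (valP p : prime (val (val p))).
  by case: (w p); rewrite ?expr0 ?expr1; [exact: l2|exact: l1].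
rewrite -big_seq big_const_seq count_predT.
have -> n : iter n (mule (2%:R^-1)%:E) 1%E = ((2%:R^-1) ^+ n)%:E :> \bar R.
  by elim: n => // n IH; rewrite iterS IH exprS EFinM.
have -> : size small_primes = #|I|.
  rewrite cardE -(size_map (fun p : I => val (val p))); apply: perm_size.
  apply: uniq_perm; first exact: fset_uniq.
    by rewrite map_inj_uniq ?enum_uniq// => x y /val_inj/val_inj.
  by move=> q; rewrite !inE.
by rewrite exprVn card_ffun card_bool natrX.
Qed.

Lemma prod_primes_walsh w t (n : 'I_N.+1) : atom w t -> (0 < F n)%N ->
  \prod_(p <- primes (F n)) f p t = walsh R (prime_support P n) w.
Proof.
move=> at_ n0; rewrite /walsh -big_enum.
rewrite (perm_big (map (fun p : I => val (val p)) (enum (prime_support P n)))); last first.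
  apply: uniq_perm; first exact: primes_uniq.
    by rewrite map_inj_uniq ?enum_uniq// => x y /val_inj/val_inj.
  move=> q; apply/idP/mapP => [|[p]].
    rewrite mem_primes => /and3P[pq _ qn].
    have [p pE] := prime_dvd_support pq n0 qn; exists p => //.
    by rewrite mem_enum in_prime_support pE.
  rewrite mem_enum in_prime_support => pn ->; rewrite mem_primes n0 pn !andbT.
  exact: (valP p).
by rewrite big_map; apply: eq_bigr => p _; exact: atomP.
Qed.

Lemma normalized_sum_atom w t : atom w t ->
  normalized_sum f P N t = normalized_walsh_sum R w.
Proof.
move=> at_; have [_ _ sq nsq] := fR.
rewrite /normalized_sum /normalized_walsh_sum /walsh_sum mulrC nb_squarefree_valuesE.
congr (_ / _); rewrite big_geq_mkord big_mkcond [RHS]big_mkcond.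
apply: eq_bigr => n _; rewrite /admissible_index /admissible /ext0 /=.
case: (0 < val n)%N => //=; case: (boolP (0 < P.[_])) => //= Pn.
have Fn0 : (0 < F n)%N by rewrite /absval absz_gt0 gt_eqF.
case: (boolP (squarefree _)) => [sn|nsn]; last exact: nsq.
by rewrite sq// (prod_primes_walsh at_ Fn0).
Qed.

(** E contains every atom on which h is nonzero, and h <= 1. The atoms may miss a null event where
    some f p is not a sign, which a lower bound tolerates. *)
Lemma Pr_ge_mean (E : set T) (h : R -> R) : measurable E ->
  (forall x, 0 <= h x <= 1) ->
  (forall t, h (normalized_sum f P N t) != 0 -> E t) ->
  ((mean (fun w : Omega => h (normalized_walsh_sum R w)))%:E <= Pr E)%E.
Proof.
move=> mE h01 hE; pose Q w := h (@normalized_walsh_sum R P N w) != 0.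
apply: (@le_trans _ _ (Pr (\bigcup_(w in [set w | Q w]) atom w))); last first.
  apply: le_measure; rewrite ?inE//.
    apply: fin_bigcup_measurable; first exact: finite_finset.
    by move=> w _; exact: measurable_atom.
  move=> t [w /= Qw at_]; apply: hE.
  by rewrite (normalized_sum_atom at_).
rewrite (measure_finite_union _ measurable_atom atom_disjoint).
rewrite (eq_bigr (fun=> (#|{: Omega}|%:R^-1)%:E)) => [|w _]; last exact: Pr_atom.
rewrite sumEFin lee_fin /mean mulr_suml [leRHS]big_mkcond.
apply: ler_sum => w _; rewrite -/(Q w); case: (boolP (Q w)).
  by rewrite ler_piMl ?invr_ge0//; case/andP: (h01 (normalized_walsh_sum R w)).
by rewrite negbK => /eqP ->; rewrite mul0r.
Qed.

End Transfer.

(** Some tail infimum is positive, and it is finite since it lies below the real number u n. *)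
Lemma positive_liminf (R : realType) (u : nat -> R) :
  (0 < limn_einf (fun N => (u N)%:E))%E ->
  exists2 c : R, 0 < c & exists N1, forall N, (N1 <= N)%N -> c <= u N.
Proof.
rewrite limn_einf_lim => l0.
have [n hn] : exists n, (0 < einfs (fun N => (u N)%:E) n)%E.
  apply: contrapT => /forallNP h; move: l0; apply/negP; rewrite -leNgt.
  apply: lime_le; first exact: is_cvg_einfs.
  by apply: nearW => n; rewrite leNgt; apply/negP/h.
have le m : (n <= m)%N -> (einfs (fun N => (u N)%:E) n <= (u m)%:E)%E.
  by move=> nm; apply: ereal_inf_lbound; exists m.
move: hn le; case: (einfs _ n) => [c|//|//] c0 le.
  by exists c; rewrite -?lte_fin//; exists n => m /le; rewrite lee_fin.
by have := le n (leqnn n).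
Qed.

Theorem theorem1p1 (R : realType) (P : {poly int})
    (d : measure_display) (T : measurableType d) (Pr : probability T R)
    (f : nat -> {RV Pr >-> R}) :
  separable R P ->
  (2 <= (size P).-1)%N ->
  0 < lead_coef P ->
  (0 < limn_einf
         (fun N : nat => ((nb_squarefree_values P N)%:R / N%:R : R)%:E))%E ->
  rademacher_multiplicative f ->
  cvg_in_distribution
    (fun N : nat => normalized_sum f P N : {RV Pr >-> R})
    (normal_prob 0 1).
Proof.
move=> _ sP lP dens fR.
have [e sPe] : exists e, size P = e.+3.
  by move: sP; case: (size P) => [|[|[|e]]]// _; exists e.
have lP0 : lead_coef P != 0 by rewrite gt_eqF.
have [n0 [C [K [n08 Fpos Fmono Fub gap]]]] := absval_growth R sPe lP.
have Fsq n : (n0 <= n)%N -> (n ^ 2 <= 8 * absval P n)%N by move=> /Fpos[].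
have Fn n : (n0 <= n)%N -> (n <= absval P n)%N.
  move=> nn; have := Fsq n nn; have := leq_trans n08 nn; rewrite -mulnn; nia.
have [t [D [t1 hD]]] := nquad_bound lP n08 Fsq Fmono Fub gap.
have hq := nquad_littleo t1 hD.
have [c c0 [N1 hN1]] := positive_liminf dens.
(* Halving c replaces N by N + 1, the size of the index type ['I_N.+1]. *)
have densB N : (N1.+1 <= N)%N -> c / 2%:R * N.+1%:R <= #|@admissible_index P N|%:R.
  move=> NN; have N0 : 0 < N%:R :> R by rewrite ltr0n; lia.
  have := hN1 N (ltnW NN); rewrite ler_pdivlMr// nb_squarefree_valuesE.
  apply: le_trans; rewrite -mulrA ler_wpM2l ?(ltW c0)//.
  rewrite ler_pdivrMl// -natr1; have : 1 <= N%:R :> R by rewrite ler1n; lia.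
  by lra.
have c20 : 0 < c / 2%:R by rewrite divr_gt0.
have stein := stein_asymptotic lP0 Fmono Fn hq c20 densB.
have tight N : mean (fun w => @normalized_walsh_sum R P N w ^+ 2) <= n0.+1%:R.
  by apply: mean_walsh_sum_sqr => //; rewrite sqr_sqrtr.
have weak := weak_lower_bound (fun N => card_Omega_gt0 (small_prime P N)) stein tight.
move=> x _; pose g : R := fine (normal_prob 0 1 `]-oo, x]%classic).
have gE : normal_prob 0 1 `]-oo, x]%classic = g%:E :> \bar R.
  by rewrite fineK// fin_num_measure.
have gC : fine (normal_prob 0 1 `]x, +oo[%classic) = 1 - g.
  have -> : `]x, +oo[%classic = ~` `]-oo, x]%classic :> set R by rewrite setCitvl.
  transitivity (fine (1%:E - g%:E)%E); last by [].
  by congr fine; rewrite -gE; apply: (probability_setC (normal_prob (0 : R) 1)).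
pose X N : {RV Pr >-> R} := normalized_sum f P N.
have FE N : cdf (X N) x = (fine (cdf (X N) x))%:E.
  by rewrite fineK// fin_num_measure.
suff : (fun N => fine (cdf (X N) x)) @ \oo --> g.
  move=> cv; rewrite -[X in _ --> X]/(normal_prob 0 1 `]-oo, x]%classic) gE.
  by apply: cvg_EFin cv; apply: nearW => N; rewrite FE.
apply/cvgrPdist_le => eps eps0.
have e2 : 0 < eps / 2%:R by rewrite divr_gt0.
have [a1 [b1 [e1 [e10 be1 h1]]]] := trapezoid_below x e2.
have [a2 [b2 [e3 [e30 ae2 h2]]]] := trapezoid_above x e2.
have [M1 hM1] := weak a1 b1 e1 e10 _ e2.
have [M2 hM2] := weak a2 b2 e3 e30 _ e2.
exists (maxn M1 M2) => // N /=; rewrite geq_max => /andP[NM1 NM2].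
have mX : measurable (X N @^-1` `]-oo, x]%classic).
  by rewrite -[X in measurable X]setTI; apply: measurable_funP.
have low : g - eps <= fine (cdf (X N) x).
  have := hM1 N NM1.
  have : ((mean (fun w => trapezoid a1 b1 e1 (@normalized_walsh_sum R P N w)))%:E
      <= cdf (X N) x)%E.
    apply: (Pr_ge_mean fR) => // [y|y hy]; first exact: trapezoid_bounds.
    rewrite /= in_itv /= leNgt; apply: contra hy => xy; apply/eqP/trapezoid_eq0 => //.
    by rewrite (le_trans be1 (ltW xy)) orbT.
  rewrite FE lee_fin; move: h1; rewrite -/g; lra.
(* The upper bound on the distribution function is a lower bound for the complementary event,
   because the two Gaussian half-lines have total mass 1. *)
have up : 1 - g - eps <= 1 - fine (cdf (X N) x).
  have := hM2 N NM2.
  have : ((mean (fun w => trapezoid a2 b2 e3 (@normalized_walsh_sum R P N w)))%:E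
      <= Pr (~` (X N @^-1` `]-oo, x]%classic)))%E.
    apply: (Pr_ge_mean fR) => [|y|y hy]; first exact: measurableC.
      exact: trapezoid_bounds.
    rewrite /= in_itv /= => yx; move/eqP: hy; apply; apply: trapezoid_eq0 => //.
    by rewrite (le_trans yx ae2).
  rewrite probability_setC// -[Pr _]/(cdf (X N) x) FE -EFinB lee_fin.
  by move: h2; rewrite gC; lra.
by rewrite ler_norml; apply/andP; split; lra.
Qed.
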